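(* Let $A$ be any associative, not necessarily commutative, Frobenius algebra. Then the assumption of commutativity of $A$ is unnecessary for the Hochschild cochain operations defined from arc systems by correlation functions: all of these operations are defined for the Hochschild cochains of $A$. Moreover, for a surface $S$ of genus $g$ with $b$ decorated boundary components, where the $i$-th boundary is decorated by elements $a^i_1,\dots,a^i_{n_i}\in A$, the local correlation function is $$Y(S)\Big(\bigotimes_{j=1}^b\bigotimes_{i=1}^{n_j}a_i^j\Big)=\Big\langle (a_1^1\cdots a^1_{n_1})\prod_{l=2}^b\Big(\sum C_l^{(1)}a_1^l\cdots a^l_{n_l}C_l^{(2)}\Big)\prod_{k=1}^g\Big(\sum_{C_{k1},C_{k2}}C^{(1)}_{k1}C^{(1)}_{k2}C^{(2)}_{k1}C^{(2)}_{k2}\Big)\Big\rangle ,$$ which is the correlation function $Y_A(S)$ of the marked surface $S$ in the $2$d open topological field theory (OTFT) defined by $A$.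
   Context: A Frobenius algebra $A$ is an associative, unital (possibly $\mathbb Z/2\mathbb Z$-graded) algebra over $k=\mathbb Z$ with an even, symmetric, perfect pairing satisfying $\langle a,bc\rangle=\langle ab,c\rangle$; $\langle a\rangle=\langle 1,a\rangle$. The coproduct $\Delta$ is defined by $\langle\Delta(a),b\otimes c\rangle=\langle a,bc\rangle$, where $\langle a\otimes b,c\otimes d\rangle=\langle a,c\rangle\langle b,d\rangle$; $\Delta(1)=\sum C^{(1)}\otimes C^{(2)}$ is the Casimir element, and $C_l,C_{k1},C_{k2}$ denote independent copies of it. Koszul signs are suppressed. Local correlation functions: let $S$ be an oriented surface with enumerated boundary components, each carrying marked intervals decorated by elements of $A$. Choose a system of extra arcs (cuts) decomposing $S$ into polygons. For each cut decorate one side by $C^{(1)}$ and the other side by $C^{(2)}$ of one copy of the Casimir element. To each polygon with decorations $x_1,\dots,x_m$ in cyclic order assign $\langle x_1\cdots x_m\rangle$, take the product over all polygons, and sum over the Sweedler sums for all cuts. The result is the local correlation function $Y(S)$ and a priori depends on the choice of cuts; ''being defined'' means being independent of this choice. Operations from arc systems: an arc system on a surface $\Sigma$ with one marked point on each boundary component is a set of pairwise non-intersecting, pairwise non-parallel, not boundary-parallel arcs running between boundaries and avoiding the marked points. One replaces arcs by parallel copies in all possible ways, decorates the boundary intervals between consecutive arcs by elements of $A$ (some intervals may be designated inactive, i.e. decorated by the unit), and takes the product of the local correlation functions of all complementary regions; the sum over all multiplicities defines correlation functions on tensor powers of $\bigoplus_n A^{\otimes n+1}$. These become operations on Hochschild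 cochains $CH^*(A,A)$ by identifying $A^{\otimes n+1}\simeq CH^n(A,A)$ and dualizing output slots via the pairing. *)

(* Defs.v *)
From HB Require Import structures.
From mathcomp Require Import all_boot all_order all_algebra.

Set Implicit Arguments.
Unset Strict Implicit.
Unset Printing Implicit Defensive.

Import GRing.Theory.
Local Open Scope ring_scope.

(** [gr p a] is the component of [a] of parity [p] ([true] means odd), so that
    an ungraded algebra is one with [gr true a = 0] for all [a].  The ring is
    not assumed to be commutative.  Every ring is a Z-algebra, and biadditive
    means Z-bilinear. *)
Record frobenius := Frobenius {
  frob_ring :> pzRingType;
  gr : bool -> frob_ring -> frob_ring;
  pairing : frob_ring -> frob_ring -> int;
  grD : forall p a b, gr p (a + b) = gr p a + gr p b;
  gr_sum : forall a, gr false a + gr true a = a;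
  gr_gr : forall p q a, gr p (gr q a) = if p == q then gr q a else 0;
  gr_one : gr false 1 = 1;
  gr_mul : forall p q a b,
    gr (p (+) q) (gr p a * gr q b) = gr p a * gr q b;
  pairingDl : forall a b c, pairing (a + b) c = pairing a c + pairing b c;
  pairingDr : forall a b c, pairing a (b + c) = pairing a b + pairing a c;
  pairing_even : forall p q a b, p != q -> pairing (gr p a) (gr q b) = 0;
  pairing_sym : forall p q a b,
    pairing (gr p a) (gr q b) = (-1) ^+ (p && q) * pairing (gr q b) (gr p a);
  pairing_mul : forall a b c, pairing a (b * c) = pairing (a * b) c;
  pairing_perfect : forall f : {additive frob_ring -> int},
    exists! a, forall b, pairing a b = f b
}.

Definition bracket (A : frobenius) (a : A) : int := pairing 1 a.

(** Sign of the rearrangement of the word [r] into the word [s] when exactly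
    the letters in [o] are odd: one factor -1 for each inverted odd pair. *)
Definition koszul (L : finType) (o : {set L}) (r s : seq L) : int :=
  (-1) ^+ #|[set u : L * L |
    [&& u.1 \in o, u.2 \in o, (index u.1 r < index u.2 r)%N
      & (index u.2 s < index u.1 s)%N]]|.

(** The product over the words [p] in [ps] of <\prod_(l <- p) x l>, where the
    letters are initially ordered as in [r].  Summing over the set [o] of odd
    letters splits every [x l] into homogeneous components, so that the result
    is multilinear in [x]. *)
Definition signed_brackets (A : frobenius) (L : finType)
    (r : seq L) (ps : seq (seq L)) (x : L -> A) : int :=
  \sum_(o : {set L} | o \subset r)
    koszul o r (flatten ps) *
    \prod_(p <- ps) bracket (\prod_(l <- p) gr (l \in o) (x l)).

(** <s_1 (x) .. (x) s_N, t_1 (x) .. (x) t_N> = +- <s_1, t_1> .. <s_N, t_N>;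
    the letter (b, k) stands for the k-th factor of [t] if [b], else of [s]. *)
Definition tensor_pairing (A : frobenius) (s t : seq A) : int :=
  signed_brackets
    [seq (b, k) | b <- [:: false; true], k <- enum 'I_(size s)]
    [seq [:: (false, k); (true, k)] | k <- enum 'I_(size s)]
    (fun l : bool * 'I_(size s) => nth 0 (if l.1 then t else s) l.2).

(** A Sweedler presentation of Delta(1).  It determines the tensor uniquely,
    and one exists as soon as the abelian group A is finitely generated;
    conversely, it forces A to be spanned by the [cas2 i]. *)
Record casimir (A : frobenius) := Casimir {
  cas_idx : finType;
  cas1 : cas_idx -> A;
  cas2 : cas_idx -> A;
  casP : forall b c : A,
    \sum_i tensor_pairing [:: cas1 i; cas2 i] [:: b; c] = bracket (b * c)
}.

(** \sum C^(1) a C^(2): the sign comes from moving C^(2) past [a]. *)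
Definition cas_conj (A : frobenius) (C : casimir A) (a : A) : A :=
  \sum_(i : cas_idx C) \sum_p \sum_q
    (-1) ^+ (p && q) * (cas1 i * gr q a * gr p (cas2 i)).

(** \sum C_1^(1) C_2^(1) C_1^(2) C_2^(2): the sign comes from exchanging
    C_1^(2) and C_2^(1). *)
Definition cas_handle (A : frobenius) (C : casimir A) : A :=
  \sum_(i : cas_idx C) \sum_(j : cas_idx C) \sum_p \sum_q
    (-1) ^+ (p && q) *
    (cas1 i * gr q (cas1 j) * gr p (cas2 i) * cas2 j).

(** Letters label the sides met when running along the boundary of a piece of
    a cut surface, with the induced orientation: [inl d] is a marked interval
    and [inr (c, e)] one of the two sides of the cut [c].  Two consecutive sides
    are separated by an unmarked segment of the boundary of the surface. *)
Definition letter (D K : finType) : finType := (D + K * bool)%type.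

Section CutSurfaces.
Variables D K : finType.
Implicit Types ps : seq (seq (letter D K)).

Definition flip (l : letter D K) : letter D K :=
  if l is inr (c, e) then inr (c, ~~ e) else l.

Definition marking (l : letter D K) : option D :=
  if l is inl d then Some d else None.

(** The successor of [l] in the cyclic word of [ps] to which it belongs. *)
Definition side_next ps (l : letter D K) : letter D K :=
  next (nth [::] ps (find (fun p => l \in p) ps)) l.

(** A side also stands for the boundary segment that follows it.  That segment
    ends at the side [side_next ps l]; if this is a side of a cut, then the
    boundary of the surface continues with the segment following the opposite
    side of that cut. *)
Definition boundary_next ps (l : letter D K) : letter D K :=
  flip (side_next ps l).

Definition adjacent ps : rel 'I_(size ps) := fun i j =>
  [exists s : K * bool,
     (inr s \in nth [::] ps i) && (flip (inr s) \in nth [::] ps j)].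

Definition connected ps : Prop :=
  forall i j : 'I_(size ps), connect (@adjacent ps) i j.

(** The walks are the boundary components of the surface glued from [ps]. The
    exception concerns the disc without marked intervals and without cuts: it is
    a polygon with no side, and its boundary is the empty walk. *)
Definition has_boundary ps (bd : seq (seq D)) : Prop :=
  exists walks : seq (seq (letter D K)),
    [/\ perm_eq (flatten walks) (flatten ps),
        all (fcycle (boundary_next ps)) walks,
        [::] \notin walks \/ ps = [:: [::]]
      & map (pmap marking) walks = bd].

End CutSurfaces.

(** A system of cuts into polygons of the connected oriented surface of genus
    [g] whose boundary components carry the marked intervals listed, in cyclic
    order, by the words in [bd].  Such a surface is determined by these data
    up to homeomorphism, and so is a system of cuts by the words around its
    polygons.  The last condition computes the Euler characteristic. *)
Record cut_system (D : finType) (g : nat) (bd : seq (seq D)) := CutSystem {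
  cut_num : nat;
  polygons : seq (seq (letter D 'I_cut_num));
  cut_sides : perm_eq (flatten polygons)
    (map inl (flatten bd) ++
     [seq inr (c, e) | c <- enum 'I_cut_num, e <- [:: false; true]]);
  cut_connected : connected polygons;
  cut_boundary : has_boundary polygons bd;
  cut_euler : (size polygons + 2 * g + size bd = cut_num + 2)%N
}.

(** The local correlation function Y(S), computed with the cuts [X]. *)
Definition local_corr (A : frobenius) (C : casimir A) (D : finType)
    (g : nat) (bd : seq (seq D)) (X : cut_system g bd) (a : D -> A) : int :=
  \sum_(i : {ffun 'I_(cut_num X) -> cas_idx C})
    signed_brackets
      (map inl (flatten bd) ++
       [seq inr (c, e) | c <- enum 'I_(cut_num X), e <- [:: false; true]])
      (polygons X)
      (fun l => match l with
                | inl d => a d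
                | inr (c, e) => if e then cas2 (i c) else cas1 (i c)
                end).

(** [homog p s]: the entries of [s] are homogeneous, of total parity [p]. *)
Fixpoint homog (A : frobenius) (p : bool) (s : seq A) : Prop :=
  if s is a :: s' then exists q, gr q a = a /\ homog (p (+) q) s'
  else p = false.

(** [Z g bs] is the correlation function of the connected surface of genus [g]
    whose boundary components carry marked intervals decorated by the words
    in [bs].  Sewing two marked intervals inserts the Casimir element; the two
    intervals may lie on one boundary component, on two components of the same
    surface, or on two surfaces.  The disc with marked intervals decorated
    by [s] has the value determined by the Frobenius algebra. *)
Record otft_of (A : frobenius) (C : casimir A)
    (Z : nat -> seq (seq A) -> int) : Prop := OTFT {
  otft_add : forall g bs bs' s t x y,
    Z g (bs ++ (s ++ x + y :: t) :: bs') =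
      Z g (bs ++ (s ++ x :: t) :: bs') + Z g (bs ++ (s ++ y :: t) :: bs');
  otft_rot : forall g bs s x p q, homog p s -> gr q x = x ->
    Z g ((x :: s) :: bs) = (-1) ^+ (p && q) * Z g (rcons s x :: bs);
  otft_swap : forall g bs bs' s t p q, homog p s -> homog q t ->
    Z g (bs ++ s :: t :: bs') = (-1) ^+ (p && q) * Z g (bs ++ t :: s :: bs');
  otft_sew1 : forall g bs s t p, homog p s ->
    Z g (s :: t :: bs) = \sum_(i : cas_idx C) \sum_q
      (-1) ^+ (p && q) * Z g ((cas1 i :: s ++ gr q (cas2 i) :: t) :: bs);
  otft_sew2 : forall g bs s t p, homog p s ->
    Z g.+1 ((s ++ t) :: bs) = \sum_(i : cas_idx C) \sum_q
      (-1) ^+ (p && q) * Z g ((cas1 i :: s) :: (gr q (cas2 i) :: t) :: bs);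
  otft_sew3 : forall g g' bs bs' s t p q r,
    homog p s -> homog q t -> homog r (flatten bs) ->
    Z (g + g')%N ((s ++ t) :: bs ++ bs') = \sum_(i : cas_idx C) \sum_u
      (-1) ^+ (u && (p (+) r)) * (-1) ^+ (q && r) *
      (Z g ((cas1 i :: s) :: bs) * Z g' ((gr u (cas2 i) :: t) :: bs'));
  otft_disc : forall s, Z 0%N [:: s] = bracket (\prod_(x <- s) x)
}.

(** An arc system on a connected oriented surface of genus [genus] with
    boundary components [0 .. nbd - 1].  It is described by its complementary
    regions, each given by its genus and the words around its boundary
    components.  In a word, [inr (e, b)] is a side of the arc [e]; as before it
    also stands for the boundary interval following it.  A boundary component
    [i] that is not hit by any arc consists of a single interval, which
    appears as the one-letter word [inl i].  [base i] is the interval that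
    contains the marked point of the boundary component [i]. *)
Record arc_system := ArcSystem {
  arcs : finType;
  nbd : nat;
  nbd_gt0 : (0 < nbd)%N;
  genus : nat;
  regions : seq (nat * seq (seq (letter 'I_nbd arcs)));
  base : 'I_nbd -> letter 'I_nbd arcs;
  words := flatten (map snd regions);
  intervals := flatten words;
  intervals_uniq : uniq intervals;
  sides_in : forall s, inr s \in intervals;
  words_nonempty : [::] \notin words;
  word_free : forall w i, w \in words -> inl i \in w -> w = [:: inl i];
  regions_bounded : forall r, r \in regions -> r.2 != [::];
  base_in : forall i, base i \in intervals;
  base_uniq : forall t, t \in intervals ->
    exists! i, fconnect (boundary_next words) (base i) t;
  base_free : forall i j, base i = inl j -> i = j;
  arcs_connected : connected [seq flatten r.2 | r <- regions];
  arcs_euler :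
    \sum_(r <- regions) (2 - 2 * r.1%:Z - (size r.2)%:Z) - #|arcs|%:Z =
      2 - 2 * genus%:Z - nbd%:Z;
  not_boundary_parallel : forall s, (0%N, [:: [:: inr s]]) \notin regions;
  not_parallel : forall s s', (0%N, [:: [:: inr s; inr s']]) \in regions ->
    exists i, base i \in [:: inr s; inr s']
}.

Section Thickening.
Variables (S : arc_system) (m : arcs S -> nat).

(** Each arc [e] is replaced by [m e + 1] parallel copies, the copy 0 being
    the one whose side [true] faces the region on the side [true] of [e]. *)
Definition copy : finType := {e : arcs S & 'I_(m e).+1}.

Definition copy_of (e : arcs S) (k : 'I_(m e).+1) : copy :=
  Tagged (fun e => 'I_(m e).+1) k.

Definition thick_letter (l : letter 'I_(nbd S) (arcs S)) :
    letter 'I_(nbd S) copy :=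
  match l with
  | inl i => inl i
  | inr (e, b) => inr (copy_of (if b then ord0 else ord_max : 'I_(m e).+1), b)
  end.

Definition strip (e : arcs S) (k : 'I_(m e)) :
    nat * seq (seq (letter 'I_(nbd S) copy)) :=
  (0%N, [:: [:: inr (copy_of (widen_ord (leqnSn _) k), false);
                inr (copy_of (lift ord0 k), true)]]).

Definition thick_regions : seq (nat * seq (seq (letter 'I_(nbd S) copy))) :=
  [seq (r.1, map (map thick_letter) r.2) | r <- regions S] ++
  flatten [seq [seq strip k | k <- enum 'I_(m e)] | e <- enum (arcs S)].

Definition thick_words := flatten (map snd thick_regions).

(** The active intervals of the boundary component [i], starting with the one
    that contains the marked point.  Inputs are read along the induced
    orientation of the boundary and outputs ([i \in out]) against it, so that
    an annulus with one arc joining an input to an output gives the identity.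
    The intervals between parallel copies of an arc are always active. *)
Definition active (inact : {set letter 'I_(nbd S) (arcs S)})
    (out : {set 'I_(nbd S)}) (i : 'I_(nbd S)) :
    seq (letter 'I_(nbd S) copy) :=
  let s := orbit (boundary_next thick_words) (thick_letter (base i)) in
  [seq t <- (if i \in out then rotr 1 (rev s) else s)
   | t \notin [seq thick_letter l | l <- enum inact]].

End Thickening.

(** A choice of cuts for all complementary regions, for all multiplicities. *)
Definition region_cuts (S : arc_system) : Type :=
  forall (m : arcs S -> nat) (j : 'I_(size (thick_regions m))),
    cut_system (tnth (in_tuple (thick_regions m)) j).1
               (tnth (in_tuple (thick_regions m)) j).2.

Section ArcCorrelators.
Variables (A : frobenius) (C : casimir A) (S : arc_system).
Variables (X : region_cuts S) (inact : {set letter 'I_(nbd S) (arcs S)}).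
Variable out : {set 'I_(nbd S)}.

(** The input on the boundary component [i] is the pure tensor whose factors
    are the entries of [nth [::] ts i]. *)
Definition decoration (m : arcs S -> nat) (ts : seq (seq A))
    (l : letter 'I_(nbd S) (copy m)) : A :=
  if [pick i | l \in active m inact out i] is Some i
  then nth 0 (nth [::] ts i) (index l (active m inact out i)) else 1.

Definition thick_corr (m : arcs S -> nat) (ts : seq (seq A)) : int :=
  let src := flatten [seq active m inact out i | i <- enum 'I_(nbd S)] in
  \sum_(o : {set letter 'I_(nbd S) (copy m)} | o \subset src)
    koszul o src (flatten (thick_words m)) *
    \prod_j local_corr C (X (m := m) j)
              (fun l => gr (l \in o) (decoration ts l)).

(** Sum over the multiplicities for which the numbers of active intervals
    match the numbers of tensor factors.  The bound on [m] excludes none of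
    them, as each additional copy of an arc creates two active intervals. *)
Definition arc_corr (ts : seq (seq A)) : int :=
  \sum_(m : {ffun arcs S -> 'I_(size (flatten ts)).+1} |
        [forall i, size (active (fun e => m e) inact out i)
                   == size (nth [::] ts i)])
    thick_corr (fun e => m e) ts.

End ArcCorrelators.

(** CH^n(A, A): multiadditive maps in [n] variables. *)
Record cochain (A : frobenius) (n : nat) := Cochain {
  cochain_fun :> {ffun 'I_n -> A} -> A;
  cochain_add : forall (k : 'I_n) (x y z : {ffun 'I_n -> A}),
    (forall j, j != k -> x j = y j /\ x j = z j) -> x k = y k + z k ->
    cochain_fun x = cochain_fun y + cochain_fun z
}.

(** Elements of A^{(x) N} are represented by lists of pure tensors.  The image
    of [f] under CH^n(A, A) ~ A^{(x) n+1} is the sum of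
    +- f(C_1^(1), .., C_n^(1)) (x) C_1^(2) (x) .. (x) C_n^(2), where the sign
    comes from moving all C_k^(1) to the left; [o] is the set of the [k] for
    which C_k is replaced by the product of the odd components. *)
Definition cochain_tensor (A : frobenius) (C : casimir A) (n : nat)
    (f : cochain A n) : seq (seq A) :=
  [seq (-1) ^+ 'C(#|o|, 2) *
       f [ffun k => gr (k \in o) (cas1 (i k))]
       :: [seq gr (k \in o) (cas2 (i k)) | k <- enum 'I_n]
  | i : {ffun 'I_n -> cas_idx C} <- enum {ffun 'I_n -> cas_idx C},
    o : {set 'I_n} <- enum {set 'I_n}].

(** Extension of [F] from pure tensors to lists of pure tensors. *)
Fixpoint multi_ext (T : Type) (F : seq T -> int) (ts : seq (seq T)) : int :=
  if ts is t :: ts' then \sum_(u <- t) multi_ext (fun us => F (u :: us)) ts'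
  else F [::].

Section HochschildOperations.
Variables (A : frobenius) (C : casimir A) (S : arc_system).
Variables (out : {set 'I_(nbd S)}) (n : 'I_(nbd S) -> nat).

(** The correlation function of [S] on cochains [f i] in the input slots and
    pure tensors [x i] in the output slots [i \in out]; the values of [f] on
    [out] and of [x] outside [out] are not used. *)
Definition hoch_corr (X : region_cuts S)
    (inact : {set letter 'I_(nbd S) (arcs S)})
    (f : forall i, cochain A (n i)) (x : 'I_(nbd S) -> seq A) : int :=
  multi_ext (arc_corr C X inact out)
    [seq if i \in out then [:: x i] else cochain_tensor C (f i)
    | i <- enum 'I_(nbd S)].

(** An element of the tensor product of the CH^{n i}(A, A) for [i \in out] is
    represented by an integral combination [T] of families of cochains, of
    which only the members indexed by [out] matter. *)
Definition output_pairing (T : seq (int * (forall i, cochain A (n i))))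
    (x : 'I_(nbd S) -> seq A) : int :=
  \sum_(c <- T) c.1 *
    multi_ext (fun us => tensor_pairing (flatten us)
                           (flatten [seq x i | i <- enum out]))
      [seq cochain_tensor C (c.2 i) | i <- enum out].

(** [T] is the value on the cochains [f] of the operation defined by [S],
    computed with the cuts [X]: it is obtained from the correlation function
    by dualizing the output slots.  As the pairing is perfect, this determines
    the element of the tensor product represented by [T]. *)
Definition hoch_operation (X : region_cuts S)
    (inact : {set letter 'I_(nbd S) (arcs S)})
    (f : forall i, cochain A (n i))
    (T : seq (int * (forall i, cochain A (n i)))) : Prop :=
  forall x, (forall i, i \in out -> size (x i) = (n i).+1) ->
    output_pairing T x = hoch_corr X inact f x.

End HochschildOperations.

(* Main.v *)
(** Write [phi a] for [\sum C^(1) a C^(2)] and [H] for [\sum phi(C^(1)) C^(2)].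
    As the Casimir element is inverse to the pairing, [phi a] and [H] are graded
    central and [phi] is self-adjoint.  Hence
      Z g (w, v_2, .., v_b) = <w phi(v_2) .. phi(v_b) H^g>
    satisfies the three sewing axioms, and these axioms reduce any other open
    theory to its values on discs.  A local correlation function is thus computed
    by sewing the polygons along the cuts one at a time, in any order: each step
    yields again a disjoint union of surfaces evaluated by [Z], with known
    boundary walks and Euler characteristic, so that the result is [Z] of the
    glued surface whatever the cuts are.  The correlators of an arc system are
    therefore sums of products of values of [Z]; they are additive in every tensor
    factor because each active interval lies in exactly one complementary region,
    so the output slots can be dualized by expanding them in the Casimir element. *)

Require Import Defs.
From HB Require Import structures.
From mathcomp Require Import all_boot all_order all_algebra.
From mathcomp Require Import zify ring.

Set Implicit Arguments.
Unset Strict Implicit.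
Unset Printing Implicit Defensive.

Import GRing.Theory.
Local Open Scope ring_scope.

(** * Koszul signs *)

(** Two obstacles shape the proof. The first is signs: [cas1 i] and [cas2 i] are not homogeneous,
    whereas the sewing laws and the Koszul signs make sense for homogeneous letters only. Values are
    therefore sums over the set [o] of odd letters. The Casimir tensor is even, so the choices with
    just one side of a cut odd contribute 0 once the Casimir index is summed, and the two other
    choices form the sum over a parity in the sewing laws. The second obstacle is bookkeeping during
    the gluing. A glued side is not erased: it stays in its word, decorated by 1. The alphabet and
    the reference order [r] thus never change, and each side goes on naming the boundary segment
    after it. Gluing a cut then composes the successor in the words with one transposition, a single
    rule for the three topological cases, and connectedness is tracked by colourings of the letters.
    For the operations, the correlator is first rewritten without cuts, as a function of the
    concatenated output tensors; its expansion yields one value valid for all cuts. *)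

Section Koszul.
Variable L : finType.
Implicit Types (o : {set L}) (r s a b c d : seq L) (u v : L).

Lemma index_filter_lt (p : pred L) s u v : p u -> p v ->
  (index u (filter p s) < index v (filter p s))%N
    = (index u s < index v s)%N.
Proof.
move=> pu pv; elim: s => //= x s IHs; case: ifP => px /=.
  by case: eqP => _; case: eqP => _; rewrite ?ltnS.
by case: eqP => [eq_xu|_]; [rewrite eq_xu pu in px | case: eqP => [eq_xv|_];
  [rewrite eq_xv pv in px | rewrite IHs ltnS]].
Qed.

(** Only inversions between odd letters count, and filtering preserves their relative order. Hence
    even letters, such as glued sides decorated by 1, can be inserted in or removed from either word
    without a sign. *)
Lemma koszul_filter o r s r' s' :
  filter (mem o) r = filter (mem o) r' -> filter (mem o) s = filter (mem o) s' ->
  koszul o r s = koszul o r' s'.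
Proof.
move=> eq_r eq_s; rewrite /koszul; congr (_ ^+ _); apply: eq_card => u.
rewrite !inE; case: (boolP (u.1 \in o)) => //= o1.
case: (boolP (u.2 \in o)) => //= o2.
rewrite -(@index_filter_lt (mem o) r) // -(@index_filter_lt (mem o) s) //.
by rewrite -(@index_filter_lt (mem o) r') // -(@index_filter_lt (mem o) s') //
  eq_r eq_s.
Qed.

Lemma koszul_id o r : koszul o r r = 1.
Proof.
rewrite /koszul (_ : [set _ | _] = set0) ?cards0 //; apply/setP => u.
by rewrite !inE; apply/negP => /and4P[_ _ lt1 /(ltn_trans lt1)]; rewrite ltnn.
Qed.

Lemma koszul_sym o r s : koszul o r s = koszul o s r.
Proof.
rewrite /koszul; congr (_ ^+ _).
have swap_inj : injective (fun p : L * L => (p.2, p.1)) by case=> u v [w x] [-> ->].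
rewrite -(card_imset _ swap_inj); apply: eq_card => -[u v].
apply/imsetP/idP => [[[u' v']]|]; rewrite !inE /=.
  by case/and4P=> o1 o2 lt1 lt2 [-> ->]; apply/and4P.
by case/and4P=> o1 o2 lt1 lt2; exists (v, u) => //; rewrite !inE; apply/and4P.
Qed.

(** Only the pair of [u] and [v] changes its inversion status, and it counts only if both are odd.
    The hypothesis [u \in r] makes their positions in [r] differ: letters absent from [r] share the
    index [size r]. *)
Lemma koszul_adjacent o r a d u v : uniq (a ++ u :: v :: d) -> u \in r ->
  koszul o r (a ++ u :: v :: d) =
    (-1) ^+ ((u \in o) && (v \in o)) * koszul o r (a ++ v :: u :: d).
Proof.
move=> uniq_s r_u.
have [/andP[ou ov]|no_uv] := boolP ((u \in o) && (v \in o)); last first.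
  rewrite mul1r; apply: koszul_filter => //; rewrite !filter_cat /=.
  by move: no_uv; do 2 case: (_ \in o).
have neq_uv: u != v.
  move: uniq_s; rewrite cat_uniq => /and3P[_ _ /=].
  by rewrite inE negb_or => /andP[/andP[]].
set s := a ++ _; set s' := a ++ v :: u :: d.
have [a'u a'v]: u \notin a /\ v \notin a.
  move: uniq_s; rewrite cat_uniq => /and3P[_ /hasPn dis _].
  by split; apply: dis; rewrite !inE eqxx ?orbT.
have idxE w : w != u -> w != v ->
    index w s = index w s' /\
    (index w s < size a)%N || ((size a).+1 < index w s)%N.
  rewrite !index_cat /= ![u == _]eq_sym ![v == _]eq_sym => /negbTE-> /negbTE->.
  case: ifP => [|_]; first by rewrite -index_mem => ->.
  by rewrite !addnS !ltnS leq_addr orbT.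
have su: index u s = size a by rewrite index_cat (negbTE a'u) /= eqxx addn0.
have sv: index v s = (size a).+1.
  by rewrite index_cat (negbTE a'v) /= (negbTE neq_uv) eqxx addn1.
have s'u: index u s' = (size a).+1.
  by rewrite index_cat (negbTE a'u) /= eq_sym (negbTE neq_uv) eqxx addn1.
have s'v: index v s' = size a by rewrite index_cat (negbTE a'v) /= eqxx addn0.
(* Every other letter has its index before [n] or after [n.+1], with [n = size a], so it compares in
   the same way with both positions. *)
have gap k n : (k < n)%N || (n.+1 < k)%N ->
    (n < k)%N = (n.+1 < k)%N /\ (k < n.+1)%N = (k < n)%N.
  by clear; case/orP=> lt1; split; apply/idP/idP => ?; lia.
have ltE w x : (w, x) != (u, v) -> (w, x) != (v, u) ->
    (index w s < index x s)%N = (index w s' < index x s')%N.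
  rewrite !xpair_eqE.
  have [->|wu] := eqVneq w u; [|have [->|wv] := eqVneq w v];
    have [->|xu] := eqVneq x u; rewrite ?ltnn //;
    try (have [->|xv] := eqVneq x v); rewrite ?ltnn ?eqxx //= => _ _.
  - by have [<- /gap[lt1 lt2]] := idxE _ xu xv; rewrite su s'u.
  - by have [<- /gap[lt1 lt2]] := idxE _ xu xv; rewrite sv s'v.
  - by have [<- /gap[lt1 lt2]] := idxE _ wu wv; rewrite su s'u.
  - by have [<- /gap[lt1 lt2]] := idxE _ wu wv; rewrite sv s'v.
  - by have [<- _] := idxE _ wu wv; have [<- _] := idxE _ xu xv.
have neq_uvvu : ((u, v) == (v, u)) = false.
  by rewrite xpair_eqE (negbTE neq_uv).
have neq_r: index u r != index v r.
  apply/negP => /eqP eq_i; case/negP: neq_uv; apply/eqP.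
  rewrite -(nth_index u r_u) eq_i nth_index //.
  by rewrite -index_mem -eq_i index_mem.
rewrite /koszul -exprD.
set I := [set _ | _]; set I' := [set _ | _].
have [lt_uv|] := ltnP (index u r) (index v r).
  have -> : I' = (u, v) |: I.
    apply/setP => -[w x]; rewrite !inE /=.
    have [[-> ->]|n1] := eqVneq (w, x) (u, v).
      by rewrite ou ov lt_uv s'u s'v ltnS leqnn.
    have [[-> ->]|n2] := eqVneq (w, x) (v, u).
      by rewrite (ltnNge (index v r)) (ltnW lt_uv) !andbF.
    by rewrite /= ltE // xpair_eqE andbC -xpair_eqE.
  rewrite cardsU1 !inE /= su sv [((size a).+1 < _)%N]ltnNge leqnSn !andbF /=.
  by rewrite add1n !exprS !mulN1r opprK.
rewrite leq_eqVlt eq_sym (negbTE neq_r) /= => lt_vu.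
have -> : I = (v, u) |: I'.
  apply/setP => -[w x]; rewrite !inE /=.
  have [[-> ->]|n1] := eqVneq (w, x) (v, u).
    by rewrite ou ov lt_vu su sv ltnS leqnn.
  have [[-> ->]|n2] := eqVneq (w, x) (u, v).
    by rewrite (ltnNge (index u r)) (ltnW lt_vu) !andbF.
  by rewrite /= -ltE // xpair_eqE andbC -xpair_eqE.
by rewrite cardsU1 !inE /= s'u s'v [((size a).+1 < _)%N]ltnNge leqnSn !andbF
  ?ou ?ov.
Qed.

Definition odd_in o s := odd (count (mem o) s).

Lemma odd_in_cat o s t : odd_in o (s ++ t) = odd_in o s (+) odd_in o t.
Proof. by rewrite /odd_in count_cat oddD. Qed.

Lemma odd_in_cons o u s : odd_in o (u :: s) = (u \in o) (+) odd_in o s.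
Proof. by rewrite /odd_in /= oddD; case: (u \in o). Qed.

Lemma uniq_middle (a d : seq L) (u : L) :
  uniq (a ++ u :: d) = (u \notin a ++ d) && uniq (a ++ d).
Proof. exact: (perm_uniq (permEl (perm_catCA a [:: u] d))). Qed.

Lemma koszul_swap1 o r a b d u : uniq (a ++ u :: b ++ d) -> u \in r ->
  koszul o r (a ++ u :: b ++ d) =
    (-1) ^+ ((u \in o) && odd_in o b) * koszul o r (a ++ b ++ u :: d).
Proof.
move=> + ru; elim: b a => [|v b IHb] a uniq_s; first by rewrite andbF mul1r.
rewrite /= koszul_adjacent //= -cat_rcons IHb; last first.
  rewrite cat_rcons; move: uniq_s; apply: etrans; apply: perm_uniq.
  by rewrite perm_cat2l; apply/permP => p /=; lia.
rewrite cat_rcons mulrA; congr (_ * _).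
by rewrite odd_in_cons -signr_addb; case: (u \in o); case: (v \in o); case: odd_in.
Qed.

Lemma koszul_swap o r a b c d : uniq (a ++ b ++ c ++ d) -> {subset b <= r} ->
  koszul o r (a ++ b ++ c ++ d) =
    (-1) ^+ (odd_in o b && odd_in o c) * koszul o r (a ++ c ++ b ++ d).
Proof.
move=> + + ; elim: b a => [|u b IHb] a uniq_s sub_b; first by rewrite mul1r.
rewrite cat_cons -cat_rcons IHb; first last.
- by move=> x bx; apply: sub_b; rewrite inE bx orbT.
- by rewrite cat_rcons.
rewrite cat_rcons koszul_swap1; first last.
- by apply: sub_b; rewrite mem_head.
- move: uniq_s; apply: etrans; apply: perm_uniq.
  by apply/permP => p; rewrite !count_cat /= !count_cat /=; lia.
rewrite mulrA odd_in_cons; congr (_ * _).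
by rewrite -signr_addb; case: (u \in o); case: (odd_in o b); case: odd_in.
Qed.

(** A letter that comes first in both words is in no inversion, so its parity cannot affect the
    sign. *)
Lemma koszul_cons o r s u :
  koszul o (u :: r) (u :: s) = koszul (o :\ u) (u :: r) (u :: s).
Proof.
rewrite /koszul; congr (_ ^+ _); apply: eq_card => -[w x].
rewrite !inE /= ![u == _]eq_sym; case: (w =P u) => _ /=; first by rewrite !andbF.
by case: (x =P u) => _ /=; rewrite ?andbF.
Qed.

(** The cost of turning both sides [u], [v] of a cut odd. In the reference word they are neighbours
    and travel to the front as a block of even parity, without sign; in the other word [v] has to
    pass [a] to rejoin [u]. Once both words start with [u :: v], [koszul_cons] makes the two letters
    even again. *)
Lemma koszul_pair o r1 r2 u v a d :
  uniq (r1 ++ u :: v :: r2) -> uniq (u :: a ++ v :: d) ->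
  {subset a ++ d <= r1 ++ r2} -> u \notin o -> v \notin o ->
  koszul (u |: (v |: o)) (r1 ++ u :: v :: r2) (u :: a ++ v :: d) =
    (-1) ^+ odd_in o a * koszul o (r1 ++ u :: v :: r2) (u :: a ++ v :: d).
Proof.
move=> uniq_r uniq_s sub_s ou ov; set o2 := u |: _.
have neq_uv : (u == v) = false.
  by apply/negbTE; move: uniq_s; rewrite /= mem_cat inE !negb_or;
    case/andP => /and3P[].
have odd_in_eq t : u \notin t -> v \notin t -> odd_in o2 t = odd_in o t.
  rewrite /odd_in => tu tv; congr odd; apply: eq_in_count => x tx.
  rewrite /= !inE; case: eqP => [eq_x|_]; first by rewrite -eq_x tx in tu.
  by case: eqP => [eq_x|//]; rewrite -eq_x tx in tv.
have /and4P[au av du dv] : [&& u \notin a, v \notin a, u \notin d & v \notin d].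
  move: uniq_s; rewrite -cat_cons uniq_middle /= !(mem_cat, inE) !negb_or.
  by case/and3P=> /and3P[_ -> ->] /andP[-> ->].
have /and4P[r1u r1v r2u r2v] :
    [&& u \notin r1, v \notin r1, u \notin r2 & v \notin r2].
  move: uniq_r; rewrite !uniq_middle.
  rewrite !(mem_cat, inE) !negb_or.
  by case/and3P=> /and3P[-> _ ->] /andP[-> ->].
have ruv : u \in r1 ++ u :: v :: r2 /\ v \in r1 ++ u :: v :: r2.
  by rewrite !mem_cat !inE !eqxx !orbT.
have -> : koszul o2 (r1 ++ u :: v :: r2) (u :: a ++ v :: d) =
   (-1) ^+ odd_in o2 a * koszul o2 (r1 ++ u :: v :: r2) (u :: v :: a ++ d).
  rewrite (@koszul_swap1 _ _ [:: u] a d v _ ruv.2); last first.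
    by rewrite uniq_middle -[[:: u] ++ _]/((u :: a) ++ d) -uniq_middle.
  by rewrite mulrA -signr_addb -/o2 !inE eqxx orbT addbb mul1r.
rewrite odd_in_eq //; congr (_ * _).
have -> : koszul o2 (r1 ++ u :: v :: r2) (u :: v :: a ++ d) =
   koszul o2 (u :: v :: r1 ++ r2) (u :: v :: a ++ d).
  rewrite [LHS]koszul_sym [RHS]koszul_sym.
  rewrite (@koszul_swap o2 _ [::] [:: u; v] r1 r2) //=; first last.
  - by move=> x; rewrite !inE => /orP[]/eqP->; rewrite eqxx ?orbT.
  - by move: uniq_r; rewrite !uniq_middle /= !inE !mem_cat !inE !negb_or neq_uv;
      case/and3P=> /and3P[-> _ ->] /andP[-> ->] ->.
  by rewrite !odd_in_cons !inE !eqxx !orbT mul1r.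
rewrite koszul_cons /o2 setU1K ?inE ?negb_or ?neq_uv //.
rewrite (@koszul_filter (v |: o) _ _ (v :: r1 ++ r2) (v :: a ++ d)); first last.
- by rewrite /= !inE neq_uv (negbTE ou).
- by rewrite /= !inE neq_uv (negbTE ou).
rewrite koszul_cons setU1K //; apply: koszul_filter.
  by rewrite /= !filter_cat /= (negbTE ou) (negbTE ov).
by rewrite /= !filter_cat /= (negbTE ou) (negbTE ov).
Qed.

End Koszul.

(** * Graded Frobenius algebras and the Casimir element *)

Section Frobenius.
Variable A : frobenius.
Implicit Types (a b c x y z : A) (p q r : bool).

Lemma gr_is_zmod_morphism p : zmod_morphism (@gr A p).
Proof.
have gr0 : gr p (0 : A) = 0.
  by apply: (addrI (gr p 0)); rewrite -grD !addr0.
move=> a b; rewrite grD; congr (_ + _); apply: (addrI (gr p b)).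
by rewrite -grD !subrr.
Qed.
HB.instance Definition _ p :=
  GRing.isZmodMorphism.Build A A (@gr A p) (gr_is_zmod_morphism p).

Lemma pairing_is_zmod_morphism a : zmod_morphism (@pairing A a).
Proof.
have p0 : pairing a (0 : A) = 0.
  by apply: (addrI (pairing a 0)); rewrite -pairingDr !addr0.
move=> b c; rewrite pairingDr; congr (_ + _); apply: (addrI (pairing a c)).
by rewrite -pairingDr !subrr.
Qed.
HB.instance Definition _ a :=
  GRing.isZmodMorphism.Build A int (@pairing A a) (pairing_is_zmod_morphism a).

(** With its arguments exchanged, the pairing can be declared additive in its left argument. *)
Definition pairing_l b a := pairing a b.

Lemma pairing_l_is_zmod_morphism a : zmod_morphism (pairing_l a).
Proof.
have p0 : pairing_l a 0 = 0.
  by apply: (addrI (pairing_l a 0)); rewrite -[LHS]pairingDl !addr0.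
move=> b c; rewrite {1}/pairing_l pairingDl; congr (_ + _).
by apply: (addrI (pairing_l a c)); rewrite -[LHS]pairingDl !subrr.
Qed.
HB.instance Definition _ a :=
  GRing.isZmodMorphism.Build A int (pairing_l a) (pairing_l_is_zmod_morphism a).

HB.instance Definition _ :=
  GRing.isZmodMorphism.Build A int (@bracket A) (pairing_is_zmod_morphism 1).

Lemma pairingE a b : pairing a b = bracket (a * b).
Proof. by rewrite /bracket pairing_mul mul1r. Qed.

Lemma pairing_inj a b : (forall c, pairing a c = pairing b c) -> a = b.
Proof.
move=> eq_ab; have [d [_ d_uniq]] := pairing_perfect (@pairing A a).
by rewrite -(d_uniq a (fun=> erefl)) -(d_uniq b (fun c => esym (eq_ab c))).
Qed.

Definition hom p a := gr p a = a.

Lemma gr_hom p a : hom p (gr p a).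
Proof. by rewrite /hom gr_gr eqxx. Qed.

Lemma hom_gr p q a : hom p a -> gr q a = if q == p then a else 0.
Proof. by move=> pa; rewrite -[in LHS]pa gr_gr pa; case: eqP. Qed.

Lemma hom0 p : hom p (0 : A).
Proof. exact: raddf0. Qed.

Lemma hom_sum p (I : Type) (s : seq I) (P : pred I) (f : I -> A) :
  (forall i, P i -> hom p (f i)) -> hom p (\sum_(i <- s | P i) f i).
Proof. by move=> hom_f; rewrite /hom raddf_sum; apply: eq_bigr. Qed.

Lemma homN p a : hom p a -> hom p (- a).
Proof. by move=> pa; rewrite /hom raddfN /= pa. Qed.

Lemma homM p q a b : hom p a -> hom q b -> hom (p (+) q) (a * b).
Proof. by move=> pa qb; rewrite /hom -[in LHS]pa -[in LHS]qb gr_mul pa qb. Qed.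

Lemma hom1 : hom false (1 : A).
Proof. exact: gr_one. Qed.

Lemma gr_sumE a : a = gr true a + gr false a.
Proof. by rewrite addrC gr_sum. Qed.

Lemma pairing_odd p q a b : hom p a -> hom q b -> p != q -> pairing a b = 0.
Proof. by move=> pa qb /(pairing_even a b); rewrite pa qb. Qed.

Lemma bracket_odd a : hom true a -> bracket a = 0.
Proof. by move=> a1; apply: (pairing_odd hom1 a1). Qed.

Lemma pairing_grl p a b : pairing (gr p a) b = pairing (gr p a) (gr p b).
Proof.
rewrite {1}[b]gr_sumE raddfD /=; case: p.
  by rewrite (pairing_odd (gr_hom _ _) (gr_hom false b)) // addr0.
by rewrite (pairing_odd (gr_hom _ _) (gr_hom true b)) // add0r.
Qed.

Lemma pairing_grr p a b : pairing a (gr p b) = pairing (gr p a) (gr p b).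
Proof.
rewrite {1}[a]gr_sumE pairingDl /=; case: p.
  by rewrite (pairing_odd (gr_hom false a) (gr_hom _ _)) // addr0.
by rewrite (pairing_odd (gr_hom true a) (gr_hom _ _)) // add0r.
Qed.

Lemma pairing_gr p a b : pairing (gr p a) b = pairing a (gr p b).
Proof. by rewrite pairing_grl -pairing_grr. Qed.

(** [sg p x] is x multiplied by the sign of its exchange with an element of
    parity [p]. *)
Definition sg p x : A := if p then gr false x - gr true x else x.

Lemma sg_is_zmod_morphism p : zmod_morphism (sg p).
Proof.
move=> a b; case: p => //=;  by rewrite !(raddfB (@gr A _)) !opprD !opprK addrACA.
Qed.
HB.instance Definition _ p :=
  GRing.isZmodMorphism.Build A A (sg p) (sg_is_zmod_morphism p).

Lemma sg_hom p q x : hom q x -> sg p x = (-1) ^+ (p && q) * x.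
Proof.
rewrite /sg => x_q; case: p => /=; last by rewrite mul1r.
rewrite !(hom_gr _ x_q); case: q {x_q}; rewrite ?sub0r ?subr0 ?mulN1r ?mul1r //.
Qed.

Lemma sgD p q x : sg p (sg q x) = sg (p (+) q) x.
Proof.
case: p q => -[] //=; rewrite /sg !(raddfB (@gr A _)) /= !gr_gr /= subr0 sub0r opprK.
by rewrite [RHS]gr_sumE addrC.
Qed.

Lemma sgD0 p x : sg p (sg p x) = x.
Proof. by rewrite sgD addbb. Qed.

Lemma hom_sg p q x : hom q x -> hom q (sg p x).
Proof.
move=> x_q; rewrite (sg_hom p x_q) mulr_sign.
by case: ifP => // _; apply: homN.
Qed.

Lemma sgM p x y : sg p (x * y) = sg p x * sg p y.
Proof.
rewrite [x]gr_sumE [y]gr_sumE !(mulrDl, mulrDr, raddfD) /=.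
have sgMh q r (u v : A) : hom q u -> hom r v -> sg p (u * v) = sg p u * sg p v.
  move=> uq vr; rewrite (sg_hom _ (homM uq vr)) (sg_hom _ uq) (sg_hom _ vr).
  case: p q r {uq vr} => -[] [];
    by rewrite /= ?expr0 ?expr1 ?mul1r ?mulN1r ?mulrN ?mulNr ?opprK.
by rewrite !(sgMh _ _ _ _ (gr_hom _ _) (gr_hom _ _)).
Qed.

Lemma bracket_sg p x : bracket (sg p x) = bracket x.
Proof.
have grE y : bracket y = bracket (gr false y).
  by rewrite /bracket -pairing_gr gr_one.
rewrite grE [RHS]grE; congr bracket; case: p => //=.
by rewrite (raddfB (@gr A _)) /= !gr_gr /= subr0.
Qed.

Arguments sg : simpl never.

Lemma pairing_sg p x y : pairing (sg p x) y = pairing x (sg p y).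
Proof. by rewrite !pairingE -(bracket_sg p) sgM sgD addbb. Qed.

(** Only the component of [y] of parity [p] pairs with [x], so the exchange sign may be charged to
    [x] alone, and [y] may be arbitrary. *)
Lemma bracketC p x y : hom p x -> bracket (x * y) = bracket (y * sg p x).
Proof.
move=> x_p; rewrite -!pairingE (sg_hom _ x_p) andbb.
rewrite -[in LHS]x_p pairing_grl pairing_sym andbb -pairing_grr x_p.
by rewrite !mulr_sign; case: p {x_p} => //; rewrite raddfN.
Qed.

Lemma bracketC' p x y : hom p x -> bracket (x * y) = bracket (sg p y * x).
Proof.
move=> x_p; rewrite (bracketC _ x_p) -(bracket_sg p) sgM sgD addbb //.
Qed.

(** [sg true] is the Nakayama automorphism of the form: it gives the right sign for each parity, so
    cyclicity holds without homogeneity assumptions. *)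
Lemma bracket_sgC x y : bracket (x * y) = bracket (y * sg true x).
Proof.
rewrite [x]gr_sumE mulrDl !raddfD mulrDr raddfD /=.
rewrite (bracketC _ (gr_hom true x)) (bracketC _ (gr_hom false x)).
by rewrite (sg_hom true (gr_hom false x)) mul1r.
Qed.

End Frobenius.

Arguments sg : simpl never.

(** * Signs in the pairing of tensors *)

Section TensorPairing.
Variable A : frobenius.

(** Sign of the shuffle of s_1 .. s_n t_1 .. t_n into s_1 t_1 .. s_n t_n, when the two factors at
    each position have the common parity listed in [ps]. *)
Definition tensor_sign n (ps : seq bool) : int :=
  koszul [set l : bool * 'I_n | nth false ps l.2]
    [seq (b, k) | b <- [:: false; true], k <- enum 'I_n]
    (flatten [seq [:: (false, k); (true, k)] | k <- enum 'I_n]).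

(** The hypothesis says that the pairing at position [k] only sees the parity recorded in [ps]; a
    single term of the sum over sets of odd letters then survives. *)
Lemma tensor_pairingE (s t : seq A) ps :
  (forall k p q, (p != nth false ps k) || (q != nth false ps k) ->
    pairing (gr p (nth 0 s k)) (gr q (nth 0 t k)) = 0) ->
  tensor_pairing s t =
    tensor_sign (size s) ps * \prod_(k < size s) pairing (nth 0 s k) (nth 0 t k).
Proof.
move=> st0; rewrite /tensor_pairing /signed_brackets.
set o0 := [set l : bool * 'I_(size s) | nth false ps l.2].
have memr (l : bool * 'I_(size s)) :
    l \in [seq (b, k) | b <- [:: false; true], k <- enum 'I_(size s)].
  by case: l => b k; apply: allpairs_f; [case: b | rewrite mem_enum].
rewrite (bigD1 o0) /=; last by apply/subsetP.
rewrite [X in _ + X]big1 ?addr0 => [|o /andP[_ neq_o]].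
  rewrite -/(tensor_sign _ _) big_map big_enum /=; congr (_ * _).
  apply: eq_bigr => k _; rewrite !big_cons big_nil mulr1 !inE /= -pairingE.
  set e := nth false ps k.
  have sE : nth 0 s k = gr e (nth 0 s k) + gr (~~ e) (nth 0 s k).
    by rewrite {1}[nth 0 s k]gr_sumE; case: e; rewrite // addrC.
  rewrite [in RHS]sE pairingDl [X in _ = X + _]pairing_grl.
  rewrite [X in _ = _ + X]pairing_grl [X in _ = _ + X]st0 ?addr0 //.
  by rewrite -/e; case: (e).
have [l neq_l] : exists l, (l \in o) != (l \in o0).
  apply/existsP; apply: contraNT neq_o => /existsPn eq_o.
  by apply/eqP/setP => l; apply/eqP; rewrite -[_ == _]negbK.
rewrite big_map big_enum /= (bigD1 l.2) //= mulrCA.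
rewrite [X in X * _](_ : _ = 0) ?mul0r //.
rewrite !big_cons big_nil mulr1 /= -pairingE; apply: st0.
by move: neq_l; case: l => -[] k; rewrite !inE /= => ->; rewrite ?orbT.
Qed.

Lemma tensor_sign2 p q : tensor_sign 2 [:: p; q] = (-1) ^+ (p && q).
Proof.
rewrite /tensor_sign !enum_ordSl enum_ord0 /=.
set k0 := ord0; set k1 := lift ord0 ord0.
set r := [:: (false, k0); _; _; _].
rewrite koszul_sym -[LHS]mul1r.
rewrite (@koszul_swap _ _ _ [:: (false, k0)] [:: (false, k1)] [:: (true, k0)]
  [:: (true, k1)]) //= ?koszul_id.
  by rewrite mul1r mulr1 /odd_in /= !inE /= !addn0 !oddb andbC.
by move=> x; rewrite !inE => /eqP->; rewrite eqxx orbT.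
Qed.

End TensorPairing.

(** * The Casimir element as inverse of the pairing *)

Section Casimir.
Variables (A : frobenius) (C : casimir A).
Implicit Types (a b c x y z : A) (p q r : bool).
Notation c1 := (@cas1 A C).
Notation c2 := (@cas2 A C).

Lemma pairing_hom_eq0 x b p p' q' : hom p b -> (p' != p) || (q' != p) ->
  pairing (gr p' x) (gr q' b) = 0.
Proof.
move=> bp neq; have [eq_q|neq_q] := eqVneq q' p.
  by apply: pairing_even; rewrite eq_q eqxx orbF in neq *.
by rewrite (hom_gr _ bp) (negbTE neq_q) raddf0.
Qed.

Lemma pairing_hom_eq0_l x b p p' q' : hom p b -> (p' != p) || (q' != p) ->
  pairing (gr p' b) (gr q' x) = 0.
Proof.
move=> bp neq; have [eq_p|neq_p] := eqVneq p' p.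
  by apply: pairing_even; rewrite eq_p eqxx /= eq_sym in neq *.
by rewrite (hom_gr _ bp) (negbTE neq_p) -[LHS]/(pairing_l _ 0) raddf0.
Qed.

Lemma cas_hom p q b c : hom p b -> hom q c ->
  (-1) ^+ (p && q) * \sum_i pairing (c1 i) b * pairing (c2 i) c = pairing b c.
Proof.
move=> bp cq; rewrite [RHS]pairingE -(casP C b c) big_distrr; apply: eq_bigr => i _.
rewrite (@tensor_pairingE _ _ _ [:: p; q]) ?tensor_sign2 //=.
  by rewrite !big_ord_recl big_ord0 mulr1.
case=> [|[|k]] p' q' /=; rewrite ?nth_nil ?raddf0 //.
- exact: pairing_hom_eq0.
- exact: pairing_hom_eq0.
Qed.

Lemma pairingC p x y : hom p x -> pairing x y = (-1) ^+ p * pairing y x.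
Proof.
move=> xp; rewrite pairingE (bracketC _ xp) (sg_hom _ xp) andbb -pairingE.
by rewrite !mulr_sign; case: p {xp} => //; rewrite raddfN.
Qed.

Lemma pairing_inj_hom x y :
  (forall p c, hom p c -> pairing x c = pairing y c) -> x = y.
Proof.
move=> eq_xy; apply: pairing_inj => c; rewrite [c]gr_sumE !raddfD /=.
by rewrite !(eq_xy _ _ (gr_hom _ c)).
Qed.

(** Additivity is carried as a hypothesis on bare functions such as [B^~ c]; packing them as
    additive maps gives access to [raddf_sum]. *)
Lemma zmod_morphism_sum (U V : zmodType) (f : U -> V) (I : finType) (x : I -> U)
    (n : I -> int) : zmod_morphism f ->
  f (\sum_i x i *~ n i) = \sum_i f (x i) *~ n i.
Proof.
move=> fB; pose g : {additive U -> V} :=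
  HB.pack f (GRing.isZmodMorphism.Build U V f fB).
by rewrite -[f]/(g : U -> V) raddf_sum; apply: eq_bigr => i _; rewrite raddfMz.
Qed.

Lemma pairing_sum (I : finType) (x : I -> A) (n : I -> int) c :
  pairing (\sum_i x i *~ n i) c = \sum_i pairing (x i) c * n i.
Proof.
rewrite -[LHS]/(pairing_l c _) (zmod_morphism_sum _ _ (@raddfB _ _ (pairing_l c))).
by apply: eq_bigr => i _; rewrite mulrzz.
Qed.

(** [c1] and [c2] behave as dual bases, although neither family is assumed to be free. Against a
    homogeneous test element this is [cas_hom], whose sign absorbs the exchange of [y] with [c1 i];
    nondegeneracy concludes. *)
Lemma cas2E x : x = \sum_i c2 i *~ pairing x (c1 i).
Proof.
have cas2_hom p y : hom p y -> y = \sum_i c2 i *~ pairing y (c1 i).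
  move=> yp; apply: pairing_inj_hom => q c cq; rewrite pairing_sum.
  have [eq_pq|neq_pq] := eqVneq p q.
    rewrite -(cas_hom yp cq) -eq_pq andbb big_distrr /=; apply: eq_bigr => i _.
    by rewrite (pairingC _ yp); ring.
  (* For different parities both sides vanish: [cas_hom] equates the sum, up to an invertible sign,
     with [pairing y c = 0]. *)
  have /eqP := cas_hom yp cq; rewrite (pairing_odd yp cq neq_pq) mulf_eq0 signr_eq0.
  move/eqP => sum0.
  apply: (@eq_trans _ _ ((-1) ^+ p * 0)); first by rewrite mulr0.
  rewrite -[X in _ * X]sum0 big_distrr /=; apply: eq_bigr => i _.
  by rewrite (pairingC _ yp); ring.
rewrite [LHS]gr_sumE {1}(cas2_hom _ _ (gr_hom true x)) {1}(cas2_hom _ _ (gr_hom false x)).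
rewrite -big_split; apply: eq_bigr => i _ /=.
by rewrite -mulrzDr -pairingDl -gr_sumE.
Qed.

Lemma cas1E x : x = \sum_i c1 i *~ pairing (c2 i) x.
Proof.
have cas1_hom p y : hom p y -> y = \sum_i c1 i *~ pairing (c2 i) y.
  move=> yp; apply: pairing_inj_hom => q c cq; rewrite pairing_sum.
  have [eq_pq|neq_pq] := eqVneq p q.
    rewrite (pairingC _ yp) -(cas_hom cq yp) -eq_pq andbb mulrA -signr_addb addbb.
    by rewrite mul1r.
  have neq_qp : q != p by rewrite eq_sym.
  have /eqP := cas_hom cq yp; rewrite (pairing_odd cq yp neq_qp) mulf_eq0.
  by rewrite signr_eq0 (pairing_odd yp cq neq_pq) => /eqP->.
rewrite [LHS]gr_sumE {1}(cas1_hom _ _ (gr_hom true x)) {1}(cas1_hom _ _ (gr_hom false x)).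
rewrite -big_split; apply: eq_bigr => i _ /=.
by rewrite -mulrzDr -raddfD -gr_sumE.
Qed.

(** An operator crosses the Casimir element as its adjoint: expand [T (c1 i)] in the [c1 j], and the
    coefficients assemble [T' (c2 j)] on the other leg. An arbitrary biadditive [B] stands in for
    the tensor product. *)
Lemma cas_adjoint (V : zmodType) (B : A -> A -> V) (T T' : A -> A) :
    (forall b, zmod_morphism (B b)) -> (forall c, zmod_morphism (B^~ c)) ->
    (forall x y, pairing y (T x) = pairing (T' y) x) ->
  \sum_i B (T (c1 i)) (c2 i) = \sum_i B (c1 i) (T' (c2 i)).
Proof.
move=> Br Bl adj.
under eq_bigr => i _ do
  rewrite [T _]cas1E (zmod_morphism_sum (f := B^~ (c2 i))) //.
rewrite exchange_big; apply: eq_bigr => j _ /=.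
rewrite [T' _ in RHS]cas2E zmod_morphism_sum //.
by apply: eq_bigr => i _; rewrite adj.
Qed.

(** The projections [gr p] are self-adjoint, so the Casimir element is even. *)
Lemma cas_gr (V : zmodType) (B : A -> A -> V) p q :
    (forall b, zmod_morphism (B b)) -> (forall c, zmod_morphism (B^~ c)) ->
  \sum_i B (gr p (c1 i)) (gr q (c2 i)) =
    if p == q then \sum_i B (c1 i) (gr q (c2 i)) else 0.
Proof.
move=> Br Bl.
rewrite (cas_adjoint (B := fun x y => B x (gr q y)) (T := gr p) (T' := gr p)).
- case: (p =P q) => [->|neq]; first by apply: eq_bigr => i _; rewrite gr_gr eqxx.
  apply: big1 => i _; rewrite gr_gr (introF eqP (nesym neq)).
  by have := Br (c1 i) 0 0; rewrite !subrr.
- by move=> b x y; rewrite raddfB Br.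
- by move=> c x y; rewrite Bl.
- by move=> x y; rewrite pairing_gr.
Qed.

Lemma cas_mull (V : zmodType) (B : A -> A -> V) a :
    (forall b, zmod_morphism (B b)) -> (forall c, zmod_morphism (B^~ c)) ->
  \sum_i B (a * c1 i) (c2 i) = \sum_i B (c1 i) (c2 i * a).
Proof.
move=> Br Bl; apply: (cas_adjoint (T := *%R a) (T' := *%R^~ a)) => //.
by move=> x y; rewrite pairing_mul.
Qed.

(** By cyclicity, left multiplication by [sg p a] is the adjoint of right multiplication by [a]. *)
Lemma cas_mulr (V : zmodType) (B : A -> A -> V) p a : hom p a ->
    (forall b, zmod_morphism (B b)) -> (forall c, zmod_morphism (B^~ c)) ->
  \sum_i B (c1 i * a) (c2 i) = \sum_i B (c1 i) (sg p a * c2 i).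
Proof.
move=> ap Br Bl; apply: (cas_adjoint (T := *%R^~ a) (T' := *%R (sg p a))) => //.
move=> x y; rewrite !pairingE mulrA -[in LHS](sgD0 p (y * x)) -bracketC' // sgM.
by rewrite -[RHS](bracket_sg p) !sgM sgD0 mulrA.
Qed.

Lemma cas_sg (V : zmodType) (B : A -> A -> V) p :
    (forall b, zmod_morphism (B b)) -> (forall c, zmod_morphism (B^~ c)) ->
  \sum_i B (sg p (c1 i)) (c2 i) = \sum_i B (c1 i) (sg p (c2 i)).
Proof.
move=> Br Bl; apply: cas_adjoint => // x y.
by rewrite pairing_sg.
Qed.

(** Expanding the first leg in the [c2 j] leaves on the second leg the expansion of
    [sg true (c1 j)]; the twist is that of [bracket_sgC]. *)
Lemma cas_sym (V : zmodType) (B : A -> A -> V) :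
    (forall b, zmod_morphism (B b)) -> (forall c, zmod_morphism (B^~ c)) ->
  \sum_i B (c1 i) (c2 i) = \sum_i B (c2 i) (sg true (c1 i)).
Proof.
move=> Br Bl.
under eq_bigr => i _ do
  rewrite [c1 i]cas2E (zmod_morphism_sum (f := B^~ (c2 i))) //.
rewrite exchange_big; apply: eq_bigr => j _ /=.
rewrite [sg _ _ in RHS]cas2E zmod_morphism_sum //.
apply: eq_bigr => i _.
by rewrite pairing_sg !pairingE -bracket_sgC.
Qed.

End Casimir.

(** * Graded central elements *)

Section Centers.
Variables (A : frobenius) (C : casimir A).
Implicit Types (a b c x y z : A) (p q r : bool).
Notation c1 := (@cas1 A C).
Notation c2 := (@cas2 A C).

Ltac additive := by move=> ? ? ?; rewrite /= ?(mulrBl, mulrBr, raddfB) //=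
  ?(mulrBl, mulrBr, raddfB) //= ?(mulrBl, mulrBr, raddfB) //=
  ?(mulrBl, mulrBr, raddfB).

Lemma cas_conj_is_zmod_morphism : zmod_morphism (cas_conj C).
Proof.
move=> a b; rewrite /cas_conj -sumrB; apply: eq_bigr => i _.
rewrite -sumrB; apply: eq_bigr => p _; rewrite -sumrB; apply: eq_bigr => q _.
by rewrite raddfB mulrBr mulrBl mulrBr.
Qed.
HB.instance Definition _ :=
  GRing.isZmodMorphism.Build A A (cas_conj C) cas_conj_is_zmod_morphism.

Lemma sum_sg p x : \sum_q (-1) ^+ (p && q) * gr q x = sg p x.
Proof.
rewrite big_bool /= andbT andbF expr0 mul1r mulr_sign /sg.
by case: p => /=; [rewrite addrC | rewrite -gr_sumE].
Qed.

Lemma cas_conjE p a : hom p a -> cas_conj C a = \sum_i c1 i * a * sg p (c2 i).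
Proof.
move=> ap; apply: eq_bigr => i _; rewrite -sum_sg big_distrr /=.
apply: eq_bigr => q _; rewrite (bigD1 p) //= big1 => [|r neq_r].
  by rewrite ap addr0 andbC !mulr_sign; case: ifP; rewrite ?mulrN.
by rewrite (hom_gr _ ap) (negbTE neq_r) !(mulr0, mul0r).
Qed.

Lemma cas_even (V : zmodType) (B : A -> A -> V) :
    (forall b, zmod_morphism (B b)) -> (forall c, zmod_morphism (B^~ c)) ->
  \sum_i B (c1 i) (c2 i) = \sum_p \sum_i B (gr p (c1 i)) (gr p (c2 i)).
Proof.
move=> Br Bl; rewrite exchange_big /=.
have BrD b x y : B b (x + y) = B b x + B b y.
  pose g : {additive A -> V} :=
    HB.pack (B b) (GRing.isZmodMorphism.Build A V (B b) (Br b)).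
  exact: (raddfD g).
under eq_bigr => i _ do rewrite [c2 i]gr_sumE BrD.
rewrite exchange_big big_bool big_split /= !cas_gr //=.
Qed.

Lemma hom_cas_conj p a : hom p a -> hom p (cas_conj C a).
Proof.
move=> ap; rewrite (cas_conjE ap).
rewrite (cas_even (B := fun u v => u * a * sg p v)); try additive.
apply: hom_sum => q _; apply: hom_sum => i _.
have := homM (homM (gr_hom q (c1 i)) ap) (hom_sg p (gr_hom q (c2 i))).
by rewrite addbC addbA addbb.
Qed.

Lemma cas_conj_gr p a : gr p (cas_conj C a) = cas_conj C (gr p a).
Proof.
rewrite {1}[a]gr_sumE !raddfD /= !(hom_gr _ (hom_cas_conj (gr_hom _ _))).
by case: p; rewrite /= ?addr0 ?add0r.
Qed.

(** [x] enters at the first leg of the Casimir element and leaves at the second, by [cas_mull]; the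
    twist [sg p] carried by that leg is passed on to [x]. *)
Lemma cas_conj_comm p a x : hom p a -> x * cas_conj C a = cas_conj C a * sg p x.
Proof.
move=> ap; rewrite (cas_conjE ap) big_distrr big_distrl /=.
under eq_bigr => i _ do rewrite !mulrA.
rewrite (cas_mull C x (B := fun u v => u * a * sg p v)); try additive.
by apply: eq_bigr => i _; rewrite sgM !mulrA.
Qed.

(** The sign of graded commutation depends on the parity of [z], so the condition is imposed on each
    component; [z] itself may be inhomogeneous. *)
Definition gcentral z := forall p x, gr p z * x = sg p x * gr p z.

Lemma gcentral_hom z p x : gcentral z -> hom p z -> z * x = sg p x * z.
Proof. by move=> /(_ p x) + zp; rewrite zp. Qed.

Lemma gcentral_cas_conj a : gcentral (cas_conj C a).
Proof.
by move=> p x; rewrite cas_conj_gr (cas_conj_comm _ (gr_hom p a)) sgD0.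
Qed.

Lemma gcentral1 : gcentral 1.
Proof. by case=> x; rewrite (hom_gr _ (hom1 A)) /= ?mul0r ?mulr0 ?mul1r ?mulr1. Qed.

Lemma gcentralM y z : gcentral y -> gcentral z -> gcentral (y * z).
Proof.
move=> cy cz p x.
have -> : gr p (y * z) = \sum_q gr q y * gr (p (+) q) z.
  rewrite {1}[y]gr_sumE {1}[z]gr_sumE !(mulrDl, mulrDr, raddfD) /=.
  rewrite !(hom_gr _ (homM (gr_hom _ _) (gr_hom _ _))) big_bool /=.
  by case: p; rewrite /= ?addr0 ?add0r // addrC.
rewrite big_distrl big_distrr; apply: eq_bigr => q _ /=.
by rewrite -mulrA cz mulrA cy sgD mulrA addbCA addbb addbF.
Qed.

Lemma gcentral_prod (I : Type) (s : seq I) (f : I -> A) :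
  (forall i, gcentral (f i)) -> gcentral (\prod_(i <- s) f i).
Proof.
by move=> cf; apply: big_ind => //; [apply: gcentral1 | apply: gcentralM].
Qed.

(** Symmetry of the Casimir element exchanges its legs in <x c1 y c2>, and cyclicity of the bracket
    then brings the last factor to the front, giving <c1 x c2 y>; the twists combine to the required
    one. *)
Lemma cas_conj_adjoint x y :
  pairing x (cas_conj C y) = pairing (cas_conj C x) y.
Proof.
have adj_hom p q a b : hom p a -> hom q b ->
    pairing a (cas_conj C b) = pairing (cas_conj C a) b.
  move=> ap bq; have [eq_pq|neq_pq] := eqVneq p q; last first.
    by rewrite (pairing_odd ap (hom_cas_conj bq)) //
      (pairing_odd (hom_cas_conj ap) bq).
  rewrite -{q}eq_pq in bq; rewrite (cas_conjE ap) (cas_conjE bq) !pairingE.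
  rewrite big_distrr big_distrl !raddf_sum /=.
  rewrite (cas_sym C (B := fun u v => bracket (a * (u * b * sg p v))));
    try additive; rewrite /=.
  under eq_bigr => i _ do
    rewrite !mulrA -[sg p _](sgD0 true) -bracket_sgC sgD sgD addbC addbA addbb !mulrA.
  rewrite (cas_sg C _ (B := fun u v => bracket (u * a * v * b))) //; try additive.
rewrite [x]gr_sumE [y]gr_sumE !raddfD /= !pairingDl.
by rewrite !(adj_hom _ _ _ _ (gr_hom _ _) (gr_hom _ _)).
Qed.

Lemma cas_conjMr x z : gcentral z -> cas_conj C (x * z) = cas_conj C x * z.
Proof.
move=> cz; have conjM p q a : hom p a ->
    cas_conj C (a * gr q z) = cas_conj C a * gr q z.
  move=> ap; rewrite (cas_conjE ap) (cas_conjE (homM ap (gr_hom q z))).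
  rewrite big_distrl; apply: eq_bigr => i _ /=.
  by rewrite mulrA -[in LHS]mulrA cz mulrA sgD addbCA addbb addbF.
rewrite [x]gr_sumE [z]gr_sumE !(mulrDl, mulrDr, raddfD) /=.
by rewrite !(conjM _ _ _ (gr_hom _ x)) addrACA.
Qed.

(** [cas_conj] is a graded trace with values in the graded centre: [x], standing to the right of
    [c1], crosses to the left of [c2] and thereby passes to the other side of [y]. *)
Lemma cas_conjC q x y : hom q y -> cas_conj C (x * y) = cas_conj C (y * sg q x).
Proof.
move=> yq; have conjC p a : hom p a ->
    cas_conj C (a * y) = cas_conj C (y * sg q a).
  move=> ap; rewrite (cas_conjE (homM ap yq)) (cas_conjE (homM yq (hom_sg q ap))).
  under eq_bigr => i _ do rewrite mulrA.
  rewrite (cas_mulr C ap (B := fun u v => u * y * sg (p (+) q) v)); try additive.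
  by apply: eq_bigr => i _; rewrite sgM sgD addbC addbA addbb addFb !mulrA
    [q (+) p]addbC.
rewrite [x]gr_sumE !(mulrDl, mulrDr, raddfD) /= ?(mulrDr, raddfD) /=.
by rewrite !(conjC _ _ (gr_hom _ _)).
Qed.

Lemma cas_handleE : cas_handle C = \sum_i cas_conj C (c1 i) * c2 i.
Proof.
rewrite /cas_handle exchange_big; apply: eq_bigr => j _ /=.
rewrite big_distrl; apply: eq_bigr => i _ /=.
rewrite big_distrl; apply: eq_bigr => p _ /=.
by rewrite big_distrl; apply: eq_bigr => q _ /=; rewrite -!mulrA.
Qed.

Lemma hom_cas_handle : hom false (cas_handle C).
Proof.
rewrite cas_handleE (cas_even (B := fun u v => cas_conj C u * v)); try additive.
apply: hom_sum => q _; apply: hom_sum => i _.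
by have := homM (hom_cas_conj (gr_hom q (c1 i))) (gr_hom q (c2 i)); rewrite addbb.
Qed.

(** The identity behind [sew2]: [x] crosses to the second leg by [cas_mulr] and then leaves the sum
    on the left, because the values of [cas_conj] are graded central. *)
Lemma cas_conj_handle p x : hom p x ->
  \sum_i cas_conj C (c1 i * x) * sg p (c2 i) = x * cas_handle C.
Proof.
move=> xp; rewrite (cas_mulr C xp (B := fun u v => cas_conj C u * sg p v));
  try additive.
rewrite cas_handleE big_distrr /=.
rewrite (cas_even (B := fun u v => cas_conj C u * sg p (sg p x * v))); try additive.
rewrite (cas_even (B := fun u v => x * (cas_conj C u * v))); try additive.
apply: eq_bigr => q _; apply: eq_bigr => i _.
rewrite sgM sgD0 mulrA -[cas_conj _ _](hom_cas_conj (gr_hom q _)).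
rewrite gcentral_cas_conj (sg_hom _ xp) (sg_hom _ (gr_hom q (c2 i))) andbC.
by rewrite !mulr_sign mulrA; case: ifP; rewrite // ?mulrN ?mulNr ?opprK.
Qed.

(** H x = \sum phi(c1) c2 x = \sum phi(x c1) c2 = \sum +- phi(c1 x) c2 = x H, by [cas_mull], the
    trace property [cas_conjC] and [cas_conj_handle]. As H is even, graded centrality is plain
    commutation. *)
Lemma gcentral_cas_handle : gcentral (cas_handle C).
Proof.
have comm p x : hom p x -> cas_handle C * x = x * cas_handle C.
  move=> xp; rewrite -(cas_conj_handle xp) cas_handleE big_distrl /=.
  under eq_bigr => i _ do rewrite -mulrA.
  rewrite -(cas_mull C x (B := fun u v => cas_conj C u * v)); try additive.
  rewrite (cas_even (B := fun u v => cas_conj C (x * u) * v)); try additive.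
  rewrite (cas_even (B := fun u v => cas_conj C (u * x) * sg p v)); try additive.
  apply: eq_bigr => q _; apply: eq_bigr => i _.
  rewrite (cas_conjC _ (gr_hom q _)) (sg_hom _ xp) (sg_hom _ (gr_hom q (c2 i))).
  rewrite !mulr_sign andbC; case: ifP => // _.
  by rewrite mulrN raddfN mulNr mulrN.
case=> x; first by rewrite (hom_gr _ hom_cas_handle) mul0r mulr0.
rewrite (hom_gr _ hom_cas_handle) /= /sg.
by rewrite [x]gr_sumE mulrDr mulrDl !(comm _ _ (gr_hom _ _)).
Qed.

End Centers.

(** * The open topological field theory *)

Section OpenTFT.
Variables (A : frobenius) (C : casimir A).
Implicit Types (a b c x y z : A) (p q r : bool) (s t w : seq A)
  (bs : seq (seq A)).
Notation c1 := (@cas1 A C).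
Notation c2 := (@cas2 A C).

Definition word_prod s : A := \prod_(x <- s) x.

Definition handles_prod g bs : A :=
  \prod_(w <- bs) cas_conj C (word_prod w) * cas_handle C ^+ g.

(** The first word is singled out as in the closed formula; by [tft_swap] another choice only
    produces a Koszul sign. The value on the empty list is a default: the axioms and [otft_unique]
    speak of at least one boundary component. *)
Definition tft g bs : int :=
  if bs is w :: bs' then bracket (word_prod w * handles_prod g bs') else 0.

Lemma homog_cat p s t : homog p (s ++ t) <->
  exists q r, [/\ homog q s, homog r t & p = q (+) r].
Proof.
elim: s p => [|a s IHs] p /=.
  by split=> [hp|[q [r [-> hr ->]]]]; [exists false, p | rewrite addFb].
split=> [[u [au /IHs[q [r [hq hr e]]]]]|[q [r [[u [au hq]] hr ->]]]].
  exists (q (+) u), r; split=> //; first by exists u; rewrite -addbA addbb addbF.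
  by rewrite addbAC -e -addbA addbb addbF.
exists u; split=> //; apply/IHs; exists (q (+) u), r; split=> //.
by rewrite addbAC.
Qed.

Lemma hom_word_prod p s : homog p s -> hom p (word_prod s).
Proof.
elim: s p => [|a s IHs] p /= => [->|[q [aq /IHs hs]]].
  by rewrite /word_prod big_nil; apply: hom1.
rewrite /word_prod big_cons; have := homM aq hs.
by rewrite addbCA addbb addbF.
Qed.

Lemma word_prod_cat s t : word_prod (s ++ t) = word_prod s * word_prod t.
Proof. exact: big_cat. Qed.

Lemma word_prod_cons x s : word_prod (x :: s) = x * word_prod s.
Proof. exact: big_cons. Qed.

Lemma handles_prod_cons g w bs :
  handles_prod g (w :: bs) = cas_conj C (word_prod w) * handles_prod g bs.
Proof. by rewrite /handles_prod big_cons mulrA. Qed.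

Lemma gcentral_handle_exp g : gcentral (cas_handle C ^+ g).
Proof.
elim: g => [|g IHg]; first by rewrite expr0; apply: gcentral1.
by rewrite exprS; apply: gcentralM => //; apply: gcentral_cas_handle.
Qed.

Lemma gcentral_conj_prod bs : gcentral (\prod_(w <- bs) cas_conj C (word_prod w)).
Proof. by apply: gcentral_prod => w; apply: gcentral_cas_conj. Qed.

Lemma gcentral_handles g bs : gcentral (handles_prod g bs).
Proof.
exact: gcentralM (gcentral_conj_prod bs) (gcentral_handle_exp g).
Qed.

Lemma hom_handle_exp g : hom false (cas_handle C ^+ g).
Proof.
elim: g => [|g IHg]; first by rewrite expr0; apply: hom1.
by rewrite exprS; apply: homM (hom_cas_handle C) IHg.
Qed.

Lemma hom_conj_prod r bs : homog r (flatten bs) ->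
  hom r (\prod_(w <- bs) cas_conj C (word_prod w)).
Proof.
elim: bs r => [|w bs IHbs] r /= => [->|/homog_cat[p [q [hp hq ->]]]].
  by rewrite big_nil; apply: hom1.
by rewrite big_cons; apply: homM (IHbs _ hq); apply/hom_cas_conj/hom_word_prod.
Qed.

Lemma hom_handles g r bs : homog r (flatten bs) -> hom r (handles_prod g bs).
Proof.
by move=> /hom_conj_prod hr; rewrite -[r]addbF; apply: homM hr (hom_handle_exp g).
Qed.

Lemma handle_exp_comm g x : cas_handle C ^+ g * x = x * cas_handle C ^+ g.
Proof. exact: (gcentral_hom x (gcentral_handle_exp g) (hom_handle_exp g)). Qed.

(** This is why whole pieces of a surface can be permuted without sign. *)
Lemma tft_odd g bs : homog true (flatten bs) -> tft g bs = 0.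
Proof.
case: bs => [|w bs] //= /homog_cat[p [q [hp hq e]]].
apply: bracket_odd; rewrite e; apply: homM; first exact: hom_word_prod.
exact: hom_handles.
Qed.

Lemma tft_eq_prod g w w' bs bs' : word_prod w = word_prod w' ->
  map word_prod bs = map word_prod bs' -> tft g (w :: bs) = tft g (w' :: bs').
Proof.
move=> eq_w eq_bs /=; rewrite eq_w /handles_prod.
by rewrite -!(big_map word_prod xpredT (cas_conj C)) eq_bs.
Qed.

(** Only the product of each word matters, so letters decorated by 1 are invisible to [tft]. *)
Lemma tft_eq_word_prod g bs bs' : map word_prod bs = map word_prod bs' ->
  tft g bs = tft g bs'.
Proof. by case: bs bs' => [|w bs] [|w' bs'] //= [/tft_eq_prod]; apply. Qed.

Lemma signMr p x y : (-1) ^+ p * x * y = (-1) ^+ p * (x * y) :> A.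
Proof. by rewrite mulrA. Qed.

Lemma signrMz (V : pzRingType) (f : {additive A -> V}) p x :
  f ((-1) ^+ p * x) = (-1) ^+ p * f x.
Proof. by rewrite !mulr_sign; case: p; rewrite ?raddfN. Qed.

Lemma mulr_signC p x y : x * ((-1) ^+ p * y) = (-1) ^+ p * (x * y).
Proof. by rewrite !mulr_sign; case: p; rewrite ?mulrN. Qed.

Lemma tft_add g bs bs' s t x y :
  tft g (bs ++ (s ++ x + y :: t) :: bs') =
    tft g (bs ++ (s ++ x :: t) :: bs') + tft g (bs ++ (s ++ y :: t) :: bs').
Proof.
have prodD : word_prod (s ++ x + y :: t) =
    word_prod (s ++ x :: t) + word_prod (s ++ y :: t).
  by rewrite !word_prod_cat !word_prod_cons mulrDl mulrDr.
case: bs => [|w bs] /=; first by rewrite prodD mulrDl raddfD.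
rewrite /handles_prod !big_cat !big_cons /= prodD raddfD /=.
by rewrite !(mulrDl, mulrDr) raddfD.
Qed.

Lemma tft_rot g bs s x p q : homog p s -> gr q x = x ->
  tft g ((x :: s) :: bs) = (-1) ^+ (p && q) * tft g (rcons s x :: bs).
Proof.
move=> /hom_word_prod hs xq; rewrite /= word_prod_cons -cats1 word_prod_cat.
rewrite word_prod_cons /word_prod big_nil mulr1 -/(word_prod s).
have cR := gcentral_handles g bs; set R := handles_prod g bs in cR *.
rewrite [R]gr_sumE !mulrDr !raddfD mulrDr /=.
(* [R] is not homogeneous, but only its component of parity [p (+) q] contributes, since the bracket
   vanishes on odd elements. *)
suff rotR r : bracket (x * word_prod s * gr r R) =
    (-1) ^+ (p && q) * bracket (word_prod s * x * gr r R) by rewrite !rotR.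
have [eq_r|neq_r] := eqVneq r (p (+) q); last first.
  have e1 : q (+) p (+) r = true by case: p q r neq_r {hs xq} => -[] [].
  have e2 : p (+) q (+) r = true by rewrite [p (+) q]addbC.
  have := homM (homM xq hs) (gr_hom r R); rewrite e1 => /bracket_odd->.
  have := homM (homM hs xq) (gr_hom r R); rewrite e2 => /bracket_odd->.
  by rewrite mulr0.
rewrite -mulrA (bracketC _ xq) -[in LHS]mulrA cR sgD (sg_hom _ xq) signMr.
rewrite mulr_signC signrMz mulrA; congr (_ * _).
by rewrite eq_r; case: p q {hs xq eq_r} => -[].
Qed.

(** Self-adjointness exchanges the word outside [cas_conj] with one inside; the central factor [z]
    is carried along by [cas_conjMr]. *)
Lemma pairing_conj a b z : gcentral z ->
  bracket (a * cas_conj C b * z) = bracket (cas_conj C a * b * z).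
Proof.
move=> cz; rewrite -mulrA -cas_conjMr // -pairingE cas_conj_adjoint pairingE.
by rewrite mulrA.
Qed.

Lemma tft_swap g bs bs' s t p q : homog p s -> homog q t ->
  tft g (bs ++ s :: t :: bs') = (-1) ^+ (p && q) * tft g (bs ++ t :: s :: bs').
Proof.
move=> /hom_word_prod hs /hom_word_prod ht.
case: bs => [|w bs] /=.
  rewrite !handles_prod_cons.
  move: (handles_prod g bs') (gcentral_handles g bs') => R cR.
  rewrite !mulrA pairing_conj //.
  rewrite (gcentral_hom _ (gcentral_cas_conj C _) (hom_cas_conj C hs)).
  by rewrite (sg_hom _ ht) !signMr signrMz.
rewrite /handles_prod !big_cat !big_cons /=; set S := word_prod s.
rewrite [cas_conj C S * _]mulrA.
rewrite (gcentral_hom _ (gcentral_cas_conj C _) (hom_cas_conj C hs)).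
rewrite (sg_hom _ (hom_cas_conj C ht)) !signMr !mulr_signC.
by rewrite !signMr mulr_signC signrMz -!mulrA.
Qed.

(** Self-adjointness moves the conjugation from [t] to [s]; unfolding it there puts the legs of a
    Casimir element on both sides of [s]. *)
Lemma sew1 g bs s t p : homog p s ->
  tft g (s :: t :: bs) = \sum_(i : cas_idx C) \sum_q
    (-1) ^+ (p && q) * tft g ((c1 i :: s ++ gr q (c2 i) :: t) :: bs).
Proof.
move=> /hom_word_prod hs /=; rewrite handles_prod_cons.
have cR := gcentral_handles g bs; rewrite mulrA pairing_conj //.
rewrite (cas_conjE C hs) !big_distrl raddf_sum; apply: eq_bigr => i _ /=.
rewrite -sum_sg !(big_distrr, big_distrl) raddf_sum; apply: eq_bigr => q _ /=.
by rewrite word_prod_cons word_prod_cat word_prod_cons mulr_signC !signMr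
  signrMz -!mulrA.
Qed.

(** On the right-hand side the conjugation is moved from the second word to the first, which
    produces \sum +- phi(c1 s) c2 = s H, one more factor H. *)
Lemma sew2 g bs s t p : homog p s ->
  tft g.+1 ((s ++ t) :: bs) = \sum_(i : cas_idx C) \sum_q
    (-1) ^+ (p && q) * tft g ((c1 i :: s) :: (gr q (c2 i) :: t) :: bs).
Proof.
move=> /hom_word_prod hs /=.
have sumE i : \sum_q (-1) ^+ (p && q) *
    bracket (word_prod (c1 i :: s) * handles_prod g ((gr q (c2 i) :: t) :: bs))
    = bracket (cas_conj C (c1 i * word_prod s) * sg p (c2 i) *
               (word_prod t * handles_prod g bs)).
  rewrite mulrA -[_ * word_prod t]mulrA -pairing_conj; last exact: gcentral_handles.
  rewrite -sum_sg big_distrl (raddf_sum (cas_conj C)) !(big_distrr, big_distrl).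
  rewrite raddf_sum; apply: eq_bigr => q _ /=.
  by rewrite handles_prod_cons !word_prod_cons signMr signrMz mulr_signC
    signMr signrMz !mulrA.
under eq_bigr do rewrite sumE.
rewrite -raddf_sum -big_distrl /= cas_conj_handle //.
rewrite -[cas_handle C](expr1 (cas_handle C)) -mulrA handle_exp_comm.
by rewrite word_prod_cat /handles_prod expr1 exprSr !mulrA.
Qed.

(** The coefficients <c1 x> against the [c2 i] rebuild [x], by [cas2E]; this is the sewing of two
    separate surfaces. *)
Lemma cas_sew p x y : hom p x ->
  \sum_i bracket (c1 i * x) * bracket (sg p (c2 i) * y) = bracket (x * y).
Proof.
move=> xp; rewrite -[in RHS](bracket_sg p) sgM (sg_hom _ xp) andbb signMr signrMz.
rewrite /= -pairingE [X in _ = _ * pairing X _](cas2E C) pairing_sum big_distrr.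
apply: eq_bigr => i _ /=.
rewrite -!pairingE (pairingC (c1 i) xp) pairing_sg.
by case: (p); rewrite /= ?expr0 ?expr1; ring.
Qed.

Lemma sew3 g g' bs bs' s t p q r :
    homog p s -> homog q t -> homog r (flatten bs) ->
  tft (g + g')%N ((s ++ t) :: bs ++ bs') = \sum_(i : cas_idx C) \sum_u
    (-1) ^+ (u && (p (+) r)) * (-1) ^+ (q && r) *
    (tft g ((c1 i :: s) :: bs) * tft g' ((gr u (c2 i) :: t) :: bs')).
Proof.
move=> /hom_word_prod hs /hom_word_prod ht hbs /=.
have hX := homM hs (hom_handles g hbs).
set X := word_prod s * _ in hX; set Y := word_prod t * handles_prod g' bs'.
have sumE i : \sum_u (-1) ^+ (u && (p (+) r)) * (-1) ^+ (q && r) *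
   (bracket (word_prod (c1 i :: s) * handles_prod g bs) *
    bracket (word_prod (gr u (c2 i) :: t) * handles_prod g' bs')) =
   (-1) ^+ (q && r) * (bracket (c1 i * X) * bracket (sg (p (+) r) (c2 i) * Y)).
  rewrite -sum_sg big_distrl raddf_sum !big_distrr; apply: eq_bigr => u _ /=.
  rewrite !word_prod_cons signMr signrMz /X /Y !mulrA andbC.
  by rewrite -!mulrA; ring.
under eq_bigr do rewrite sumE.
rewrite -big_distrr /= cas_sew // /X /Y word_prod_cat /handles_prod big_cat exprD.
have hP := hom_conj_prod hbs; have cP := gcentral_conj_prod bs.
move: (\prod_(w <- bs) _) hP cP => P hP cP.
rewrite -signrMz; congr bracket.
rewrite -!mulrA [_ ^+ g * (word_prod t * _)]handle_exp_comm -!mulrA -!exprD.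
rewrite [(g' + g)%N]addnC -mulr_signC; congr (_ * _).
(* Passing [P], of parity [r], over [t], of parity [q], creates the sign that cancels (-1)^(q &&
   r). *)
rewrite [P * (word_prod t * _)]mulrA (gcentral_hom (word_prod t) cP hP) (sg_hom _ ht).
by rewrite !signMr [RHS]mulrA -signr_addb andbC addbb mul1r -mulrA.
Qed.

Lemma tft_disc s : tft 0 [:: s] = bracket (\prod_(x <- s) x).
Proof. by rewrite /= /handles_prod big_nil expr0 !mulr1. Qed.

Lemma otft_tft : otft_of C tft.
Proof.
split.
- exact: tft_add.
- exact: tft_rot.
- exact: tft_swap.
- exact: sew1.
- exact: sew2.
- exact: sew3.
- exact: tft_disc.
Qed.

(** [otft_sew2] lowers the genus and [otft_sew1] the number of boundary components, down to
    discs. *)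
Lemma otft_unique Z Z' : otft_of C Z -> otft_of C Z' ->
  forall g w ws, Z' g (w :: ws) = Z g (w :: ws).
Proof.
move=> HZ HZ'; elim=> [|g IHg] w ws; last first.
  (* The empty prefix is homogeneous of parity [false], so the axiom applies to an arbitrary [w]. *)
  rewrite -[w]cat0s (otft_sew2 HZ _ _ _ (p := false)) //.
  rewrite (otft_sew2 HZ' _ _ _ (p := false)) //.
  by apply: eq_bigr => i _; apply: eq_bigr => q _; rewrite IHg.
elim: ws w => [|t bs IHws] w; first by rewrite (otft_disc HZ) (otft_disc HZ').
(* [otft_sew1] needs a homogeneous first word. Its letters are split into components one at a time,
   [u] being the part already treated. *)
have homog_ext p u v : homog p u ->
    Z' 0%N ((u ++ v) :: t :: bs) = Z 0%N ((u ++ v) :: t :: bs).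
  elim: v p u => [|a v IHv] p u hu.
    rewrite cats0 (otft_sew1 HZ _ _ _ hu) (otft_sew1 HZ' _ _ _ hu).
    by apply: eq_bigr => i _; apply: eq_bigr => q _; rewrite IHws.
  have hua q : homog (p (+) q) (u ++ [:: gr q a]).
    apply/homog_cat; exists p, q; split=> //.
    by exists q; split; [apply: gr_hom | rewrite /= addbb].
  rewrite [a]gr_sumE (otft_add HZ _ [::]) (otft_add HZ' _ [::]) /=.
  by rewrite -!(cat_rcons _ u) -!cats1 !(IHv _ _ (hua _)).
by rewrite -[w]cat0s (homog_ext false).
Qed.

End OpenTFT.

Arguments tft : simpl never.

(** * Gluing along cuts *)

(** Sign rules are at hand for neighbours only; adjacent transpositions generate all
    permutations. *)
Lemma adjacent_perm_ind (T : eqType) (Q : seq T -> Prop) :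
    (forall a x y b, Q (a ++ x :: y :: b) -> Q (a ++ y :: x :: b)) ->
  forall s t, perm_eq s t -> Q s -> Q t.
Proof.
move=> Qswap.
have Qmove a x s b : Q (a ++ x :: s ++ b) -> Q (a ++ s ++ x :: b).
  by elim: s a => // y s IHs a /Qswap; rewrite -cat_rcons => /IHs; rewrite cat_rcons.
suff QcatCA a s1 s2 b : Q (a ++ s1 ++ s2 ++ b) -> Q (a ++ s2 ++ s1 ++ b).
  by apply: catCA_perm_ind => s1 s2 s3; apply: (QcatCA [::]).
elim: s1 a => // x s1 IHs a; rewrite cat_cons -cat_rcons => /IHs.
by rewrite cat_rcons => /Qmove.
Qed.

Section Pieces.
Variable L : finType.

(** A piece of a partly glued surface is given by its genus and by the words
    around its boundary components. *)
Definition piece : Type := (nat * seq (seq L))%type.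
Implicit Types (P Q : seq piece) (w s t : seq L) (bs : seq (seq L)) (u v l : L).

Definition pwords P : seq (seq L) := flatten (map snd P).
Definition letters P : seq L := flatten (pwords P).

Definition nexts (f : L -> L) P := all (fcycle f) (pwords P).

(** Connectedness in a form stable under gluing: instead of following pieces as they merge, one asks
    which colourings of the letters are constant on each piece. *)
Definition mono (col : pred L) P :=
  all (fun p : piece => all (fun l => all (fun l' => col l == col l')
    (flatten p.2)) (flatten p.2)) P.

Definition euler P : int := \sum_(p <- P) (2 - 2 * p.1%:Z - (size p.2)%:Z).

(** Excludes closed pieces and boundary components without letters, which no condition on letters
    could detect. *)
Definition nonempty P :=
  all (fun p : piece => (p.2 != [::]) && ([::] \notin p.2)) P.

Lemma letters_cons p P : letters (p :: P) = flatten p.2 ++ letters P.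
Proof. by rewrite /letters /pwords /= flatten_cat. Qed.

Lemma pwords_cons p P : pwords (p :: P) = p.2 ++ pwords P.
Proof. by []. Qed.

Lemma letters_cat P Q : letters (P ++ Q) = letters P ++ letters Q.
Proof. by rewrite /letters /pwords map_cat !flatten_cat. Qed.

Section Values.
Variables (A : frobenius) (C : casimir A).

Definition pieces_val (z : L -> A) P : int :=
  \prod_(p <- P) tft C p.1 (map (map z) p.2).

Definition signed_val r (o : {set L}) (z : L -> A) P : int :=
  koszul o r (letters P) * pieces_val z P.

Definition homL (o : {set L}) (z : L -> A) := forall l, hom (l \in o) (z l).

Lemma homog_map o z s : homL o z -> homog (odd_in o s) (map z s).
Proof.
move=> hz; elim: s => //= l s IHs; exists (l \in o); split; first exact: hz.
by rewrite odd_in_cons addbAC addbb addFb.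
Qed.

Lemma homog_flatten_map o z bs : homL o z ->
  homog (odd_in o (flatten bs)) (flatten (map (map z) bs)).
Proof. by move=> hz; rewrite -map_flatten; apply: homog_map. Qed.

Lemma pieces_val_cons z p P :
  pieces_val z (p :: P) = tft C p.1 (map (map z) p.2) * pieces_val z P.
Proof. exact: big_cons. Qed.

(** Swapping two pieces costs a sign only when both are odd, and then the value is 0 by
    [tft_odd]. *)
Lemma signed_val_perm r o z P P' : homL o z -> uniq (letters P) ->
  {subset letters P <= r} -> perm_eq P P' ->
  signed_val r o z P = signed_val r o z P'.
Proof.
move=> hz uP sP eqP.
pose Q P1 := [/\ uniq (letters P1), {subset letters P1 <= r}
  & signed_val r o z P = signed_val r o z P1].
suff [] : Q P' by [].
apply: (adjacent_perm_ind _ eqP) => // a x y b [u1 s1 e1].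
have perm_l : perm_eq (letters (a ++ x :: y :: b)) (letters (a ++ y :: x :: b)).
  by rewrite !letters_cat !letters_cons perm_cat2l perm_catCA.
split; first by rewrite -(perm_uniq perm_l).
  by move=> l; rewrite -(perm_mem perm_l); apply: s1.
rewrite {}e1 /signed_val /pieces_val !big_cat !big_cons /=.
move: u1 s1; rewrite !letters_cat !letters_cons => u1 s1.
rewrite koszul_swap //; last first.
  by move=> l bl; apply: s1; rewrite !mem_cat bl !orbT.
case odd_x: (odd_in o (flatten x.2)); last by rewrite mul1r; ring.
have := homog_flatten_map x.2 hz; rewrite odd_x => /tft_odd->.
by rewrite !(mul0r, mulr0).
Qed.

(** The sign in [tft_swap] is the Koszul sign of exchanging two neighbouring words, so the two
    cancel. *)
Lemma signed_val_words r o z g bs bs' P : homL o z ->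
    uniq (letters ((g, bs) :: P)) -> {subset letters ((g, bs) :: P) <= r} ->
    perm_eq bs bs' ->
  signed_val r o z ((g, bs) :: P) = signed_val r o z ((g, bs') :: P).
Proof.
move=> hz uP sP eqP.
pose Q bs1 := [/\ uniq (letters ((g, bs1) :: P)),
  {subset letters ((g, bs1) :: P) <= r}
  & signed_val r o z ((g, bs) :: P) = signed_val r o z ((g, bs1) :: P)].
suff [] : Q bs' by [].
apply: (adjacent_perm_ind _ eqP) => // a x y b [u1 s1 e1].
move: u1 s1; rewrite !letters_cons /= !flatten_cat /= -!catA => u1 s1.
have perm_l : perm_eq (flatten a ++ x ++ y ++ flatten b ++ letters P)
    (flatten a ++ y ++ x ++ flatten b ++ letters P).
  by rewrite perm_cat2l perm_catCA.
split; rewrite ?letters_cons /= ?flatten_cat /= -?catA.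
- by rewrite -(perm_uniq perm_l).
- by move=> l; rewrite -(perm_mem perm_l); apply: s1.
rewrite {}e1 /signed_val !letters_cons /= !flatten_cat /= -!catA.
rewrite koszul_swap //; last first.
  by move=> l bl; apply: s1; rewrite !mem_cat bl !orbT.
rewrite !pieces_val_cons /= !map_cat /=.
rewrite (tft_swap C _ _ _ (homog_map x hz) (homog_map y hz)).
by rewrite -!mulrA [X in _ = X](mulrC) !mulrA -mulrA;
  case: odd_in; case: odd_in; rewrite /= ?expr0 ?expr1; ring.
Qed.

Lemma signed_val_rot r o z g w k bs P : homL o z ->
    uniq (letters ((g, w :: bs) :: P)) ->
    {subset letters ((g, w :: bs) :: P) <= r} ->
  signed_val r o z ((g, w :: bs) :: P) = signed_val r o z ((g, rot k w :: bs) :: P).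
Proof.
move=> hz; elim: k => [|k IHk] uP sP; first by rewrite rot0.
have [lt_k|ge_k] := ltnP k (size w); last first.
  by rewrite [rot k.+1 w]rot_oversize // ltnW.
rewrite rotS // IHk //; move: uP sP; rewrite !letters_cons /= -!catA => uP sP.
have perm_l : perm_eq (w ++ flatten bs ++ letters P)
    (rot k w ++ flatten bs ++ letters P) by rewrite perm_cat2r perm_sym perm_rot.
have: uniq (rot k w ++ flatten bs ++ letters P) by rewrite -(perm_uniq perm_l).
have: {subset (rot k w ++ flatten bs ++ letters P) <= r}.
  by move=> l; rewrite -(perm_mem perm_l); apply: sP.
case: (rot k w) => // l s s1 u1; rewrite rot1_cons.
rewrite /signed_val !letters_cons /= -!catA cat_rcons.
rewrite (@koszul_swap1 _ _ _ [::] s _ l) //; last by apply: s1; rewrite mem_head.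
rewrite !pieces_val_cons /= map_rcons /=.
rewrite (tft_rot C _ _ (homog_map s hz) (hz l)) andbC.
by case: andb; rewrite /= ?expr0 ?expr1; ring.
Qed.

End Values.

End Pieces.

(** * The three ways of gluing two sides *)

Section Gluing.
Variables (A : frobenius) (C : casimir A) (L : finType).
Implicit Types (P Q : seq (piece L)) (w s t : seq L) (bs : seq (seq L)).
Implicit Types (u v l : L) (o : {set L}) (z : L -> A).

(** Two presentations of one partly glued surface: the data that identify it agree, and so do the
    values. These are compared for homogeneous decorations, where Koszul signs make sense, and for
    every reference word [r] containing the letters. *)
Record same_surface P P' : Prop := SameSurface {
  same_letters : perm_eq (letters P) (letters P');
  same_nexts : forall f, nexts f P = nexts f P';
  same_mono : forall col, mono col P = mono col P';
  same_euler : euler P = euler P';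
  same_nonempty : nonempty P = nonempty P';
  same_val : forall r o z, homL o z -> {subset letters P <= r} ->
    signed_val C r o z P = signed_val C r o z P'
}.

Lemma same_surface_trans P1 P2 P3 :
  same_surface P1 P2 -> same_surface P2 P3 -> same_surface P1 P3.
Proof.
case=> l1 n1 m1 e1 ne1 v1 [l2 n2 m2 e2 ne2 v2]; split=> [||||| r o z hz sP].
- exact: perm_trans l1 l2.
- by move=> f; rewrite n1.
- by move=> f; rewrite m1.
- by rewrite e1.
- by rewrite ne1.
- by rewrite v1 // v2 // => l; rewrite -(perm_mem l1); apply: sP.
Qed.

Lemma same_surface_perm P P' : uniq (letters P) -> perm_eq P P' ->
  same_surface P P'.
Proof.
move=> uP eqP; have perm_w : perm_eq (pwords P) (pwords P').
  by apply/perm_flatten/perm_map.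
split=> [|f|col|||r o z hz sP].
- exact: perm_flatten.
- exact: perm_all.
- exact: perm_all.
- exact: perm_big.
- exact: perm_all.
- exact: signed_val_perm.
Qed.

Lemma mono_cons col (p p' : piece L) P : flatten p.2 =i flatten p'.2 ->
  mono col (p :: P) = mono col (p' :: P).
Proof.
move=> eq_p; rewrite /mono /=; congr (_ && _).
by rewrite (eq_all_r eq_p); apply: eq_all => l; apply: eq_all_r.
Qed.

Lemma same_surface_words g bs bs' P : uniq (letters ((g, bs) :: P)) ->
  perm_eq bs bs' -> same_surface ((g, bs) :: P) ((g, bs') :: P).
Proof.
move=> uP eq_bs; have perm_l := perm_flatten eq_bs.
split=> [|f|col|||r o z hz sP].
- by rewrite !letters_cons perm_cat2r.
- by rewrite /nexts !pwords_cons !all_cat (perm_all _ eq_bs).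
- by apply: mono_cons; apply: perm_mem.
- by rewrite /euler !big_cons /= (perm_size eq_bs).
- by rewrite /nonempty /= -!size_eq0 (perm_size eq_bs) (perm_mem eq_bs).
- exact: signed_val_words.
Qed.

Lemma same_surface_rot g w k bs P : uniq (letters ((g, w :: bs) :: P)) ->
  same_surface ((g, w :: bs) :: P) ((g, rot k w :: bs) :: P).
Proof.
move=> uP; have perm_w : perm_eq w (rot k w) by rewrite perm_sym perm_rot.
split=> [|f|col|||r o z hz sP].
- by rewrite !letters_cons !perm_cat2r.
- by rewrite /nexts !pwords_cons /= rot_cycle.
- by apply: mono_cons; apply: perm_mem; rewrite /= perm_cat2r.
- by rewrite /euler !big_cons /=.
- by rewrite /nonempty /= !inE !(eq_sym [::]) -!size_eq0 size_rot.
- exact: signed_val_rot.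
Qed.

Lemma uniq_same P P' : same_surface P P' -> uniq (letters P) -> uniq (letters P').
Proof. by move=> /same_letters/perm_uniq->. Qed.

(** Reordering pieces and words and rotating one word brings [l] to the very front, so gluing only
    has to deal with leading letters. *)
Lemma same_surface_head P l : uniq (letters P) -> l \in letters P ->
  exists g s bs Q, same_surface P ((g, (l :: s) :: bs) :: Q).
Proof.
move=> uP; rewrite /letters => /flattenP[w /flattenP[_ /mapP[[g bs] Pp ->] /= ws] lw].
have S1 := same_surface_perm uP (perm_to_rem Pp); have u1 := uniq_same S1 uP.
have S2 := same_surface_words u1 (perm_to_rem ws); have u2 := uniq_same S2 u1.
have [k s def_w] := rot_to lw; have S3 := same_surface_rot k u2.
rewrite def_w in S3; exists g, s, (rem w bs), (rem (g, bs) P).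
exact: same_surface_trans S1 (same_surface_trans S2 S3).
Qed.

(** One word splits into two boundary components, two words of one piece create a handle, or two
    pieces merge; the cases mirror the sewing axioms. [u] and [v] remain, as names of the boundary
    segments that follow them. *)
Variant glued u v P P' : Prop :=
| Glued1 g s t bs Q of
    P = (g, (u :: s ++ v :: t) :: bs) :: Q &
    P' = (g, (u :: s) :: (v :: t) :: bs) :: Q
| Glued2 g s t bs Q of
    P = (g, (u :: s) :: (v :: t) :: bs) :: Q &
    P' = (g.+1, (u :: s ++ v :: t) :: bs) :: Q
| Glued3 g g' s t bs bs' Q of
    P = [:: (g, (u :: s) :: bs), (g', (v :: t) :: bs') & Q] &
    P' = ((g + g')%N, (u :: s ++ v :: t) :: bs ++ bs') :: Q.

Lemma glued_exists P u v : uniq (letters P) -> u != v ->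
  u \in letters P -> v \in letters P ->
  exists P1 P', same_surface P P1 /\ glued u v P1 P'.
Proof.
move=> uP neq_uv uinP vinP.
have [g [t [bs [Q S1]]]] := same_surface_head uP vinP.
have u1 := uniq_same S1 uP.
move: uinP; rewrite (perm_mem (same_letters S1)) letters_cons /= inE !mem_cat.
rewrite (negbTE neq_uv) -orbA /= => /or3P[|/flattenP[w wbs uw]|].
- move=> ut; case/splitPr: ut S1 u1 => t1 t2 S1 u1.
  have := same_surface_rot (size (v :: t1)) u1.
  rewrite -[v :: _]cat_cons rot_size_cat => S2.
  exists ((g, (u :: t2 ++ v :: t1) :: bs) :: Q); eexists; split.
    exact: same_surface_trans S1 S2.
  by apply: Glued1; eauto.
- have perm_bs : perm_eq ((v :: t) :: bs) (w :: (v :: t) :: rem w bs).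
    rewrite perm_sym (perm_catCA [:: w] [:: v :: t] (rem w bs)) /= perm_cons.
    rewrite perm_sym.
    exact: perm_to_rem.
  have S2 := same_surface_words u1 perm_bs; have u2 := uniq_same S2 u1.
  have [k s def_w] := rot_to uw; have S3 := same_surface_rot k u2.
  rewrite def_w in S3; eexists; eexists; split.
    exact: same_surface_trans S1 (same_surface_trans S2 S3).
  by apply: Glued2; eauto.
- rewrite /letters => /flattenP[w /flattenP[_ /mapP[[g' bs'] Pp ->] /= ws] uw].
  have perm_Q : perm_eq ((g, (v :: t) :: bs) :: Q)
      ((g', bs') :: (g, (v :: t) :: bs) :: rem (g', bs') Q).
    rewrite perm_sym (perm_catCA [:: (g', bs')] [:: (g, (v :: t) :: bs)]) /=.
    rewrite perm_cons perm_sym.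
    exact: perm_to_rem.
  have S2 := same_surface_perm u1 perm_Q; have u2 := uniq_same S2 u1.
  have S3 := same_surface_words u2 (perm_to_rem ws); have u3 := uniq_same S3 u2.
  have [k s def_w] := rot_to uw; have S4 := same_surface_rot k u3.
  rewrite def_w in S4; eexists; eexists; split.
    apply: same_surface_trans S1 (same_surface_trans S2 _).
    exact: same_surface_trans S3 S4.
  by apply: Glued3; eauto.
Qed.

Lemma glued_letters u v P P' : glued u v P P' -> perm_eq (letters P) (letters P').
Proof.
case=> [g s t bs Q -> -> | g s t bs Q -> -> | g g' s t bs bs' Q -> ->];
  rewrite !letters_cons /= -?catA ?cat_cons -?catA //=.
rewrite flatten_cat -!catA -!cat_cons.
by rewrite perm_cat2l perm_catCA.
Qed.

(** The gluing is along an interval, whose Euler characteristic is 1. *)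
Lemma glued_euler u v P P' : glued u v P P' -> euler P' = euler P - 1.
Proof.
have arith1 (g k e : int) :
  2 - 2 * g - (1 + (1 + k)) + e = 2 - 2 * g - (1 + k) + e - 1 by lia.
have arith2 (g k e : int) :
  2 - 2 * (1 + g) - (1 + k) + e = 2 - 2 * g - (1 + (1 + k)) + e - 1 by lia.
have arith3 (g g' k k' e : int) : 2 - 2 * (g + g') - (1 + (k + k')) + e =
  2 - 2 * g - (1 + k) + (2 - 2 * g' - (1 + k') + e) - 1 by lia.
case=> [g s t bs Q -> -> | g s t bs Q -> -> | g g' s t bs bs' Q -> ->];
  rewrite /euler !big_cons [_.1]/= [_.2]/= [size _]/= ?size_cat ?intS ?PoszD.
- exact: arith1.
- exact: arith2.
- exact: arith3.
Qed.

Lemma glued_nonempty u v P P' : glued u v P P' -> nonempty P -> nonempty P'.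
Proof.
case=> [g s t bs Q -> -> | g s t bs Q -> -> | g g' s t bs bs' Q -> ->];
  rewrite /nonempty /= !inE //= mem_cat negb_or.
by case/and3P=> -> ->.
Qed.

Lemma monoP col P :
  reflect (forall p, p \in P -> {in flatten p.2 &, forall l l', col l = col l'})
          (mono col P).
Proof.
apply: (iffP allP) => h p pP; last first.
  by apply/allP => l lp; apply/allP => l' l'p; apply/eqP/(h p).
by move=> l l' lp l'p; apply/eqP; have /allP/(_ l lp)/allP := h p pP; apply.
Qed.

(** In each case [u] and [v] lie in one piece of [P'], which contains the letters of the pieces they
    came from. *)
Lemma glued_mono u v P P' col : glued u v P P' -> mono col P' ->
  mono col P /\ col u = col v.
Proof.
case=> [g s t bs Q -> -> | g s t bs Q -> -> | g g' s t bs bs' Q -> ->] /monoP h;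
  have h0 := h _ (mem_head _ _);
  (split; last by apply: h0; rewrite /= !(mem_cat, inE) eqxx ?orbT);
  apply/monoP => p; rewrite inE.
- case/predU1P=> [->|pQ]; last by apply: h; rewrite inE pQ orbT.
  by move=> l l'; rewrite /= -catA; apply: h0.
- case/predU1P=> [->|pQ]; last by apply: h; rewrite inE pQ orbT.
  by move=> l l' /= lp l'p; apply: h0; rewrite /= -catA /=.
- rewrite inE => /or3P[/eqP->|/eqP->|pQ]; last by apply: h; rewrite inE pQ orbT.
    move=> l l' /= lp l'p; apply: h0; rewrite /= flatten_cat.
      by move: lp; rewrite !(mem_cat, inE) => /or3P[]->; rewrite ?orbT.
    by move: l'p; rewrite !(mem_cat, inE) => /or3P[]->; rewrite ?orbT.
  move=> l l' /= lp l'p; apply: h0; rewrite /= flatten_cat.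
    by move: lp; rewrite !(mem_cat, inE) => /or3P[]->; rewrite ?orbT.
  by move: l'p; rewrite !(mem_cat, inE) => /or3P[]->; rewrite ?orbT.
Qed.

Definition exchange u v l := if l == u then v else if l == v then u else l.

Lemma fpath_exchange f u v x s : u \notin s -> v \notin s ->
  fpath f x s -> fpath (fun l => exchange u v (f l)) x s.
Proof.
elim: s x => //= y s IHs x; rewrite !inE !negb_or => /andP[uy us] /andP[vy vs].
case/andP=> /eqP-> /IHs->; rewrite // /exchange.
by rewrite ![y == _]eq_sym (negbTE uy) (negbTE vy) ?andbT.
Qed.

(** Composing a permutation with a transposition splits a cycle containing both letters and joins
    two cycles containing one each. This describes the new boundary in all three cases of
    [glued]. *)
Lemma glued_nexts u v P P' f : uniq (letters P) -> glued u v P P' ->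
  nexts f P -> nexts (fun l => exchange u v (f l)) P'.
Proof.
have exu : exchange u v u = v by rewrite /exchange eqxx.
have exv : exchange u v v = u by rewrite /exchange eqxx; case: eqP.
have exch_word w : u \notin w -> v \notin w ->
    fcycle f w -> fcycle (fun l => exchange u v (f l)) w.
  case: w => //= x s; rewrite !inE !negb_or => /andP[ux us] /andP[vx vs].
  by apply: fpath_exchange; rewrite mem_rcons inE negb_or ?ux ?vx.
have exch_words ws : u \notin flatten ws -> v \notin flatten ws ->
    all (fcycle f) ws -> all (fcycle (fun l => exchange u v (f l))) ws.
  elim: ws => //= w ws IHws; rewrite !mem_cat !negb_or => /andP[uw us] /andP[vw vs].
  by case/andP=> /exch_word-> // /IHws->.
have split_uniq s t (R : seq L) : uniq (u :: s ++ v :: t ++ R) ->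
    [/\ u \notin s, v \notin s, u \notin t & v \notin t]
    /\ u \notin R /\ v \notin R.
  rewrite -[_ :: _ ++ _]/((u :: s) ++ _) uniq_middle /= !(mem_cat, inE) !negb_or.
  by case/and3P=> /and4P[_ -> -> ->] /and3P[-> -> ->].
have all1 h w ws : all (fcycle h) (w :: ws) = fcycle h w && all (fcycle h) ws by [].
have merged s t h : fcycle h (u :: s ++ v :: t) =
    [&& fpath h u s, h (last u s) == v, fpath h v t & h (last v t) == u].
  by rewrite /= rcons_cat rcons_cons cat_path /= rcons_path.
have split1 x s h : fcycle h (x :: s) = fpath h x s && (h (last x s) == x).
  by rewrite /= rcons_path.
move=> uP; case=> [g s t bs Q defP -> | g s t bs Q defP -> | g g' s t bs bs' Q defP ->];
  move: uP; rewrite defP /nexts letters_cons !pwords_cons !all_cat.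
- rewrite [(_, _).2]/= [flatten _]/= cat_cons -!catA cat_cons -?catA => uP.
  have [[us vs ut vt] [uR vR]] := split_uniq _ _ _ uP.
  move: uR vR; rewrite !mem_cat !negb_or => /andP[ub uQ] /andP[vb vQ].
  rewrite !all1 merged !split1 -!andbA.
  case/and5P=> fs /eqP lu ft /eqP lv /andP[/exch_words -> // /exch_words -> //].
  by rewrite !fpath_exchange // lu lv exu exv !eqxx.
- rewrite [(_, _).2]/= [flatten _]/= cat_cons -!catA cat_cons -?catA => uP.
  have [[us vs ut vt] [uR vR]] := split_uniq _ _ _ uP.
  move: uR vR; rewrite !mem_cat !negb_or => /andP[ub uQ] /andP[vb vQ].
  rewrite !all1 merged !split1 -!andbA.
  case/and5P=> fs /eqP lu ft /eqP lv /andP[/exch_words -> // /exch_words -> //].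
  by rewrite !fpath_exchange // lu lv exu exv !eqxx.
- rewrite letters_cons ![(_, _).2]/= ![flatten (_ :: _)]/= !cat_cons -?catA
    ?cat_cons -?catA => uP.
  have uP' : uniq (u :: s ++ v :: t ++ flatten bs ++ flatten bs' ++ letters Q).
    move: uP; apply: etrans; apply: perm_uniq.
    rewrite perm_cons perm_cat2l.
    exact: (permEl (perm_catCA (v :: t) (flatten bs) (flatten bs' ++ _))).
  have [[us vs ut vt] [uR vR]] := split_uniq _ _ _ uP'.
  move: uR vR; rewrite !mem_cat !negb_or => /and3P[ub ub' uQ] /and3P[vb vb' vQ].
  rewrite !all1 all_cat merged !split1 -!andbA.
  case/and5P=> fs /eqP lu /exch_words -> // ft /and3P[/eqP lv].
  move=> /exch_words -> // /exch_words -> //.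
  by rewrite !fpath_exchange // lu lv exu exv !eqxx.
Qed.

End Gluing.

Section Sums.
Variables (L : finType) (V : nmodType).

Lemma sum_set_split (Q : pred {set L}) (F : {set L} -> V) (u : L) :
    (forall o, Q (u |: o) = Q o) ->
  \sum_(o | Q o) F o = \sum_(o | Q o && (u \notin o)) (F o + F (u |: o)).
Proof.
move=> Qu; rewrite (bigID (fun o : {set L} => u \in o)) /= addrC big_split /=.
congr (_ + _); rewrite (reindex_onto (fun o => u |: o) (fun o => o :\ u)) /=.
  apply: eq_bigl => o; rewrite Qu setU11 andbT.
  case: (boolP (u \in o)) => ou; last by rewrite setU1K // eqxx andbT.
  rewrite andbF; apply/negbTE/negP => /andP[_ /eqP eq_o].
  by move: ou; rewrite -eq_o !inE eqxx.
by move=> o /andP[_ ou]; rewrite setD1K.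
Qed.

End Sums.

Lemma add_zmod_morphism (U V : zmodType) (f : U -> V) :
  (forall x y : U, f (x + y) = f x + f y) -> zmod_morphism f.
Proof. by move=> fD x y; apply: (addIr (f y)); rewrite -fD !subrK. Qed.

Lemma zmod_morphism_add (U V : zmodType) (f : U -> V) :
  zmod_morphism f -> forall x y : U, f (x + y) = f x + f y.
Proof.
move=> fB; pose g : {additive U -> V} :=
  HB.pack f (GRing.isZmodMorphism.Build U V f fB).
exact: (raddfD g).
Qed.

Lemma zmod_morphism_zero (U V : zmodType) (f : U -> V) : zmod_morphism f -> f 0 = 0.
Proof. by move=> fB; rewrite -(subrr 0) fB subrr. Qed.

(** * Multilinear expansion into parities *)

Section Expansion.
Variables (A : frobenius) (C : casimir A) (L : finType).
Implicit Types (P Q : seq (piece L)) (w s t r : seq L) (bs : seq (seq L)).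
Implicit Types (u v l : L) (o : {set L}) (x z : L -> A).

Definition upd z u a := fun l => if l == u then a else z l.

Definition additive_at (F : (L -> A) -> int) u :=
  forall z, zmod_morphism (fun a => F (upd z u a)).

Lemma eq_pieces_val z z' P : {in letters P, z =1 z'} ->
  pieces_val C z P = pieces_val C z' P.
Proof.
elim: P => [|p P IHP]; first by rewrite /pieces_val !big_nil.
move=> eq_z; rewrite !pieces_val_cons IHP; last first.
  by move=> l lP; apply: eq_z; rewrite letters_cons mem_cat lP orbT.
congr (tft _ _ _ * _); apply/eq_in_map => w wp; apply/eq_in_map => l lw.
apply: eq_z; rewrite letters_cons mem_cat; apply/orP; left.
by apply/flattenP; exists w.
Qed.

Lemma pieces_val_additive P u : uniq (letters P) -> u \in letters P ->
  additive_at (pieces_val C ^~ P) u.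
Proof.
move=> uP uinP z; apply: add_zmod_morphism => a b.
have /flattenP[w /flattenP[_ /mapP[[g bs] Pp ->] /= ws] uw] := uinP.
case/splitPr: Pp uP {uinP} => P1 P2; case/splitPr: ws => bs1 bs2.
case/splitPr: uw => s t.
rewrite letters_cat letters_cons /= flatten_cat /= -!catA cat_cons => uP.
have : u \notin letters P1 ++ flatten bs1 ++ s ++ t ++ flatten bs2 ++ letters P2.
  move: uP; rewrite catA catA uniq_middle -!catA; case/andP=> + _.
  by [].
rewrite !mem_cat !negb_or => /and5P[u1 u2 u3 u4 /andP[u5 u6]].
have upd_out (y : L -> A) c Q : u \notin letters Q ->
    pieces_val C (upd y u c) Q = pieces_val C y Q.
  move=> uQ; apply: eq_pieces_val => l lQ; rewrite /upd; case: eqP => // eq_l.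
  by rewrite -eq_l lQ in uQ.
have map_out c (q : seq L) : u \notin q -> map (upd z u c) q = map z q.
  move=> uq; apply/eq_in_map => l lq; rewrite /upd; case: eqP => // eq_l.
  by rewrite -eq_l lq in uq.
have maps_out c (q : seq (seq L)) : u \notin flatten q ->
    map (map (upd z u c)) q = map (map z) q.
  move=> uq; apply/eq_in_map => e eq; apply: map_out; apply: contra uq => ue.
  by apply/flattenP; exists e.
have mapu c : map (upd z u c) (s ++ u :: t) = map z s ++ c :: map z t.
  by rewrite map_cat /= !map_out // {1}/upd eqxx.
have valE c : pieces_val C (upd z u c) (P1 ++ (g, bs1 ++ (s ++ u :: t) :: bs2) :: P2)
    = pieces_val C z P1 * (tft C g (map (map z) bs1 ++
       (map z s ++ c :: map z t) :: map (map z) bs2) * pieces_val C z P2).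
  rewrite {1}/pieces_val big_cat big_cons /= -![\prod_(p <- _) _]/(pieces_val _ _ _).
  by rewrite !upd_out // map_cat /= mapu !maps_out.
by rewrite !valE tft_add mulrDl mulrDr.
Qed.

Lemma sum_gr_expand F s x : uniq s -> {in s, forall u, additive_at F u} ->
  (forall z z', {in s, z =1 z'} -> F z = F z') ->
  \sum_(o : {set L} | o \subset s) F (fun l => gr (l \in o) (x l)) = F x.
Proof.
move=> us addF extF.
(* Only the letters of [t] are split, the others keeping their value in [y]; this makes an induction
   on [t] possible. *)
suff main t y : {subset t <= s} -> uniq t ->
   \sum_(o : {set L} | o \subset t)
     F (fun l => if l \in t then gr (l \in o) (y l) else y l) = F y.
  rewrite -[RHS](main s) //; apply: eq_bigr => o _.
  by apply: extF => l ->.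
elim: t y => [|u t IHt] y sub_t.
  move=> _; rewrite (bigD1 set0) /=; last first.
    by apply/subsetP => l; rewrite inE.
  rewrite [X in _ + X]big1 ?addr0 // => o /andP[sub_o /set0Pn[l lo]].
  by have := subsetP sub_o l lo; rewrite in_nil.
case/andP=> ut unt; rewrite (@sum_set_split _ _ _ _ u); last first.
  move=> o; apply/subsetP/subsetP => sub_o l lo; first by apply: sub_o; rewrite setU1r.
  by case/setU1P: lo => [->|/sub_o //]; rewrite mem_head.
have -> : F y = F (upd y u (gr false (y u))) + F (upd y u (gr true (y u))).
  rewrite addrC -(zmod_morphism_add (addF u _ y)) ?sub_t ?mem_head //.
  rewrite -gr_sumE; apply: extF => l _; rewrite /upd; by case: eqP => [->|].
have sub_t' : {subset t <= s} by move=> l lt; apply: sub_t; rewrite inE lt orbT.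
rewrite -(IHt (upd y u (gr false (y u)))) // -(IHt (upd y u (gr true (y u)))) //.
rewrite -big_split /=; apply: eq_big => [o|o /andP[_ uo]].
  apply/andP/idP => [[/subsetP sub_o uo]|/subsetP sub_o].
    apply/subsetP => l lo; have := sub_o l lo; rewrite inE => /predU1P[eq_l|//].
    by rewrite -eq_l lo in uo.
  split; last by apply: contra ut => /sub_o.
  by apply/subsetP => l /sub_o lt; rewrite inE lt orbT.
congr (_ + _); apply: extF => l _; rewrite inE /upd.
  by case: eqP => [->|] //=; rewrite (negbTE ut) (negbTE uo).
have [->|neq_l] := eqVneq l u; first by rewrite (negbTE ut) setU11.
by rewrite /= !inE (negbTE neq_l).
Qed.

End Expansion.

(** * The effect of gluing one cut on values *)

Section GlueValue.
Variables (A : frobenius) (C : casimir A) (L : finType).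
Implicit Types (P Q : seq (piece L)) (w s t r : seq L) (bs : seq (seq L)).
Implicit Types (u v l : L) (o : {set L}) (x z : L -> A).
Notation c1 := (@cas1 A C).
Notation c2 := (@cas2 A C).

Definition upd2 z u v a b := upd (upd z v b) u a.

(** The Casimir element being even, the two sides of a cut are odd together or even together; [q] is
    their common parity. *)
Definition pair_in o u v (q : bool) : {set L} := if q then u |: (v |: o) else o.

Lemma map_upd2 z u v a b s : u \notin s -> v \notin s ->
  map (upd2 z u v a b) s = map z s.
Proof.
move=> us vs; apply/eq_in_map => l ls; rewrite /upd2 /upd.
by case: eqP => [eq_l|_]; [rewrite -eq_l ls in us | case: eqP => [eq_l|//];
  rewrite -eq_l ls in vs].
Qed.

Lemma maps_upd2 z u v a b bs : u \notin flatten bs -> v \notin flatten bs ->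
  map (map (upd2 z u v a b)) bs = map (map z) bs.
Proof.
elim: bs => //= w bs IHbs; rewrite !mem_cat !negb_or => /andP[uw ub] /andP[vw vb].
by rewrite map_upd2 // IHbs.
Qed.

Lemma pieces_val_upd2 z u v a b Q : u \notin letters Q -> v \notin letters Q ->
  pieces_val C (upd2 z u v a b) Q = pieces_val C z Q.
Proof.
move=> uQ vQ; apply: eq_pieces_val => l lQ; rewrite /upd2 /upd.
by case: eqP => [eq_l|_]; [rewrite -eq_l lQ in uQ | case: eqP => [eq_l|//];
  rewrite -eq_l lQ in vQ].
Qed.

Lemma tft_unit g (s t : seq A) (bs : seq (seq A)) :
  tft C g ((1 :: s) :: (1 :: t) :: bs) = tft C g (s :: t :: bs).
Proof. by apply: tft_eq_prod; rewrite /= !word_prod_cons !mul1r. Qed.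

Lemma tft_unit2 g (s t : seq A) (bs : seq (seq A)) :
  tft C g ((1 :: s ++ 1 :: t) :: bs) = tft C g ((s ++ t) :: bs).
Proof.
by apply: tft_eq_prod; rewrite // word_prod_cons !word_prod_cat word_prod_cons !mul1r.
Qed.

Lemma upd2u z u v a b : upd2 z u v a b u = a.
Proof. by rewrite /upd2 /upd eqxx. Qed.

Lemma upd2v z u v a b : u != v -> upd2 z u v a b v = b.
Proof. by rewrite /upd2 /upd eq_sym eqxx => /negbTE->. Qed.

(** Each case of [glued] is one sewing law of [tft]; what remains is to match its sign with the
    Koszul signs of the two orders of the letters. After gluing, [u] and [v] carry 1 and drop out of
    the products. *)
Lemma glued_signed_val u v P P' r1 r2 o z :
    glued u v P P' -> uniq (letters P) -> uniq (r1 ++ u :: v :: r2) ->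
    {subset letters P <= r1 ++ u :: v :: r2} ->
    homL o z -> u \notin o -> v \notin o ->
  signed_val C (r1 ++ u :: v :: r2) o (upd2 z u v 1 1) P' =
    \sum_i \sum_q
      koszul (pair_in o u v q) (r1 ++ u :: v :: r2) (letters P) *
      pieces_val C (upd2 z u v (c1 i) (gr q (c2 i))) P.
Proof.
move=> gP uP ur sP hz ou ov; set r := r1 ++ _ in sP *.
(* Making both sides of the cut odd costs the passage of [v] over the letters [s] between them. *)
have kE q s d : letters P = u :: s ++ v :: d ->
    koszul (pair_in o u v q) r (letters P) =
    (-1) ^+ (odd_in o s && q) * koszul o r (letters P).
  move=> lP; case: q; last by rewrite andbF mul1r.
  rewrite andbT lP koszul_pair //; first by rewrite -lP.
  move=> l lsd; move: (uP); rewrite lP -cat_cons uniq_middle /= inE negb_or.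
  case/and3P=> /andP[_ vsd] usd _.
  have := sP l; rewrite lP /r -cat_cons !(mem_cat, inE) => sPl.
  have [lu|neq_u] := eqVneq l u; first by rewrite -lu lsd in usd.
  have [lv|neq_v] := eqVneq l v; first by rewrite -lv lsd in vsd.
  move: sPl; rewrite (negbTE neq_u) (negbTE neq_v) /=; apply.
  by move: lsd; rewrite mem_cat.
have split_uniq s t (R : seq L) : uniq (u :: s ++ v :: t ++ R) ->
    [/\ u \notin s, v \notin s, u \notin t & v \notin t]
    /\ [/\ u \notin R, v \notin R & u != v].
  rewrite -[_ :: _ ++ _]/((u :: s) ++ _) uniq_middle /= !(mem_cat, inE) !negb_or.
  by rewrite eq_sym; case/and3P=> /and4P[-> -> -> ->] /and3P[-> -> ->].
case: gP uP sP kE => [g s t bs Q -> -> | g s t bs Q -> -> | g g' s t bs bs' Q -> ->] uP sP kE.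
- have lP : letters ((g, (u :: s ++ v :: t) :: bs) :: Q) =
    u :: s ++ v :: t ++ flatten bs ++ letters Q.
    by rewrite letters_cons /= -!catA /= -?catA.
  have [[us vs ut vt] [+ + neq_uv]] := split_uniq _ _ _ (eq_ind _ uniq uP _ lP).
  rewrite !mem_cat !negb_or => /andP[ub uQ] /andP[vb vQ].
  have lP' : letters ((g, (u :: s) :: (v :: t) :: bs) :: Q) =
     letters ((g, (u :: s ++ v :: t) :: bs) :: Q).
    by rewrite lP letters_cons /= -!catA /= -?catA.
  rewrite /signed_val lP' pieces_val_cons (pieces_val_upd2 _ _ _ uQ vQ) /=.
  rewrite !map_upd2 // maps_upd2 // upd2u upd2v // tft_unit.
  rewrite (sew1 C _ _ _ (homog_map s hz)) big_distrl big_distrr; apply: eq_bigr => i _ /=.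
  rewrite big_distrl big_distrr; apply: eq_bigr => q _ /=.
  rewrite (kE _ _ _ lP) pieces_val_cons (pieces_val_upd2 _ _ _ uQ vQ) /=.
  by rewrite map_cat /= !map_upd2 // maps_upd2 // upd2u upd2v //; ring.
- have lP : letters ((g, (u :: s) :: (v :: t) :: bs) :: Q) =
    u :: s ++ v :: t ++ flatten bs ++ letters Q.
    by rewrite letters_cons /= -!catA /= -?catA.
  have [[us vs ut vt] [+ + neq_uv]] := split_uniq _ _ _ (eq_ind _ uniq uP _ lP).
  rewrite !mem_cat !negb_or => /andP[ub uQ] /andP[vb vQ].
  have lP' : letters ((g.+1, (u :: s ++ v :: t) :: bs) :: Q) =
     letters ((g, (u :: s) :: (v :: t) :: bs) :: Q).
    by rewrite lP letters_cons /= -!catA /= -?catA.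
  rewrite /signed_val lP' pieces_val_cons (pieces_val_upd2 _ _ _ uQ vQ) /=.
  rewrite map_cat /= !map_upd2 // maps_upd2 // upd2u upd2v // tft_unit2.
  rewrite (sew2 C _ _ _ (homog_map s hz)) big_distrl big_distrr; apply: eq_bigr => i _ /=.
  rewrite big_distrl big_distrr; apply: eq_bigr => q _ /=.
  rewrite (kE _ _ _ lP) pieces_val_cons (pieces_val_upd2 _ _ _ uQ vQ) /=.
  by rewrite !map_upd2 // maps_upd2 // upd2u upd2v //; ring.
- set P3 := [:: _, _ & _] in uP sP kE *.
  have lP : letters P3 = u :: (s ++ flatten bs) ++ v :: t ++ flatten bs' ++ letters Q.
    by rewrite !letters_cons /= -!catA /= -?catA.
  have lP' : letters ((g + g', (u :: s ++ v :: t) :: bs ++ bs') :: Q)%N =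
     u :: s ++ v :: t ++ flatten bs ++ flatten bs' ++ letters Q.
    by rewrite letters_cons /= flatten_cat -!catA /= -?catA.
  have perm_l : perm_eq (letters P3)
      (u :: s ++ v :: t ++ flatten bs ++ flatten bs' ++ letters Q).
    rewrite lP -!catA perm_cons perm_cat2l.
    exact: (permEl (perm_catCA (flatten bs) (v :: t) (flatten bs' ++ _))).
  have uP' := eq_ind _ is_true uP _ (perm_uniq perm_l).
  have [[us vs ut vt] [+ + neq_uv]] := split_uniq _ _ _ uP'.
  rewrite !mem_cat !negb_or => /and3P[ub ub' uQ] /and3P[vb vb' vQ].
  rewrite /signed_val lP' pieces_val_cons (pieces_val_upd2 _ _ _ uQ vQ) /=.
  rewrite !map_cat /= !map_upd2 // !maps_upd2 // upd2u upd2v // tft_unit2.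
  rewrite (sew3 C _ _ _ (homog_map s hz) (homog_map t hz) (homog_flatten_map bs hz)).
  rewrite big_distrl big_distrr; apply: eq_bigr => i _ /=.
  rewrite big_distrl big_distrr; apply: eq_bigr => q _ /=.
  rewrite (kE _ _ _ lP) !pieces_val_cons (pieces_val_upd2 _ _ _ uQ vQ) /=.
  rewrite !map_upd2 // !maps_upd2 // upd2u upd2v //.
  (* The words [bs] precede [v :: t] in [P3] but follow it in the merged piece; this exchange
     accounts for the sign of [sew3] that involves the parities of [t] and [bs]. *)
  rewrite -[u :: s ++ _]cat_cons -[v :: t ++ _]cat_cons koszul_swap //; last first.
    by move=> l lvt; apply: sP; rewrite (perm_mem perm_l) -[v :: t ++ _]cat_cons
      inE !mem_cat lvt !orbT.
  rewrite odd_in_cons (negbTE ov) odd_in_cat lP [_ && q]andbC -!catA /=.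
  by case: (odd_in o t); case: (odd_in o (flatten bs)); case: (odd_in o s); case: q;
    rewrite /= ?expr0 ?expr1; ring.
Qed.

End GlueValue.

Section GlueTotal.
Variables (A : frobenius) (C : casimir A) (L : finType).
Implicit Types (P Q : seq (piece L)) (r : seq L).
Implicit Types (u v l : L) (o : {set L}) (x z : L -> A).
Notation c1 := (@cas1 A C).
Notation c2 := (@cas2 A C).

Definition total_val r x P : int :=
  \sum_(o : {set L} | o \subset r)
    signed_val C r o (fun l => gr (l \in o) (x l)) P.

Lemma pieces_val_zero P u z : uniq (letters P) -> u \in letters P -> z u = 0 ->
  pieces_val C z P = 0.
Proof.
move=> uP uinP zu; rewrite -(zmod_morphism_zero (pieces_val_additive C uP uinP z)).
by apply: eq_pieces_val => l _; rewrite /upd; case: eqP => [->|].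
Qed.

Lemma upd2_additive_l P u v z b : uniq (letters P) -> u \in letters P ->
  zmod_morphism (fun a => pieces_val C (upd2 z u v a b) P).
Proof. by move=> uP uinP; apply: pieces_val_additive. Qed.

Lemma upd2_additive_r P u v z a : uniq (letters P) -> v \in letters P -> u != v ->
  zmod_morphism (fun b => pieces_val C (upd2 z u v a b) P).
Proof.
move=> uP vinP neq_uv b b'.
have upd2C b0 : pieces_val C (upd2 z u v a b0) P =
    pieces_val C (upd (upd z u a) v b0) P.
  apply: eq_pieces_val => l _; rewrite /upd2 /upd.
  by case: eqP => [->|//]; rewrite (negbTE neq_uv).
by rewrite !upd2C (pieces_val_additive C uP vinP (upd z u a)).
Qed.

Lemma subset_setU1 o u r : u \in r -> (u |: o \subset r) = (o \subset r).
Proof.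
move=> ur; apply/subsetP/subsetP => sub_o l lo; first by apply: sub_o; rewrite setU1r.
by case/setU1P: lo => [->|/sub_o].
Qed.

(** The sets of odd letters are grouped in fours according to [u] and [v]. After gluing only the set
    with both even survives, as 1 is even; before gluing the two mixed sets contribute 0 by
    [cas_gr], and the two others form the sum over [q] in [glued_signed_val]. *)
Lemma glued_total_val u v P P' r1 r2 x :
    glued u v P P' -> uniq (letters P) -> uniq (r1 ++ u :: v :: r2) ->
    {subset letters P <= r1 ++ u :: v :: r2} ->
  \sum_i total_val (r1 ++ u :: v :: r2) (upd2 x u v (c1 i) (c2 i)) P =
    total_val (r1 ++ u :: v :: r2) (upd2 x u v 1 1) P'.
Proof.
move=> gP uP ur sP; set r := r1 ++ _ in sP *.
have [ru rv] : u \in r /\ v \in r by rewrite /r !(mem_cat, inE) !eqxx !orbT.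
have perm_l := glued_letters gP; have uP' := uP; rewrite (perm_uniq perm_l) in uP'.
have [uinP vinP] : u \in letters P /\ v \in letters P.
  by case: gP => [g s t bs Q -> _ | g s t bs Q -> _ | g g' s t bs bs' Q -> _];
    rewrite !letters_cons /= !(mem_cat, inE) !eqxx ?orbT.
have [uinP' vinP'] : u \in letters P' /\ v \in letters P'.
  by rewrite -!(perm_mem perm_l).
have neq_uv : u != v.
  move: ur; rewrite /r uniq_middle mem_cat inE !negb_or.
  by case/andP=> /and3P[].
pose Q1 (o : {set L}) := o \subset r.
pose Q2 (o : {set L}) := Q1 o && (u \notin o).
have Q1u o : Q1 (u |: o) = Q1 o by exact: subset_setU1.
have Q2v o : Q2 (v |: o) = Q2 o.
  by rewrite /Q2 /Q1 subset_setU1 // in_setU1 (negbTE neq_uv).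
rewrite /total_val exchange_big /=.
rewrite [LHS](sum_set_split _ Q1u) [LHS](sum_set_split _ Q2v).
rewrite [RHS](sum_set_split _ Q1u) [RHS](sum_set_split _ Q2v).
apply: eq_bigr => o /andP[/andP[_ uo] vo].
pose zo l := gr (l \in o) (x l).
have hzo : homL o zo by move=> l; apply: gr_hom.
have odd_zero (e : {set L}) : (u \in e) || (v \in e) ->
    signed_val C r e (fun l => gr (l \in e) (upd2 x u v 1 1 l)) P' = 0.
  rewrite /signed_val => /orP[ue|ve].
    by rewrite (pieces_val_zero uP' uinP') ?mulr0 // upd2u ue (hom_gr _ (hom1 A)).
  by rewrite (pieces_val_zero uP' vinP') ?mulr0 // upd2v // ve (hom_gr _ (hom1 A)).
rewrite (odd_zero (u |: o)) ?setU11 // (odd_zero (v |: o)) ?setU11 ?orbT //.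
rewrite (odd_zero (u |: (v |: o))) ?setU11 // !addr0.
rewrite [RHS](_ : _ = signed_val C r o (upd2 zo u v 1 1) P'); last first.
  rewrite /signed_val; congr (_ * _); apply: eq_pieces_val => l _.
  rewrite /upd2 /upd /zo; case: eqP => [->|_].
    by rewrite (negbTE uo) (hom_gr _ (hom1 A)).
  by case: eqP => [->|_] //; rewrite (negbTE vo) (hom_gr _ (hom1 A)).
rewrite (glued_signed_val C gP uP ur sP hzo uo vo).
pose B a b := pieces_val C (upd2 zo u v a b) P.
have Br a : zmod_morphism (B a) by apply: upd2_additive_r.
have Bl b : zmod_morphism (B^~ b) by apply: upd2_additive_l.
have valE (e : {set L}) i : (forall l, l != u -> l != v -> (l \in e) = (l \in o)) ->
   signed_val C r e (fun l => gr (l \in e) (upd2 x u v (c1 i) (c2 i) l)) P =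
   koszul e r (letters P) * B (gr (u \in e) (c1 i)) (gr (v \in e) (c2 i)).
  move=> eq_e; rewrite /signed_val; congr (_ * _); apply: eq_pieces_val => l _.
  rewrite /upd2 /upd /zo; have [->//|neq_u] := eqVneq l u.
  by have [->//|neq_v] := eqVneq l v; rewrite eq_e.
have sumE (e : {set L}) : (forall l, l != u -> l != v -> (l \in e) = (l \in o)) ->
   \sum_i signed_val C r e (fun l => gr (l \in e) (upd2 x u v (c1 i) (c2 i) l)) P =
   koszul e r (letters P) *
     if (u \in e) == (v \in e) then \sum_i B (c1 i) (gr (v \in e) (c2 i)) else 0.
  move=> eq_e; under eq_bigr do rewrite valE //.
  by rewrite -big_distrr /= cas_gr.
have vu : (v == u) = false by rewrite eq_sym (negbTE neq_uv).
rewrite !sumE; first last.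
- by [].
- by move=> l lu lv; rewrite !inE (negbTE lu).
- by move=> l lu lv; rewrite !inE (negbTE lv).
- by move=> l lu lv; rewrite !inE (negbTE lu) (negbTE lv).
rewrite !inE !eqxx (negbTE uo) (negbTE vo) (negbTE neq_uv) vu /= !mulr0 addr0 add0r.
under [RHS]eq_bigr do rewrite big_bool.
by rewrite big_split addrC -!big_distrr.
Qed.

End GlueTotal.

Section Cycles.
Variables (A : frobenius) (C : casimir A) (L : finType).

(** Distinct letters with a prescribed successor leave no freedom but the order and the starting
    points of the words. [pre] collects the words already matched. *)
Lemma same_surface_cycles (f : L -> L) h (bs bs' pre : seq (seq L)) :
    uniq (flatten (bs ++ pre)) -> perm_eq (flatten bs) (flatten bs') ->
    all (fcycle f) bs -> all (fcycle f) bs' -> [::] \notin bs -> [::] \notin bs' ->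
  same_surface C [:: (h, bs ++ pre)] [:: (h, bs' ++ pre)].
Proof.
have letters1 h' (ws : seq (seq L)) : letters [:: (h', ws)] = flatten ws.
  by rewrite letters_cons /= cats0.
elim: bs' bs pre => [|w bs' IHbs] bs pre u_bs perm_bs.
  case: bs u_bs perm_bs => [|[|l s] bs] //= _ perm_bs _ _ _ _.
  by have := perm_size perm_bs.
move=> /= f_bs /andP[f_w f_bs']; rewrite inE negb_or => ne_bs.
case: w perm_bs f_w => // l s perm_bs f_w /andP[_ ne_bs'].
have /flattenP[w wbs lw] : l \in flatten bs.
  by rewrite (perm_mem perm_bs) inE eqxx.
have perm_w := perm_to_rem wbs.
have u_ws : uniq (l :: s).
  have : uniq (flatten bs).
    by move: u_bs; rewrite flatten_cat cat_uniq; case/andP.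
  rewrite (perm_uniq perm_bs) -[flatten _]/((l :: s) ++ flatten bs').
  by rewrite cat_uniq; case/andP.
have [k s' def_w] := rot_to lw.
have u_w : uniq w.
  move: u_bs; rewrite flatten_cat cat_uniq (perm_uniq (perm_flatten perm_w)) /=.
  by rewrite cat_uniq -!andbA; case/andP.
have f_w' : fcycle f (l :: s') by rewrite -def_w rot_cycle (allP f_bs).
(* A duplicate-free cycle of [f] starting at [l] is the orbit of [l], so the two words through [l]
   agree. *)
have eq_s : l :: s' = l :: s.
  rewrite -(undup_id u_ws) (undup_cycle_cons f_w) -(undup_cycle_cons f_w').
  by rewrite undup_id // -def_w rot_uniq.
have uL (ws : seq (seq L)) : perm_eq (bs ++ pre) ws -> uniq (letters [:: (h, ws)]).
  by move=> perm_ws; rewrite letters1 -(perm_uniq (perm_flatten perm_ws)).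
have perm1 : perm_eq (bs ++ pre) (w :: rem w bs ++ pre).
  by rewrite -cat_cons perm_cat2r.
apply: (same_surface_trans (same_surface_words C (g := h) (P := [::]) _ perm1)).
  by rewrite letters1.
have S2 := same_surface_rot C k (uL _ perm1).
rewrite def_w eq_s in S2; apply: (same_surface_trans S2).
have u2 := uniq_same S2 (uL _ perm1).
have perm3 : perm_eq ((l :: s) :: rem w bs ++ pre) (rem w bs ++ (l :: s) :: pre).
  by rewrite -cat1s perm_catCA.
have S3 := same_surface_words C u2 perm3.
apply: (same_surface_trans S3); have u3 := uniq_same S3 u2.
have perm4 : perm_eq (flatten (rem w bs)) (flatten bs').
  have : perm_eq (w ++ flatten (rem w bs)) ((l :: s) ++ flatten bs').
    by rewrite -(permPl (perm_flatten perm_w)).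
  move=> perm_wF; rewrite -(perm_cat2l w); apply: (perm_trans perm_wF).
  by rewrite perm_cat2r -eq_s -def_w perm_rot.
rewrite letters1 in u3.
apply: (same_surface_trans (IHbs _ _ u3 perm4 _ _ _ _)) => //.
- by apply/allP => x /mem_rem /(allP f_bs).
- by apply: contra ne_bs; apply: mem_rem.
apply: same_surface_words; last by rewrite -cat1s perm_catCA.
move: u3; rewrite letters1 !flatten_cat; apply: etrans; apply: perm_uniq.
by rewrite perm_cat2r perm_sym.
Qed.

End Cycles.

(** * Gluing all the cuts *)

Section CutGluing.
Variables (A : frobenius) (C : casimir A) (D K : finType) (a : D -> A).
Notation L := (letter D K).
Implicit Types (P Q : seq (piece L)) (w s t : seq L) (bs : seq (seq L)).
Implicit Types (U : {set K}) (c : K) (l : L) (f : {ffun K -> option (cas_idx C)}).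
Notation c1 := (@cas1 A C).
Notation c2 := (@cas2 A C).

Definition cut_side c b : L := inr (c, b).

(** The sides of the cuts that are already glued are decorated by 1. *)
Definition side_val f l : A :=
  match l with
  | inl d => a d
  | inr (c, b) => if f c is Some i then if b then c2 i else c1 i else 1
  end.

(** For the set [U] of unglued cuts, composing with this map cancels the flips built into the
    boundary walks at those cuts. *)
Definition flip_in U l : L :=
  if l is inr (c, b) then if c \in U then inr (c, ~~ b) else l else l.

(** The value [None] marks the cuts already glued; those in [U] still carry a Casimir index. *)
Definition supported U f := [forall c, (f c != None) == (c \in U)].

Definition setf f c y : {ffun K -> option (cas_idx C)} :=
  [ffun c' => if c' == c then y else f c'].

Lemma sum_supported U c (X : {ffun K -> option (cas_idx C)} -> int) : c \in U ->
  \sum_(f | supported U f) X f =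
    \sum_(f | supported (U :\ c) f) \sum_j X (setf f c (Some j)).
Proof.
move=> cU; rewrite [RHS]exchange_big /=.
transitivity (\sum_(f | supported U f) \sum_(j | f c == Some j) X f).
  apply: eq_bigr => f /forallP/(_ c)/eqP; rewrite cU; case: (f c) => // j _.
  rewrite (big_pred1 j) // => j'; by apply/eqP/eqP => [[->]|->].
rewrite (exchange_big_dep xpredT) //=; apply: eq_bigr => j _.
rewrite (reindex_onto (fun f => setf f c (Some j)) (fun f => setf f c None)) /=.
  apply: eq_bigl => f.
  have -> : setf f c (Some j) c == Some j by rewrite ffunE eqxx.
  rewrite andbT.
  apply/andP/forallP => [[/forallP supf /eqP eq_f] c'|supf].
    rewrite -eq_f ffunE !inE; have [->//|neq_c] := eqVneq c' c.
    by have := supf c'; rewrite !ffunE (negbTE neq_c).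
  split; first apply/forallP => c'.
    rewrite ffunE; have [->|neq_c] := eqVneq c' c; first by rewrite cU.
    by have := supf c'; rewrite !inE neq_c.
  apply/eqP/ffunP => c'; rewrite !ffunE; have [->|//] := eqVneq c' c.
  by have := supf c; rewrite !inE eqxx; case: (f c).
move=> f /andP[_ /eqP fc]; apply/ffunP => c'; rewrite !ffunE.
by have [->|] := eqVneq c' c.
Qed.

Lemma sum_supportedT (X : {ffun K -> option (cas_idx C)} -> int) :
  \sum_(i : {ffun K -> cas_idx C}) X [ffun c => Some (i c)] =
    \sum_(f | supported setT f) X f.
Proof.
transitivity (\sum_(f | supported setT f)
    \sum_(i : {ffun K -> cas_idx C} | [ffun c => Some (i c)] == f) X f).
  rewrite (exchange_big_dep xpredT) //=; apply: eq_bigr => i _.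
  rewrite (big_pred1 [ffun c => Some (i c)]) // => f /=.
  rewrite [RHS]eq_sym; apply/andP/idP => [[_ //]|/eqP<-]; split=> //.
  by apply/forallP => c; rewrite ffunE inE.
apply: eq_bigr => f /forallP supf.
have [i def_f] : exists i : K -> cas_idx C, forall c, f c = Some (i c).
  apply: (@fin_all_exists _ (fun=> cas_idx C) (fun c j => f c = Some j)) => c.
  have := supf c; rewrite inE.
  by case: (f c) => // j _; exists j.
rewrite (big_pred1 (finfun i)) // => i' /=; apply/eqP/eqP => [eq_f|->].
  apply/ffunP => c; have := def_f c; rewrite -eq_f !ffunE => -[->//].
by apply/ffunP => c; rewrite !ffunE def_f.
Qed.

Section FixedBoundary.
Variables (bd : seq (seq D)) (g : nat) (walks : seq (seq L)).
Variable next_side : L -> L.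

Definition all_letters : seq L :=
  map inl (flatten bd) ++ [seq inr (c, e) | c <- enum K, e <- [:: false; true]].

Hypotheses (uniq_bd : uniq (flatten bd)) (bd_neq0 : bd != [::]).
Hypotheses (walks_perm : perm_eq (flatten walks) all_letters)
  (walks_cycles : all (fcycle next_side) walks) (walks_nonempty : [::] \notin walks)
  (walks_bd : map (pmap (@marking D K)) walks = bd).

Lemma cut_side_eq c c' b b' :
  (inr (c', b') == cut_side c b :> L) = (c' == c) && (b' == b).
Proof. by apply/eqP/andP => [[-> ->]|[/eqP-> /eqP->]]. Qed.

Lemma cut_side_in c b : cut_side c b \in all_letters.
Proof.
rewrite mem_cat; apply/orP; right; apply/flatten_mapP; exists c.
  by rewrite mem_enum.
by case: b; rewrite !inE eqxx ?orbT.
Qed.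

Lemma uniq_all_letters : uniq all_letters.
Proof.
rewrite cat_uniq map_inj_uniq ?uniq_bd; last by move=> d d' [].
rewrite allpairs_uniq ?enum_uniq //; last by move=> [c e] [c' e'] _ _ [-> ->].
rewrite andbT; apply/hasPn => l /allpairsPdep[c [e [_ _ ->]]].
by apply/mapP => -[].
Qed.

Lemma all_letters_split c : exists r1 r2,
  all_letters = r1 ++ cut_side c false :: cut_side c true :: r2.
Proof.
rewrite /all_letters; have : c \in enum K by rewrite mem_enum.
case/splitPr=> k1 k2.
exists (map inl (flatten bd) ++ [seq inr (c, e) | c <- k1, e <- [:: false; true]]).
exists [seq inr (c, e) | c <- k2, e <- [:: false; true]].
by rewrite allpairs_cat /= -catA.
Qed.

(** The boundary of the surface does not change while the cuts in [U] are
    glued: gluing a cut composes the successor in the words with the exchange of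
    the two sides of the cut. *)
Record partly_glued U P : Prop := PartlyGlued {
  pg_letters : perm_eq (letters P) all_letters;
  pg_nexts : nexts (fun l => flip_in U (next_side l)) P;
  pg_connected : forall col, mono col P ->
    (forall c, c \in U -> col (cut_side c false) = col (cut_side c true)) ->
    {in letters P &, forall l l', col l = col l'};
  pg_euler : euler P - #|U|%:Z = 2 - 2 * g%:Z - (size bd)%:Z;
  pg_nonempty : nonempty P
}.

Lemma partly_glued_same U P P' : same_surface C P P' -> partly_glued U P ->
  partly_glued U P'.
Proof.
case=> l1 n1 m1 e1 ne1 _ [l2 n2 m2 e2 ne2].
have mem_l := perm_mem l1; split.
- by rewrite -(permPl l1).
- by rewrite -n1.
- by move=> col; rewrite -m1 => h h' l l'; rewrite -!mem_l; apply: m2.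
- by rewrite -e1.
- by rewrite -ne1.
Qed.

(** The transposition in [glued_nexts] exchanges the two sides of [c], which is exactly the flip by
    which [flip_in U] and [flip_in (U :\ c)] differ. *)
Lemma partly_glued_step U P P' c : c \in U ->
    glued (cut_side c false) (cut_side c true) P P' -> partly_glued U P ->
  partly_glued (U :\ c) P'.
Proof.
move=> cU gP [l1 n1 m1 e1 ne1].
have perm_l := glued_letters gP.
have uP : uniq (letters P) by rewrite (perm_uniq l1) uniq_all_letters.
split.
- by rewrite -(permPl perm_l).
- have := glued_nexts uP gP n1; apply: sub_all => w; apply: sub_cycle => l l'.
  move=> /= /eqP<-; apply/eqP; rewrite /exchange /flip_in /cut_side.
  case: (next_side l) => [//|[c' e]]; rewrite !inE.
  have [->|neq_c] /= := eqVneq c' c; first last.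
    have neq_s b b' : (inr (c', b) == inr (c, b') :> L) = false.
      by apply/eqP => -[eq_c _]; rewrite eq_c eqxx in neq_c.
    by case: ifP => _; rewrite !neq_s.
  by rewrite cU; case: e; [rewrite eqxx | case: eqP => [[]|_] //; rewrite eqxx].
- move=> col mono_col col_cuts l l'; rewrite -!(perm_mem perm_l).
  have [mono_P col_c] := glued_mono gP mono_col.
  apply: m1 => // c' c'U; have [->//|neq_c] := eqVneq c' c.
  by apply: col_cuts; rewrite !inE neq_c.
- rewrite (glued_euler gP) -e1 (cardsD1 c U) cU.
  by rewrite add1n intS opprD addrA.
- exact: glued_nonempty gP ne1.
Qed.

(** Connectedness leaves a single piece, the successor function fixes its words up to order and
    rotation, and the Euler characteristic gives its genus. *)
Lemma partly_glued_end P : partly_glued set0 P ->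
  same_surface C P [:: (g, walks)].
Proof.
have arith (i j k : int) : 2 - 2 * i - k = 2 - 2 * j - k -> j = i by lia.
case=> perm_P nexts_P conn_P euler_P ne_P.
have uP : uniq (letters P) by rewrite (perm_uniq perm_P) uniq_all_letters.
have head_letter (p : piece L) Q : nonempty (p :: Q) ->
    exists2 l, l \in flatten p.2 & l \in letters (p :: Q).
  case: p => h [|[|l s] bs] //= _.
  by exists l; rewrite ?letters_cons ?mem_cat /= inE eqxx.
case: P perm_P nexts_P conn_P euler_P ne_P uP => [|p Q] perm_P nexts_P conn_P euler_P ne_P uP.
  (* Without pieces there would be no letters, hence no nonempty walks, against [bd != [::]]. *)
  move: walks_nonempty walks_bd; rewrite -(permPr walks_perm) in perm_P.
  have := perm_size perm_P; case: (walks) => [_ _ eq_bd|[|l s] ws] //.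
  by move: bd_neq0; rewrite -eq_bd.
have {ne_P} [ne_p ne_Q] : nonempty [:: p] /\ nonempty Q.
  by move: ne_P; rewrite /nonempty /= andbT => /andP[].
case: Q perm_P nexts_P conn_P euler_P uP ne_Q => [|q Q] perm_P nexts_P conn_P euler_P uP ne_Q.
  case: p perm_P nexts_P conn_P euler_P uP ne_p => h bs perm_P nexts_P _ euler_P uP ne_p.
  have perm_bs : perm_eq (flatten bs) (flatten walks).
    by move: perm_P; rewrite letters_cons cats0 -(permPr walks_perm).
  have u_bs : uniq (flatten (bs ++ [::])) by move: uP; rewrite letters_cons !cats0.
  have f_bs : all (fcycle next_side) bs.
    move: nexts_P; rewrite /nexts pwords_cons cats0; apply: sub_all => w.
    apply: sub_cycle => l l' /= /eqP<-; rewrite /flip_in.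
    by case: (next_side l) => [//|[c e]]; rewrite inE.
  have ne_bs : [::] \notin bs by move: ne_p => /andP[/andP[]].
  have := same_surface_cycles C h u_bs perm_bs f_bs walks_cycles ne_bs walks_nonempty.
  rewrite !cats0 => S; suff <- : h = g by [].
  have := same_euler S; rewrite cards0 subr0 in euler_P; rewrite euler_P /euler.
  by rewrite big_seq1 /= -walks_bd size_map => /arith[].
(* With two pieces, membership in the first one is a nonconstant colouring that is constant on each
   piece. *)
exfalso; have [l lp lP] := head_letter _ _ ne_p.
have [l' l'q l'P] := head_letter _ _ ne_Q.
pose col l := l \in flatten p.2.
have lP' : l \in letters [:: p, q & Q] by rewrite letters_cons mem_cat lp.
have l'P' : l' \in letters [:: p, q & Q].
  by rewrite letters_cons mem_cat l'P orbT.
have mono_col : mono col [:: p, q & Q].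
  apply/monoP => p'; rewrite inE => /predU1P[->|p'Q] i j ip jp.
    by rewrite /col ip jp.
  move: uP; rewrite letters_cons cat_uniq => /and3P[_ /hasPn dis _].
  have out k : k \in flatten p'.2 -> col k = false.
    move=> kp; apply/negbTE; apply: dis; rewrite /letters /pwords.
    apply/flattenP; have /flattenP[w wp kw] := kp; exists w => //.
    by apply/flattenP; exists p'.2 => //; apply: map_f.
  by rewrite !out.
have l'p : l' \in flatten p.2.
  have cuts c : c \in set0 -> col (cut_side c false) = col (cut_side c true).
    by rewrite inE.
  by have := conn_P col mono_col cuts l l' lP' l'P'; rewrite /col lp => <-.
by move: uP; rewrite letters_cons cat_uniq => /and3P[_ /hasPn/(_ l' l'P)/negP].
Qed.

(** A side decorated by 1 must be even, so only marked letters can be odd. The walks list these in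
    the order of [bd], so the sign is 1, and summing over their parities restores [a]. *)
Lemma total_val_end f : (forall c, f c = None) ->
  total_val C all_letters (side_val f) [:: (g, walks)] =
    tft C g (map (map a) bd).
Proof.
move=> f0; set x := side_val f.
have letters1 h (ws : seq (seq L)) : letters [:: (h, ws)] = flatten ws.
  by rewrite letters_cons /= cats0.
have val1 h z (ws : seq (seq L)) : pieces_val C z [:: (h, ws)] =
    tft C h (map (map z) ws) by rewrite /pieces_val big_seq1.
pose marked : seq L := map inl (flatten bd).
have x_side (s : K * bool) : x (inr s) = 1 by case: s => c e; rewrite /x /side_val f0.
pose bdL : seq (seq L) := map (map inl) bd.
have flat_bdL : flatten bdL = marked by rewrite /marked map_flatten.
have u_marked : uniq marked by rewrite map_inj_uniq // => d d' [].
rewrite /total_val (bigID (fun o : {set L} => o \subset marked)) /= addrC big1 => [|o].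
  rewrite add0r.
  transitivity (\sum_(o : {set L} | o \subset marked)
      pieces_val C (fun l => gr (l \in o) (x l)) [:: (g, bdL)]).
    apply: eq_big => [o|o /andP[_ /subsetP sub_o]].
      apply: andb_idl => /subsetP sub_o; apply/subsetP => l /sub_o lm.
      by rewrite mem_cat lm.
    have side_o (s : K * bool) : inr s \notin o by apply/negP => /sub_o /mapP[].
    have filterE (s : seq L) :
        filter (mem o) s = filter (mem o) (map inl (pmap (@marking D K) s)).
      elim: s => //= -[d|s'] s IHs /=; first by rewrite IHs.
      by rewrite (negbTE (side_o s')).
    rewrite /signed_val letters1 !val1.
    have -> : koszul o all_letters (flatten walks) = 1.
      rewrite -[RHS](koszul_id o marked); apply: koszul_filter.
        rewrite filter_cat -[RHS]cats0; congr (_ ++ _).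
        apply/eqP; rewrite -(negbK (_ == _)) -has_filter; apply/hasPn => l.
        by move=> /allpairsPdep[c [e [_ _ ->]]]; apply: side_o.
      rewrite filterE /marked -walks_bd; congr (filter _ (map _ _)).
      by elim: (walks) => //= w ws IHws; rewrite pmap_cat IHws.
    rewrite mul1r; set z := fun l => _.
    have z_side (s : K * bool) : z (inr s) = 1.
      by rewrite /z (negbTE (side_o s)) x_side (hom_gr _ (hom1 A)).
    apply: tft_eq_word_prod; rewrite /bdL -walks_bd -!map_comp.
    apply: eq_map => w /=; elim: w => //= -[d|s] w IHw /=.
      by rewrite !word_prod_cons IHw.
    by rewrite word_prod_cons z_side mul1r IHw.
  rewrite (@sum_gr_expand _ _ (fun z => pieces_val C z [:: (g, bdL)]) marked) //.
  - rewrite val1 /bdL -map_comp; congr (tft _ _ _); apply: eq_map => w /=.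
    by rewrite -map_comp.
  - by move=> u um; apply: pieces_val_additive; rewrite letters1 flat_bdL.
  - by move=> z z' eq_z; apply: eq_pieces_val; rewrite letters1 flat_bdL.
case/andP=> sub_o /subsetPn[l lo l_marked].
have := subsetP sub_o l lo; rewrite mem_cat (negbTE l_marked) orFb.
case/allpairsPdep=> c [e [_ _ def_l]].
rewrite /signed_val (@pieces_val_zero _ _ _ _ l) ?mulr0 //.
- by rewrite letters1 (perm_uniq walks_perm) uniq_all_letters.
- by rewrite letters1 (perm_mem walks_perm) def_l; apply: cut_side_in.
- by rewrite lo def_l x_side (hom_gr _ (hom1 A)).
Qed.

Lemma total_val_same r x P P' : same_surface C P P' ->
  {subset letters P <= r} -> total_val C r x P = total_val C r x P'.
Proof.
by move=> S sP; apply: eq_bigr => o _; apply: (same_val S) => // l; apply: gr_hom.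
Qed.

Lemma eq_total_val r x y P : x =1 y -> total_val C r x P = total_val C r y P.
Proof.
move=> eq_xy; apply: eq_bigr => o _; congr (_ * _).
by apply: eq_pieces_val => l _; rewrite eq_xy.
Qed.

(** One cut is glued at a time until [partly_glued_end] applies. The result remembers only [g] and
    [bd], which is the independence of the cuts. *)
Lemma glue_all U P : partly_glued U P ->
  \sum_(f | supported U f) total_val C all_letters (side_val f) P =
    tft C g (map (map a) bd).
Proof.
have [n] := ubnP #|U|; elim: n U P => // n IHn U P /ltnSE le_U pgP.
have sub_letters Q : perm_eq (letters Q) all_letters -> {subset letters Q <= all_letters}.
  by move=> perm_Q l; rewrite (perm_mem perm_Q).
have [U0|[c cU]] := set_0Vmem U.
  rewrite U0 in pgP *; rewrite (big_pred1 [ffun=> None]) => [|f]; last first.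
    apply/forallP/eqP => [supf|-> c]; last by rewrite ffunE inE.
    by apply/ffunP => c; rewrite ffunE; have := supf c; rewrite inE; case: (f c).
  have S := partly_glued_end pgP.
  rewrite (total_val_same _ S); last exact: sub_letters (pg_letters pgP).
  by apply: total_val_end => c; rewrite ffunE.
have uP : uniq (letters P) by rewrite (perm_uniq (pg_letters pgP)) uniq_all_letters.
have neq_side : cut_side c false != cut_side c true by apply/eqP => -[].
have sideP b : cut_side c b \in letters P.
  by rewrite (perm_mem (pg_letters pgP)) cut_side_in.
have [P1 [P' [S gP]]] := glued_exists C uP neq_side (sideP _) (sideP _).
have pgP1 := partly_glued_same S pgP.
have pgP' := partly_glued_step cU gP pgP1.
rewrite -(IHn _ _ _ pgP'); last by rewrite [#|U|](cardsD1 c) cU in le_U.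
rewrite (sum_supported _ cU); apply: eq_bigr => f supf.
(* [c] is outside the support of [f], so [side_val f] decorates both its sides by 1, as on the glued
   side of [glued_total_val]. *)
have fc : f c = None.
  have /forallP/(_ c) := supf; rewrite !inE eqxx /=.
  by case: (f c).
have [r1 [r2 def_r]] := all_letters_split c.
have uP1 := uniq_same S uP.
transitivity (\sum_j total_val C all_letters (upd2 (side_val f)
    (cut_side c false) (cut_side c true) (c1 j) (c2 j)) P1).
  apply: eq_bigr => j _; rewrite (total_val_same _ S); last first.
    exact: sub_letters (pg_letters pgP).
  apply: eq_total_val => -[d|[c' e]]; rewrite /upd2 /upd //= ffunE.
  by rewrite !cut_side_eq; case: (c' == c); case: e.
rewrite def_r (glued_total_val _ _ gP uP1) -?def_r ?uniq_all_letters //; last first.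
  exact: sub_letters (pg_letters pgP1).
apply: eq_total_val => -[d|[c' e]]; rewrite /upd2 /upd //=.
by rewrite !cut_side_eq; case: (c' =P c) => [->|_]; rewrite ?fc; case: e.
Qed.

End FixedBoundary.
End CutGluing.

Section Discs.
Variables (A : frobenius) (C : casimir A) (L : finType).
Implicit Types (ps : seq (seq L)).

Definition disc_pieces ps : seq (piece L) := [seq (0%N, [:: p]) | p <- ps].

Lemma pwords_disc_pieces ps : pwords (disc_pieces ps) = ps.
Proof. by rewrite /pwords /disc_pieces -map_comp; elim: ps => //= p s ->. Qed.

Lemma letters_disc_pieces ps : letters (disc_pieces ps) = flatten ps.
Proof. by rewrite /letters pwords_disc_pieces. Qed.

Lemma pieces_val_discs (z : L -> A) ps :
  pieces_val C z (disc_pieces ps) = \prod_(p <- ps) bracket (\prod_(l <- p) z l).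
Proof.
rewrite /pieces_val big_map; apply: eq_bigr => p _ /=.
by rewrite tft_disc big_map.
Qed.

End Discs.

(** * Evaluation of local correlation functions *)

Section LocalCorrelation.
Variables (A : frobenius) (C : casimir A) (D : finType) (a : D -> A).
Notation c1 := (@cas1 A C).
Notation c2 := (@cas2 A C).

Lemma side_nextE (K : finType) (ps : seq (seq (letter D K))) w l :
  uniq (flatten ps) -> w \in ps -> l \in w -> side_next ps l = next w l.
Proof.
move=> u_ps w_ps lw; rewrite /side_next.
suff -> : nth [::] ps (find (fun p => l \in p) ps) = w by [].
elim: ps u_ps w_ps => //= p ps IHps; rewrite cat_uniq => /and3P[_ /hasPn dis u_ps].
rewrite inE; case: ifP => [lp|lp] /predU1P[eq_w|w_ps] /=.
- by rewrite eq_w.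
- have /dis : l \in flatten ps by apply/flattenP; exists w.
  by rewrite /= lp.
- by rewrite -eq_w lw in lp.
- exact: IHps.
Qed.

Variables (g : nat) (bd : seq (seq D)).
Hypotheses (uniq_bd : uniq (flatten bd)) (bd_neq0 : bd != [::]).
Variable X : cut_system g bd.
Notation K := 'I_(cut_num X).
Notation ps := (polygons X).

Lemma uniq_polygons : uniq (flatten ps).
Proof. by rewrite (perm_uniq (cut_sides X)); apply: uniq_all_letters. Qed.

Lemma local_corr_total_val :
  local_corr C X a = \sum_(f | supported setT f)
    total_val C (all_letters K bd) (@side_val _ C _ _ a f) (disc_pieces ps).
Proof.
rewrite -(sum_supportedT (fun f => total_val C (all_letters K bd)
  (@side_val _ C _ _ a f) (disc_pieces ps))).
apply: eq_bigr => i _; apply: eq_bigr => o _.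
rewrite /signed_val letters_disc_pieces; congr (_ * _).
rewrite pieces_val_discs; apply: eq_bigr => p _; congr bracket; apply: eq_bigr => l _.
by congr gr; case: l => //= -[c e]; rewrite ffunE.
Qed.

(** A polygon without sides is adjacent to no other one, so in a connected system it is alone. *)
Lemma empty_polygon : [::] \in ps -> ps = [:: [::]].
Proof.
move=> nil_ps; have lt_i : (index [::] ps < size ps)%N by rewrite index_mem.
pose i := Ordinal lt_i; have nth_i : nth [::] ps i = [::] by rewrite nth_index.
have eq_i j : j = i.
  have /connectP[[|k s] /= p_s ->] := @cut_connected _ _ _ X i j => //.
  by case/andP: p_s => /existsP[s']; rewrite nth_i.
have : size ps = 1%N.
  rewrite -[LHS]card_ord; apply/eqP/fintype1P; exists i => j; exact: eq_i.
by move: nil_ps; case: ps => [|p [|]] //; rewrite inE => /eqP<-.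
Qed.

(** The initial state: the flip in [boundary_next] cancels that of [flip_in setT], which leaves the
    cyclic successor in each polygon. *)
Lemma partly_glued_polygons : [::] \notin ps ->
  partly_glued bd g (boundary_next ps) setT (disc_pieces ps).
Proof.
have arith i h j k : (i + 2 * h + j = k + 2)%N ->
    i%:Z - k%:Z = 2 - 2 * h%:Z - j%:Z by lia.
move=> ne_ps; split.
- rewrite letters_disc_pieces; exact: cut_sides.
- rewrite /nexts pwords_disc_pieces; apply/allP => w w_ps.
  have u_w : uniq w.
    move: uniq_polygons; have := perm_flatten (perm_to_rem w_ps).
    by move=> /perm_uniq->; rewrite /= cat_uniq; case/andP.
  have := cycle_next u_w; apply: (@sub_in_cycle _ (mem w)) => // l l' lw _.
  move=> /= /eqP<-; rewrite -(side_nextE uniq_polygons w_ps lw) /boundary_next.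
  by case: (side_next _ _) => [//|[c e]] /=; rewrite inE negbK.
- move=> col /monoP mono_col cuts.
  have col_poly i : {in nth [::] ps i &, forall l l', col l = col l'}.
    have [lt_i|ge_i] := ltnP i (size ps); last by rewrite nth_default.
    have := mono_col (0%N, [:: nth [::] ps i]); rewrite /= cats0; apply.
    by apply/mapP; exists (nth [::] ps i) => //; apply: mem_nth.
  have adj (i j : 'I_(size ps)) : adjacent i j ->
     forall l l', l \in nth [::] ps i -> l' \in nth [::] ps j -> col l = col l'.
    case/existsP=> -[c e] /andP[ci cj] l l' li l'j.
    rewrite (col_poly i _ (inr (c, e))) // (col_poly j l' (inr (c, ~~ e))) //.
    by have := cuts c; rewrite inE => /(_ isT); case: e {ci cj}.
  have conn (i j : 'I_(size ps)) l l' :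
      l \in nth [::] ps i -> l' \in nth [::] ps j -> col l = col l'.
    have /connectP[s p_s ->] := @cut_connected _ _ _ X i j.
    elim: s i l p_s => /= [|k s IHs] i l; first by move=> _ li l'i; apply: (col_poly i).
    case/andP=> adj_ik p_s li l'j.
    have [l0 l0k] : exists l0, l0 \in nth [::] ps k.
      have : nth [::] ps k \in ps by apply: mem_nth.
      case: (nth [::] ps k) => [|l0 s0] => [nil_ps|_]; first by rewrite nil_ps in ne_ps.
      by exists l0; rewrite mem_head.
    by rewrite (adj i k adj_ik l l0) //; apply: (IHs k).
  move=> l l'; rewrite letters_disc_pieces => /flattenP[w w_ps lw].
  case/flattenP=> w' w'_ps l'w'.
  have lt_w : (index w ps < size ps)%N by rewrite index_mem.
  have lt_w' : (index w' ps < size ps)%N by rewrite index_mem.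
  by apply: (conn (Ordinal lt_w) (Ordinal lt_w')); rewrite /= nth_index.
- have := cut_euler X; rewrite cardsT card_ord /euler big_map /=.
  rewrite big_const_seq count_predT.
  have -> : iter (size ps) (+%R (2 - 2 * 0%:Z - 1%:Z)) 0 = (size ps)%:Z.
    by elim: (size ps) => //= n ->; lia.
  exact: arith.
- apply/allP => p /mapP[w w_ps ->] /=; rewrite inE.
  by apply: contra ne_ps => /eqP->.
Qed.

Lemma local_corr_tft : local_corr C X a = tft C g (map (map a) bd).
Proof.
(* The unmarked, uncut disc has an empty word, which [nonempty] forbids; it is evaluated by hand. *)
have [nil_ps|ne_ps] := boolP ([::] \in ps); last first.
  rewrite local_corr_total_val.
  have [walks [perm_w cyc_w ne_w bd_w]] := cut_boundary X.
  have pg := partly_glued_polygons ne_ps.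
  apply: (@glue_all A C D _ a bd g walks (boundary_next ps)) => //.
    by rewrite (permPl perm_w); apply: cut_sides.
  by case: ne_w => // eq_ps; rewrite eq_ps in ne_ps.
have def_ps := empty_polygon nil_ps.
have no_sides : [::] = all_letters K bd.
  by apply/esym/perm_nilP; rewrite perm_sym; have := cut_sides X; rewrite def_ps.
have n0 : cut_num X = 0%N.
  case: (posnP (cut_num X)) => // n_gt0.
  by have := cut_side_in bd (Ordinal n_gt0) true; rewrite -no_sides.
have bd0 : flatten bd = [::].
  by move: no_sides; rewrite /all_letters; case: (flatten bd).
have [g0 bd1] : g = 0%N /\ size bd = 1%N.
  have := cut_euler X; rewrite def_ps n0 /=; case: (bd) bd_neq0 => //= w ws _.
  lia.
have def_bd : bd = [:: [::]].
  by move: bd0 bd1; case: (bd) => [|[|d w] [|v ws]].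
have -> : tft C g (map (map a) bd) = bracket (1 : A).
  by rewrite g0 def_bd tft_disc big_nil.
(* Without cuts there is exactly one choice of Casimir indices. *)
transitivity (\sum_(i : {ffun K -> cas_idx C}) bracket (1 : A)); last first.
  by rewrite sumr_const card_ffun card_ord n0 expn0.
apply: eq_bigr => i _; rewrite /signed_brackets def_ps -/(all_letters _ _) -no_sides.
rewrite (big_pred1 set0) => [|o]; last first.
  apply/subsetP/eqP => [sub_o|-> l]; last by rewrite inE.
  by apply/setP => l; rewrite inE; apply/negP => /sub_o.
by rewrite koszul_id mul1r big_seq1 big_nil.
Qed.

End LocalCorrelation.

(** * Existence of cut systems *)

Section StandardCuts.
Variables D K : finType.
Notation L := (letter D K).
Notation side c b := (inr (c, b) : L).
Implicit Types (cs : seq K) (ws : seq (seq D)) (y z : L) (nx : L -> L).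

(** Cutting along arcs from the first boundary component to the other ones and
    along two loops per handle leaves one polygon, with the word
    [w c_1 v_1 c_1' .. a_1 b_1 a_1' b_1' ..]. *)
Fixpoint handle_word cs : seq L :=
  if cs is a :: b :: cs' then
    [:: side a false, side b false, side a true, side b true & handle_word cs']
  else [::].

Fixpoint cut_word ws cs : seq L :=
  match ws, cs with
  | v :: ws', c :: cs' =>
    side c false :: map inl v ++ side c true :: cut_word ws' cs'
  | _, _ => handle_word cs
  end.

(** Iterating [flip] after the successor visits the segments after all four sides of a handle block
    and then leaves it, so a handle adds no boundary component. *)
Fixpoint handle_walk cs : seq L :=
  if cs is a :: b :: cs' then
    [:: side a true, side b false, side a false, side b true & handle_walk cs']
  else [::].

Fixpoint cut_walk ws cs : seq L :=
  match ws, cs with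
  | v :: ws', c :: cs' => side c true :: cut_walk ws' cs'
  | _, _ => handle_walk cs
  end.

(** After [v] comes [side c true], whose flip is [side c false]: the walk closes up to the boundary
    component carrying [v]. *)
Fixpoint inner_walks ws cs : seq (seq L) :=
  match ws, cs with
  | v :: ws', c :: cs' => (side c false :: map inl v) :: inner_walks ws' cs'
  | _, _ => [::]
  end.

Lemma even_seq_ind (T : Type) (Q : seq T -> Prop) : Q [::] ->
  (forall a b s, Q s -> Q [:: a, b & s]) -> forall s, ~~ odd (size s) -> Q s.
Proof.
move=> Q0 Q2 s; have [n] := ubnP (size s); elim: n s => // n IHn.
case=> [|a [|b s]] //= lt_s; rewrite negbK => even_s; apply: Q2; apply: IHn => //.
by rewrite ltnW.
Qed.

Lemma handle_word_perm cs : ~~ odd (size cs) ->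
  perm_eq (handle_word cs) [seq side c e | c <- cs, e <- [:: false; true]]
  /\ perm_eq (handle_walk cs) (handle_word cs).
Proof.
elim/even_seq_ind => [//|a b s [IH1 IH2]] /=; split.
  apply/permP => q /=; have /permP/(_ q) /= := IH1 => ->.
  by congr (_ + _)%N; rewrite addnCA.
apply/permP => q /=; have /permP/(_ q) := IH2 => ->.
by rewrite addnCA [RHS]addnCA; congr (_ + _)%N; rewrite addnCA.
Qed.

Lemma cut_word_perm ws cs g : size cs = (size ws + 2 * g)%N ->
  perm_eq (cut_word ws cs)
    (map inl (flatten ws) ++ [seq side c e | c <- cs, e <- [:: false; true]])
  /\ perm_eq (cut_walk ws cs ++ flatten (inner_walks ws cs)) (cut_word ws cs).
Proof.
elim: ws cs => [|v ws IHws] cs /=.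
  move=> size_cs; rewrite cats0; apply: handle_word_perm.
  by rewrite size_cs mul2n odd_double.
case: cs => // c cs [/IHws[IH1 IH2]]; split; apply/permP => q /=.
  rewrite map_cat !count_cat /= (permP IH1 q) count_cat /=.
  ring.
rewrite !count_cat /= -(permP IH2 q) !count_cat; ring.
Qed.

Lemma pmap_marking_inl (v : seq D) : pmap (@marking D K) (map inl v) = v.
Proof. by elim: v => //= d v ->. Qed.

Lemma cut_walk_marking ws cs g : size cs = (size ws + 2 * g)%N ->
  pmap (@marking D K) (cut_walk ws cs) = [::]
  /\ map (pmap (@marking D K)) (inner_walks ws cs) = ws.
Proof.
elim: ws cs => [|v ws IHws] cs /=.
  move=> size_cs; split=> //; have : ~~ odd (size cs).
    by rewrite size_cs mul2n odd_double.
  by elim/even_seq_ind.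
case: cs => // c cs [/IHws[IH1 IH2]]; split=> //=; rewrite IH2; congr (_ :: _).
exact: pmap_marking_inl.
Qed.

Lemma inner_walks_nonempty ws cs : [::] \notin inner_walks ws cs.
Proof. by elim: ws cs => [|v ws IHws] [|c cs] //=; rewrite inE IHws. Qed.

Lemma fpath_marked nx y (v : seq D) :
  fpath nx y (map inl v) -> fpath (fun l => flip (nx l)) y (map inl v).
Proof. by elim: v y => //= d v IHv y /andP[/eqP-> /IHv->]; rewrite eqxx. Qed.

Lemma fpath_handle_walk nx y z cs : ~~ odd (size cs) ->
  fpath nx y (rcons (handle_word cs) z) ->
  fpath (fun l => flip (nx l)) y (rcons (handle_walk cs) (flip z)).
Proof.
move=> even_cs; move: y; move: even_cs.
elim/even_seq_ind => [y|a b s IHs y] /=; first by case/andP=> /eqP->; rewrite eqxx.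
case/and5P=> [/eqP-> /eqP-> /eqP-> /eqP-> /IHs->].
by rewrite /= !eqxx.
Qed.

(** [y] precedes the block and [z] follows it; they are arbitrary so that blocks can be chained. *)
Lemma fpath_cut_walk nx y z ws cs g : size cs = (size ws + 2 * g)%N ->
  fpath nx y (rcons (cut_word ws cs) z) ->
  fpath (fun l => flip (nx l)) y (rcons (cut_walk ws cs) (flip z))
  /\ all (fcycle (fun l => flip (nx l))) (inner_walks ws cs).
Proof.
elim: ws cs y => [|v ws IHws] cs y /=.
  move=> size_cs path_cs; split=> //; apply: fpath_handle_walk => //.
  by rewrite size_cs mul2n odd_double.
case: cs => // c cs [size_cs] /= /andP[/eqP nxy].
rewrite rcons_cat cat_path /= => /and3P[path_v /eqP nxc].
case/(IHws _ _ size_cs)=> -> ->; rewrite nxy /= eqxx rcons_path fpath_marked //=.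
by rewrite nxc /= eqxx.
Qed.

End StandardCuts.

Section Existence.
Variables (D : finType) (g : nat) (w : seq D) (ws : seq (seq D)).
Hypothesis uniq_w : uniq (flatten (w :: ws)).

Let n := (size ws + 2 * g)%N.
Let cs := enum 'I_n.
Let q : seq (letter D 'I_n) := cut_word ws cs.
Let p : seq (letter D 'I_n) := map inl w ++ q.

Let size_cs : size cs = (size ws + 2 * g)%N.
Proof. by rewrite size_enum_ord. Qed.

Let p_perm : perm_eq p (all_letters 'I_n (w :: ws)).
Proof.
rewrite /p /all_letters /= map_cat -catA perm_cat2l.
by have [] := cut_word_perm size_cs.
Qed.

Let uniq_p : uniq p.
Proof. by rewrite (perm_uniq p_perm) uniq_all_letters. Qed.

Let flatten_p : flatten [:: p] = p.
Proof. exact: cats0. Qed.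

Lemma standard_boundary : has_boundary [:: p] (w :: ws).
Proof.
exists ((map inl w ++ cut_walk ws cs) :: inner_walks ws cs).
have [mark_walk mark_inner] := cut_walk_marking size_cs.
have [perm1 perm2] := cut_word_perm size_cs.
have bn l : l \in p -> boundary_next [:: p] l = flip (next p l).
  by move=> lp; rewrite /boundary_next (@side_nextE _ _ _ p) ?mem_head ?flatten_p.
have perm_walks : perm_eq ((map inl w ++ cut_walk ws cs) ++
    flatten (inner_walks ws cs)) p by rewrite -catA perm_cat2l.
split.
- by rewrite flatten_p.
- suff : all (fcycle (fun l => flip (next p l)))
      ((map inl w ++ cut_walk ws cs) :: inner_walks ws cs).
    move=> /allP cyc; apply/allP => s s_walk.
    apply: (@sub_in_cycle _ (mem p)) (cyc s s_walk) => [l l' lp _|].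
      by rewrite /= bn.
    apply/allP => l ls; suff: l \in p by []. rewrite -(perm_mem perm_walks).
    by apply/(@flattenP _ (_ :: _)); exists s.
  have cyc_p := cycle_next uniq_p.
  (* The outer walk starts at the first mark of [w]; if [w] is empty it consists of sides of cuts,
     and is entered from the last letter of [q]. *)
  case def_w : w => [|d w']; last first.
    have : fcycle (next p) (inl d :: (map inl w' ++ q)).
      by move: cyc_p; rewrite {2}/p def_w.
    rewrite /= !rcons_cat !cat_path => /andP[/fpath_marked path_w].
    by move/(fpath_cut_walk size_cs) => [-> ->]; rewrite path_w.
  have : fcycle (next p) q by move: cyc_p; rewrite {2}/p def_w.
  case def_q : q => [|z q'] /=.
    move=> _; have := perm_size perm2; rewrite -/q def_q size_cat => /eqP.
    rewrite addn_eq0 !size_eq0 => /andP[/eqP-> /eqP].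
    by have := inner_walks_nonempty ws cs; case: (inner_walks _ _) => [|[|]].
  rewrite rcons_path => /andP[path_q /eqP last_q].
  have : fpath (next p) (last z q') (rcons q z).
    by rewrite def_q /= rcons_path path_q /= !last_q !eqxx.
  move/(fpath_cut_walk size_cs) => [+ ->]; rewrite andbT.
  case: (cut_walk ws cs) => [|t tw] //=; rewrite last_q.
  by case/andP=> /eqP<-.
(* An empty [p] is the unmarked disc, the exception in [has_boundary]. *)
- have [->|ne_p] := eqVneq p [::]; [by right | left].
  rewrite inE negb_or inner_walks_nonempty andbT; apply/eqP => /esym/eqP.
  rewrite -size_eq0 size_cat addn_eq0 !size_eq0 => /andP[w0 walk0].
  move: ne_p; rewrite /p (eqP w0) /= /q => /negP; apply.
  move: walk0; case: (ws) cs size_cs => [|v vs] [|c cs'] //=.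
  by move: cs' => [|b cs'] // _; rewrite /= => -[].
- rewrite /= pmap_cat mark_walk cats0 mark_inner; congr (_ :: _).
  exact: pmap_marking_inl.
Qed.

Lemma standard_cut_system : cut_system g (w :: ws).
Proof.
apply: (@CutSystem _ _ _ n [:: p]).
- by rewrite flatten_p.
- by move=> i j; rewrite (ord1 i) (ord1 j) connect0.
- exact: standard_boundary.
- by rewrite /n /=; lia.
Qed.

End Existence.

(** * Thickened arc systems *)

Section ThickRegions.
Variables (S : arc_system) (m : arcs S -> nat).
Notation letterS := (letter 'I_(nbd S) (arcs S)).
Notation L := (letter 'I_(nbd S) (copy m)).
Notation thick := (@thick_letter S m).

(** The segment following a side of a copy lies on the same boundary component of
    [S] as the segment following the corresponding side of the arc. *)
Definition thin_letter (l : L) : letterS :=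
  match l with inl i => inl i | inr (c, b) => inr (tag c, b) end.

Lemma thin_thick l : thin_letter (thick l) = l.
Proof. by case: l => // -[e b]. Qed.

Lemma thick_letter_inj : injective thick.
Proof. exact: can_inj thin_thick. Qed.

Lemma thin_flip_thick l : thin_letter (flip (thick l)) = flip l.
Proof. by case: l => // -[e b]. Qed.

Definition strip_side (e : arcs S) (kb : 'I_(m e) * bool) : L :=
  let: (k, b) := kb in
  if b then inr (copy_of (lift ord0 k), true)
  else inr (copy_of (widen_ord (leqnSn _) k), false).

Definition strip_sides : seq L :=
  [seq strip_side kb | e <- enum (arcs S),
     kb <- [seq (k, b) | k <- enum 'I_(m e), b <- [:: false; true]]].

Lemma letters_thick :
  letters (thick_regions m) = map thick (intervals S) ++ strip_sides.
Proof.
rewrite /thick_regions letters_cat; congr (_ ++ _).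
  rewrite /intervals /words /letters /pwords.
  elim: (regions S) => //= r rs IHrs.
  by rewrite !flatten_cat map_cat -IHrs map_flatten.
rewrite /strip_sides; elim: (enum (arcs S)) => //= e es IHes.
rewrite letters_cat IHes; congr (_ ++ _).
elim: (enum 'I_(m e)) => //= k ks IHks.
by rewrite letters_cons IHks.
Qed.

(** Forgets the dependent type of the copy number, so that copies of different arcs can be
    compared. *)
Definition copy_rank (l : L) : option (arcs S * nat * bool) :=
  if l is inr (c, b) then Some (tag c, val (tagged c), b) else None.

(** The old regions see copy 0 on the side [true] and copy [m e] on the side [false]; a strip has
    the side [true] of a copy numbered at least 1 and the side [false] of one numbered below
    [m e]. *)
Lemma strip_side_not_thick e (kb : 'I_(m e) * bool) l : strip_side kb != thick l.
Proof.
apply/eqP => /(congr1 copy_rank); case: kb l => k [] [i|[e' []]] //= [].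
by move=> eq_e eq_k; have := ltn_ord k; rewrite eq_k eq_e ltnn.
Qed.

Lemma uniq_thick : uniq (letters (thick_regions m)).
Proof.
rewrite letters_thick cat_uniq (map_inj_uniq thick_letter_inj) intervals_uniq /=.
apply/andP; split.
  apply/hasPn => l /allpairsPdep[e [kb [_ _ ->]]]; apply/mapP => -[l' _ eq_l].
  by have := strip_side_not_thick kb l'; rewrite eq_l eqxx.
apply: allpairs_uniq_dep; first exact: enum_uniq.
  by move=> e _; apply: allpairs_uniq; rewrite ?enum_uniq // => -[? ?] [? ?].
move=> [e [k b]] [e' [k' b']] _ _ /(congr1 copy_rank) /=.
case: b b' => -[] //= [eq_e]; case: _ / eq_e k' => k'.
  by move=> /val_inj ->.
by move=> /val_inj ->.
Qed.

Lemma side_in_thick e (k : 'I_(m e).+1) b :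
  inr (copy_of k, b) \in letters (thick_regions m).
Proof.
rewrite letters_thick mem_cat.
have thick_in b' : thick (inr (e, b')) \in map thick (intervals S).
  by apply/map_f/sides_in.
have strip_in (k' : 'I_(m e)) b' : strip_side (k', b') \in strip_sides.
  apply/allpairsPdep; exists e, (k', b'); split; rewrite ?mem_enum //.
  by apply: allpairs_f; rewrite ?mem_enum //; case: b'.
case: b.
  case: (unliftP ord0 k) => [k' ->|->]; last by rewrite (thick_in true).
  by rewrite (strip_in k' true) orbT.
have [lt_k|ge_k] := ltnP k (m e).
  have -> : k = widen_ord (leqnSn (m e)) (Ordinal lt_k) by apply: val_inj.
  by rewrite (strip_in (Ordinal lt_k) false) orbT.
have -> : k = ord_max.
  by apply: val_inj; apply/eqP; rewrite eqn_leq ge_k -ltnS ltn_ord.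
by rewrite (thick_in false).
Qed.

Lemma flip_in_thick l : l \in letters (thick_regions m) ->
  flip l \in letters (thick_regions m).
Proof. by case: l => // -[[e k] b] _; apply: side_in_thick. Qed.

Lemma uniq_words : uniq (flatten (words S)).
Proof. exact: intervals_uniq. Qed.

(** Inside a strip the walk moves to the neighbouring copy of the same arc, which is invisible in
    [S]; elsewhere it makes the step of [S]. *)
Lemma thin_boundary_next l : l \in letters (thick_regions m) ->
  boundary_next (thick_words m) l \in letters (thick_regions m) /\
  (thin_letter (boundary_next (thick_words m) l) = thin_letter l \/
   thin_letter (boundary_next (thick_words m) l) =
     boundary_next (words S) (thin_letter l)).
Proof.
have u_thick : uniq (flatten (thick_words m)) := uniq_thick.
move=> l_in; have /flattenP[w /flattenP[ws /mapP[r r_in def_ws] w_in] lw] := l_in.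
have w_in' : w \in thick_words m.
  by apply/flattenP; exists ws => //; rewrite def_ws; apply: map_f.
have next_in : next w l \in letters (thick_regions m).
  by apply/flattenP; exists w => //; rewrite mem_next.
rewrite /boundary_next (side_nextE u_thick w_in' lw).
split; first exact: flip_in_thick.
move: r_in; rewrite mem_cat => /orP[/mapP[r0 r0_in def_r]|].
  rewrite def_ws def_r /= in w_in; case/mapP: w_in => w0 w0_in def_w.
  rewrite def_w in lw; case/mapP: lw => l0 l0w ->; right.
  have w0_words : w0 \in words S.
    by apply/flattenP; exists r0.2 => //; apply: map_f.
  have u_w0 : uniq w0.
    move: uniq_words; rewrite (perm_uniq (perm_flatten (perm_to_rem w0_words))) /=.
    by rewrite cat_uniq; case/andP.
  rewrite def_w (next_map thick_letter_inj) // thin_thick.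
  rewrite (side_nextE uniq_words w0_words l0w); exact: thin_flip_thick.
move=> /flattenP[rs /mapP[e _ ->] /mapP[k _ def_r]]; left.
rewrite def_ws def_r /= inE in w_in; rewrite (eqP w_in) in lw *.
have neq_s : inr (copy_of (widen_ord (leqnSn (m e)) k), false) !=
    inr (copy_of (lift ord0 k), true) :> L by apply/eqP.
by rewrite !inE in lw; case/orP: lw => /eqP->; rewrite /= eqxx // ?(negbTE neq_s)
  1?eq_sym ?(negbTE neq_s).
Qed.

Lemma fconnect_thin l0 l : l0 \in letters (thick_regions m) ->
    fconnect (boundary_next (thick_words m)) l0 l ->
  l \in letters (thick_regions m) /\
  fconnect (boundary_next (words S)) (thin_letter l0) (thin_letter l).
Proof.
move=> l0_in /iter_findex <-; elim: (findex _ _ _) => [|k [IHin IHconn]] /=.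
  by split=> //; apply: connect0.
have [in_next [->|->]] := thin_boundary_next IHin; split=> //.
exact: connect_trans IHconn (fconnect1 _ _).
Qed.

Lemma thin_in l : l \in letters (thick_regions m) -> thin_letter l \in intervals S.
Proof.
rewrite letters_thick mem_cat => /orP[/mapP[l0 l0_in ->]|].
  by rewrite thin_thick.
by case/allpairsPdep=> e [[k b] [_ _ ->]]; case: b; apply: sides_in.
Qed.

Section Active.
Variables (inact : {set letterS}) (out : {set 'I_(nbd S)}).

Lemma activeP i l : l \in active m inact out i ->
  l \in letters (thick_regions m) /\
  fconnect (boundary_next (words S)) (base i) (thin_letter l).
Proof.
rewrite mem_filter => /andP[_ l_orb].
have {}l_orb : fconnect (boundary_next (thick_words m)) (thick (base i)) l.
  rewrite fconnect_orbit; move: l_orb.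
  by case: ifP => _ //; rewrite mem_rotr mem_rev.
have := fconnect_thin _ l_orb; rewrite thin_thick; apply.
by rewrite letters_thick mem_cat map_f // base_in.
Qed.

(** An active interval of [i] thins to an interval on the boundary component of [base i], and
    [base_uniq] recovers [i] from it. *)
Lemma active_disjoint i j l :
  l \in active m inact out i -> l \in active m inact out j -> i = j.
Proof.
move=> /activeP[l_in conn_i] /activeP[_ conn_j].
have [k [_ k_uniq]] := base_uniq (thin_in l_in).
by rewrite -(k_uniq _ conn_i) -(k_uniq _ conn_j).
Qed.

Lemma active_uniq i : uniq (active m inact out i).
Proof.
apply: filter_uniq; case: ifP => _; rewrite ?rotr_uniq ?rev_uniq; exact: orbit_uniq.
Qed.

End Active.

End ThickRegions.

(** * Correlators of arc systems without cuts, and their additivity *)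

Section Multiadditive.
Variables (A : frobenius).
Implicit Types (X Y : seq A) (G : seq A -> int).

Definition add_at p X X' X'' : Prop :=
  [/\ size X' = size X, size X'' = size X, X`_p = X'`_p + X''`_p &
   forall q, q != p -> X`_q = X'`_q /\ X`_q = X''`_q].

Definition multiadditive N G := forall p X X' X'', (p < N)%N -> size X = N ->
  add_at p X X' X'' -> G X = G X' + G X''.

Lemma pieces_val_add (C : casimir A) (L : finType) (P : seq (piece L)) u
    (z z' z'' : L -> A) : uniq (letters P) -> u \in letters P ->
    z u = z' u + z'' u -> (forall l, l != u -> z l = z' l /\ z l = z'' l) ->
  pieces_val C z P = pieces_val C z' P + pieces_val C z'' P.
Proof.
move=> uP uinP z_u z_out.
have eq_upd y c : c = y u -> (forall l, l != u -> z l = y l) ->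
    pieces_val C y P = pieces_val C (upd z u c) P.
  move=> -> eq_y; apply: eq_pieces_val => l _; rewrite /upd.
  by have [->|/eq_y] := eqVneq l u.
rewrite (eq_upd z' _ erefl) => [|l /z_out[] //].
rewrite (eq_upd z'' _ erefl) => [|l /z_out[] //].
rewrite -(zmod_morphism_add (pieces_val_additive C uP uinP z)) -z_u.
exact: eq_upd.
Qed.

End Multiadditive.

Section ArcCorrelators.
Variables (A : frobenius) (C : casimir A) (S : arc_system).
Variables (inact : {set letter 'I_(nbd S) (arcs S)}) (out : {set 'I_(nbd S)}).
Implicit Types (X : region_cuts S) (m : arcs S -> nat) (ts : seq (seq A)).

Lemma thick_region_bounded m (r : piece (letter 'I_(nbd S) (copy m))) :
  r \in thick_regions m -> uniq (flatten r.2) /\ r.2 != [::].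
Proof.
move=> r_in; split.
  have : uniq (letters (r :: rem r (thick_regions m))).
    rewrite -(perm_uniq (_ : perm_eq (letters (thick_regions m)) _)) ?uniq_thick //.
    by apply/perm_flatten/perm_flatten/perm_map/perm_to_rem.
  by rewrite letters_cons cat_uniq; case/andP.
move: r_in; rewrite mem_cat => /orP[/mapP[r0 /regions_bounded r0_in ->]|].
  by rewrite /=; case: (r0.2) r0_in.
by case/flattenP=> rs /mapP[e _ ->] /mapP[k _ ->].
Qed.

(** [thick_corr] after each local correlation function is replaced by its value in [tft]: no cuts
    are left. *)
Definition thick_val m ts : int :=
  let src := flatten [seq active m inact out i | i <- enum 'I_(nbd S)] in
  \sum_(o : {set letter 'I_(nbd S) (copy m)} | o \subset src)
    koszul o src (letters (thick_regions m)) *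
    pieces_val C (fun l => gr (l \in o) (decoration inact out ts l)) (thick_regions m).

Lemma thick_corrE X m ts : thick_corr C X inact out m ts = thick_val m ts.
Proof.
rewrite /thick_corr /thick_val; apply: eq_bigr => o _; congr (_ * _).
rewrite /pieces_val [RHS]big_tnth.
apply: eq_bigr => j _; rewrite local_corr_tft //.
  by have [] := thick_region_bounded (mem_tnth j (in_tuple (thick_regions m))).
by have [] := thick_region_bounded (mem_tnth j (in_tuple (thick_regions m))).
Qed.

Definition slot (ts : seq (seq A)) (i : nat) : seq A := nth [::] ts i.

Definition add_slot (i : 'I_(nbd S)) p ts ts' ts'' : Prop :=
  add_at p (slot ts i) (slot ts' i) (slot ts'' i) /\
  forall j, j != i :> nat -> slot ts j = slot ts' j /\ slot ts j = slot ts'' j.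

Lemma decorationE m ts i l : l \in active m inact out i ->
  decoration inact out ts l = (slot ts i)`_(index l (active m inact out i)).
Proof.
move=> l_i; rewrite /decoration; case: pickP => [j l_j|/(_ i)]; last by rewrite l_i.
by rewrite (active_disjoint l_i l_j).
Qed.

(** The factor [p] of slot [i] decorates a single letter [u], which occurs exactly once in the
    regions. *)
Lemma thick_val_add m i p ts ts' ts'' :
    size (active m inact out i) = size (slot ts i) -> (p < size (slot ts i))%N ->
    add_slot i p ts ts' ts'' ->
  thick_val m ts = thick_val m ts' + thick_val m ts''.
Proof.
move=> size_i lt_p [[size' size'' add_p add_q] add_j].
have [l0 _] : exists l0, l0 \in active m inact out i.
  case: (active _ _ _ _) size_i lt_p => [|l s] ; first by move=> /= <-.
  by exists l; rewrite mem_head.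
pose u := nth l0 (active m inact out i) p.
have u_in : u \in active m inact out i by apply: mem_nth; rewrite size_i.
have [u_letters _] := activeP u_in.
rewrite /thick_val -big_split; apply: eq_bigr => o _ /=; rewrite -mulrDr; congr (_ * _).
apply: (pieces_val_add C (u := u)) => //; first exact: uniq_thick.
  rewrite !(decorationE _ u_in) index_uniq ?size_i ?active_uniq //.
  by rewrite add_p raddfD.
move=> l neq_l; rewrite /decoration; case: pickP => // j l_j.
have [eq_j|neq_j] := eqVneq (j : nat) i.
  have {}eq_j : j = i by apply: val_inj.
  rewrite eq_j in l_j *; have [|-> ->] // := add_q (index l (active m inact out i)).
  by apply: contra neq_l => /eqP eq_p; rewrite /u -eq_p nth_index.
by have [e1 e2] := add_j _ neq_j; rewrite /slot in e1 e2; rewrite -e1 -e2.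
Qed.

(** The bound [N] is separated from [ts], so that the correlators being compared share one range of
    multiplicities. *)
Definition arc_val N ts : int :=
  \sum_(m : {ffun arcs S -> 'I_N.+1} |
        [forall i, size (active (fun e => m e) inact out i) == size (slot ts i)])
    thick_val (fun e => m e) ts.

Lemma arc_corrE X ts : arc_corr C X inact out ts = arc_val (size (flatten ts)) ts.
Proof. by apply: eq_bigr => m _; apply: thick_corrE. Qed.

Lemma arc_val_add N (i : 'I_(nbd S)) p ts ts' ts'' : (p < size (slot ts i))%N ->
  add_slot i p ts ts' ts'' -> arc_val N ts = arc_val N ts' + arc_val N ts''.
Proof.
move=> lt_p add_ts; have [[size' size'' _ _] add_j] := add_ts.
have size_eq t : size (slot t i) = size (slot ts i) ->
    (forall j, j != i :> nat -> slot ts j = slot t j) ->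
    arc_val N t = \sum_(m : {ffun arcs S -> 'I_N.+1} |
        [forall i, size (active (fun e => m e) inact out i) == size (slot ts i)])
    thick_val (fun e => m e) t.
  move=> size_t eq_t; apply: eq_bigl => m; apply: eq_forallb => j.
  by have [->|/eq_t->] := eqVneq (j : nat) i; rewrite ?size_t.
rewrite (size_eq ts') => [||j /add_j[]] //.
rewrite (size_eq ts'') => [||j /add_j[]] //.
rewrite -big_split; apply: eq_bigr => m /forallP size_m.
by apply: thick_val_add add_ts => //; apply/eqP.
Qed.

End ArcCorrelators.

(** * Dualization of the Hochschild correlators *)

Section PureCochains.
Variables (A : frobenius) (C : casimir A).
Implicit Types (X Y b y : seq A) (Psi : seq A -> int).
Notation c1 := (@cas1 A C).
Notation c2 := (@cas2 A C).
Notation idx := (cas_idx C * bool)%type.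

Fixpoint all_words N : seq (seq idx) :=
  if N is N'.+1 then [seq i :: h | i <- enum {: idx}, h <- all_words N']
  else [:: [::]].

(** Splitting the second tensor factor into homogeneous components makes
    [cas2h] homogeneous while [cas1h c] and [cas2h c] remain dual families. *)
Definition cas1h (c : idx) : A := c1 c.1.
Definition cas2h (c : idx) : A := gr c.2 (c2 c.1).

Definition dot N b X : int := \prod_(k < N) pairing b`_k X`_k.

Lemma dot_cons N (x x' : A) b X :
  dot N.+1 (x :: b) (x' :: X) = pairing x x' * dot N b X.
Proof. by rewrite /dot big_ord_recl. Qed.

Lemma size_all_words N h : h \in all_words N -> size h = N.
Proof.
elim: N h => [|N IHN] h /=; first by rewrite inE => /eqP->.
by case/allpairsPdep=> i [h' [_ /IHN size_h ->]] /=; rewrite size_h.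
Qed.

Lemma cas1h_expand x : x = \sum_(c : idx) cas1h c *~ pairing (cas2h c) x.
Proof.
rewrite -(pair_bigA _ (fun i p => c1 i *~ pairing (gr p (c2 i)) x)) /=.
rewrite [LHS](cas1E C); apply: eq_bigr => i _.
by rewrite big_bool /= -mulrzDr -pairingDl -gr_sumE.
Qed.

Lemma multiadditive_cons N Psi x : multiadditive N.+1 Psi ->
  multiadditive N (fun X => Psi (x :: X)).
Proof.
move=> PsiD p X X' X'' lt_p size_X [size' size'' add_p add_q].
apply: (PsiD p.+1); rewrite /= ?size_X //; split; rewrite /= ?size' ?size'' //.
by case.
Qed.

Lemma multiadditive_head N Psi X : multiadditive N.+1 Psi -> size X = N ->
  zmod_morphism (fun x => Psi (x :: X)).
Proof.
move=> PsiD size_X; apply: add_zmod_morphism => x y.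
by apply: (PsiD 0%N); rewrite /= ?size_X //; split=> // -[].
Qed.

(** Expanding every argument in the dual families makes [Psi] a combination of functions [dot], to
    which identities of multiadditive functions thus reduce. *)
Lemma multi_expand N Psi X : multiadditive N Psi -> size X = N ->
  Psi X = \sum_(h <- all_words N) Psi (map cas1h h) * dot N (map cas2h h) X.
Proof.
elim: N Psi X => [|N IHN] Psi X PsiD.
  by move/size0nil->; rewrite big_seq1 /dot big_ord0 mulr1.
case: X => // x X [size_X]; rewrite big_allpairs_dep big_enum /=.
rewrite {1}[x]cas1h_expand.
rewrite (zmod_morphism_sum _ _ (multiadditive_head PsiD size_X)).
apply: eq_bigr => c _; rewrite (IHN _ _ (multiadditive_cons (cas1h c) PsiD)) //.
rewrite mulrzz big_distrl /=; apply: eq_bigr => h _.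
by rewrite dot_cons; ring.
Qed.

Section Pure.
Variables (n : nat) (b : seq A).

(** The cochain of the pure tensor with factors [b], up to the sign [cochain_sign]. *)
Definition pure_fun (x : {ffun 'I_n -> A}) : A :=
  b`_0 *~ \prod_(k < n) pairing b`_k.+1 (x k).

Lemma pure_fun_add (k : 'I_n) (x y z : {ffun 'I_n -> A}) :
  (forall j, j != k -> x j = y j /\ x j = z j) -> x k = y k + z k ->
  pure_fun x = pure_fun y + pure_fun z.
Proof.
move=> eq_j add_k; rewrite /pure_fun -mulrzDr; congr (_ *~ _).
rewrite !(bigD1 k (P := xpredT)) //= add_k raddfD mulrDl /=.
congr (_ * _ + _ * _); apply: eq_bigr => j /eq_j[e1 e2]; first by rewrite e1.
by rewrite e2.
Qed.

Definition pure_cochain : cochain A n := Cochain pure_fun_add.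

End Pure.

Definition cochain_sign n (ps : seq bool) : int :=
  (-1) ^+ 'C(#|[set k : 'I_n | nth false ps k.+1]|, 2).

Lemma size_cochain_tensor n (f : cochain A n) u :
  u \in cochain_tensor C f -> size u = n.+1.
Proof.
by case/allpairsPdep=> i [o [_ _ ->]]; rewrite /= size_map size_enum_ord.
Qed.

Lemma sum_cas_pairing p (x x' : A) :
  \sum_i pairing x (gr p (c1 i)) * pairing x' (gr p (c2 i)) = pairing x' (gr p x).
Proof.
rewrite -[in RHS](gr_hom p x) [in RHS](cas2E C (gr p x)) raddf_sum raddf_sum.
apply: eq_bigr => i _; rewrite !raddfMz /= mulrzz.
by rewrite pairing_gr mulrC.
Qed.

(** In each slot, summing over the Casimir index turns the pairings of b_k with [c1] back into b_k,
    and homogeneity of b_k selects its parity, so only the set [o0] survives. *)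
Lemma dot_cochain_tensor n b ps y :
  (forall k, hom (nth false ps k) b`_k) ->
  \sum_(u <- cochain_tensor C (pure_cochain n b)) dot n.+1 y u =
    cochain_sign n ps * dot n.+1 y b.
Proof.
move=> hom_b; rewrite big_allpairs_dep exchange_big !big_enum /=.
have nthE (F : 'I_n -> A) (k : 'I_n) : [seq F k | k <- enum 'I_n]`_k = F k.
  by rewrite (nth_map k) ?size_enum_ord // nth_ord_enum.
pose o0 := [set k : 'I_n | nth false ps k.+1].
have termE (o : {set 'I_n}) :
   \sum_(i : {ffun 'I_n -> cas_idx C}) dot n.+1 y
     ((-1) ^+ 'C(#|o|, 2) * pure_fun b [ffun k => gr (k \in o) (c1 (i k))]
      :: [seq gr (k \in o) (c2 (i k)) | k <- enum 'I_n]) =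
   (-1) ^+ 'C(#|o|, 2) * (pairing y`_0 b`_0 *
     \prod_(k < n) pairing y`_k.+1 (gr (k \in o) b`_k.+1)).
  under [X in _ = _ * (_ * X)]eq_bigr do rewrite -sum_cas_pairing.
  rewrite bigA_distr_bigA !big_distrr /=; apply: eq_bigr => i _.
  rewrite big_split /= /dot big_ord_recl /= -signr_odd signrMz raddfMz /=.
  rewrite signr_odd mulrzz -!mulrA; congr (_ * (_ * (_ * _))).
    by apply: eq_bigr => k _; rewrite ffunE.
  by apply: eq_bigr => k _; rewrite nthE.
under eq_bigr do rewrite big_enum /= termE.
rewrite (bigD1 o0) //= [X in _ + X]big1 ?addr0 => [|o neq_o].
  rewrite /cochain_sign -/o0 /dot [in RHS]big_ord_recl /=.
  congr (_ * (_ * _)); apply: eq_bigr => k _; rewrite inE.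
  by rewrite [gr _ _]hom_b.
have [k neq_k] : exists k, (k \in o) != (k \in o0).
  apply/existsP; apply: contraNT neq_o => /existsPn eq_o.
  by apply/eqP/setP => k; apply/eqP; rewrite -[_ == _]negbK.
rewrite (bigD1 k) //= (hom_gr _ (hom_b k.+1)).
move: neq_k; rewrite inE => /negbTE->.
by rewrite raddf0 mul0r !mulr0.
Qed.

Lemma sum_cochain_tensor n b ps Psi :
  (forall k, hom (nth false ps k) b`_k) -> size b = n.+1 ->
  multiadditive n.+1 Psi ->
  \sum_(u <- cochain_tensor C (pure_cochain n b)) Psi u =
    cochain_sign n ps * Psi b.
Proof.
move=> hom_b size_b PsiD; rewrite [in RHS](multi_expand PsiD size_b).
rewrite big_distrr big_seq.
under eq_bigr => u u_in do rewrite (multi_expand PsiD (size_cochain_tensor u_in)).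
rewrite -big_seq exchange_big /=; apply: eq_bigr => h _.
by rewrite -big_distrr /= (dot_cochain_tensor _ _ hom_b); ring.
Qed.

End PureCochains.

Section TensorPairingAdd.
Variables (A : frobenius) (C : casimir A).

(** A product of brackets is the value of a collection of discs, so [pieces_val_add] applies. *)
Lemma signed_brackets_add (L : finType) (r : seq L) ps u (z z' z'' : L -> A) :
    uniq (flatten ps) -> u \in flatten ps ->
    z u = z' u + z'' u -> (forall l, l != u -> z l = z' l /\ z l = z'' l) ->
  signed_brackets r ps z = signed_brackets r ps z' + signed_brackets r ps z''.
Proof.
move=> u_ps u_in z_u z_out; rewrite /signed_brackets -big_split.
apply: eq_bigr => o _; rewrite /= -mulrDr -!(pieces_val_discs C); congr (_ * _).
apply: (pieces_val_add C (u := u)); rewrite ?letters_disc_pieces //.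
  by rewrite z_u raddfD.
by move=> l /z_out[<- <-].
Qed.

Lemma tensor_pairing_multiadditive N (t : seq A) :
  multiadditive N (fun s => tensor_pairing s t).
Proof.
move=> p X X' X'' lt_p size_X [size' size'' add_p add_q].
rewrite /tensor_pairing; move: size' size''; rewrite size_X => -> ->.
set ps := [seq _ | k <- enum 'I_N].
have def_ps : flatten ps = [seq (b, k) | k <- enum 'I_N, b <- [:: false; true]].
  by rewrite /ps; elim: (enum _) => //= k s ->.
apply: (@signed_brackets_add _ _ _ (false, Ordinal lt_p)); rewrite ?def_ps.
- by apply: allpairs_uniq; rewrite ?enum_uniq // => -[? ?] [? ?] _ _ [-> ->].
- by apply/allpairsPdep; exists (Ordinal lt_p), false; rewrite mem_enum inE.
- by [].
case=> -[] k //= neq_k; apply: add_q; apply: contra neq_k => /eqP eq_k.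
by apply/eqP; congr (_, _); apply: val_inj.
Qed.

End TensorPairingAdd.

Section MultiExt.
Variable T : eqType.
Implicit Types (F : seq T -> int) (ts : seq (seq T)).

Fixpoint choices ts : seq (seq T) :=
  if ts is t :: ts' then [seq u :: us | u <- t, us <- choices ts'] else [:: [::]].

Lemma multi_extE F ts : multi_ext F ts = \sum_(us <- choices ts) F us.
Proof.
elim: ts F => [|t ts IHts] F /=; first by rewrite big_seq1.
by rewrite big_allpairs_dep; apply: eq_bigr => u _; rewrite IHts.
Qed.

Lemma eq_multi_ext F F' ts : {in choices ts, F =1 F'} ->
  multi_ext F ts = multi_ext F' ts.
Proof.
by move=> eq_F; rewrite !multi_extE !big_seq; apply: eq_bigr => us /eq_F.
Qed.

Lemma size_choices ts us : us \in choices ts -> size us = size ts.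
Proof.
elim: ts us => [|t ts IHts] us /=; first by rewrite inE => /eqP->.
by case/allpairsPdep=> u [us' [_ /IHts size_us ->]] /=; rewrite size_us.
Qed.

Lemma nth_choices x0 ts us k : us \in choices ts -> (k < size ts)%N ->
  nth x0 us k \in nth [::] ts k.
Proof.
elim: ts us k => [|t ts IHts] us k //=.
by case/allpairsPdep=> u [us' [ut us'_in ->]]; case: k => //= k; apply: IHts.
Qed.

Lemma choices_set_nth x0 ts k u0 u : (k < size ts)%N -> nth [::] ts k = [:: u0] ->
  choices (set_nth [::] ts k [:: u]) = [seq set_nth x0 us k u | us <- choices ts].
Proof.
elim: ts k => [|t ts IHts] [|k] //= lt_k.
  by move=> -> /=; rewrite !cats0 -map_comp; apply: eq_map.
move=> nth_k; rewrite (IHts k) //; elim: t => //= v t IHt.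
by rewrite map_cat -IHt -!map_comp.
Qed.

End MultiExt.

Section Dualization.
Variables (A : frobenius) (C : casimir A).
Implicit Types (X Y b : seq A) (Psi : seq A -> int).

Lemma multiadditive_slice a k c Psi Y Y' : multiadditive (a + (k + c)) Psi ->
  size Y = a -> size Y' = c -> multiadditive k (fun X => Psi (Y ++ X ++ Y')).
Proof.
move=> PsiD size_Y size_Y' p X X' X'' lt_p size_X [size' size'' add_p add_q].
have nthE (Z : seq A) q : size Z = k -> (Y ++ Z ++ Y')`_q =
    if (q < a)%N then Y`_q else if (q - a < k)%N then Z`_(q - a) else Y'`_(q - a - k).
  by move=> size_Z; rewrite !nth_cat size_Y size_Z.
rewrite size_X in size' size''.
apply: (PsiD (a + p)%N).
- by rewrite ltn_add2l ltn_addr.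
- by rewrite !size_cat size_Y size_X size_Y'.
split; rewrite ?size_cat ?size' ?size'' ?size_X //.
  rewrite !nthE // ltnNge leq_addr /= addKn lt_p; exact: add_p.
move=> q neq_q; rewrite !nthE //; case: ltnP => // le_a.
case: ifP => // _; apply: add_q; apply: contra neq_q => /eqP eq_q.
by rewrite -eq_q subnKC.
Qed.

(** [Y] holds the blocks already chosen, so that each cochain is summed as one slice of [Psi]. *)
Lemma multi_ext_pure (I : eqType) (s : seq I) (n : I -> nat) (b : I -> seq A)
    (ps : I -> seq bool) Y Psi :
    (forall i k, hom (nth false (ps i) k) (b i)`_k) ->
    {in s, forall i, size (b i) = (n i).+1} ->
    multiadditive (size Y + sumn [seq (n i).+1 | i <- s]) Psi ->
  multi_ext (fun us => Psi (Y ++ flatten us))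
    [seq cochain_tensor C (pure_cochain (n i) (b i)) | i <- s] =
  (\prod_(i <- s) cochain_sign (n i) (ps i)) * Psi (Y ++ flatten [seq b i | i <- s]).
Proof.
move=> hom_b; elim: s Y => [|i s IHs] Y size_b PsiD /=.
  by rewrite big_nil mul1r.
have size_flat : size (flatten [seq b i | i <- s]) = sumn [seq (n i).+1 | i <- s].
  rewrite size_flatten /shape -map_comp; congr sumn; apply/eq_in_map => j js /=.
  by rewrite size_b // inE js orbT.
transitivity (\sum_(u <- cochain_tensor C (pure_cochain (n i) (b i)))
    (\prod_(j <- s) cochain_sign (n j) (ps j)) *
    Psi (Y ++ u ++ flatten [seq b j | j <- s])).
  rewrite [LHS]big_seq [RHS]big_seq; apply: eq_bigr => u u_in.
  rewrite (eq_multi_ext (F' := fun us => Psi ((Y ++ u) ++ flatten us))); last first.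
    by move=> us _; rewrite /= catA.
  rewrite IHs ?catA // => [j js|]; first by apply: size_b; rewrite inE js orbT.
  by rewrite size_cat (size_cochain_tensor u_in) -addnA.
rewrite -big_distrr /= big_cons.
rewrite (sum_cochain_tensor C (hom_b i) _ (multiadditive_slice PsiD _ _)) //.
  by ring.
by rewrite size_b // mem_head.
Qed.

Lemma map_nth_index (T I : eqType) (x0 : T) (s : seq I) (t : seq T) :
  uniq s -> size t = size s -> [seq nth x0 t (index i s) | i <- s] = t.
Proof.
move=> us size_t; case: s us size_t => [|i0 s] us size_t; first by case: t size_t.
apply: (@eq_from_nth _ x0); rewrite size_map // => k lt_k.
by rewrite (nth_map i0) // index_uniq.
Qed.

Lemma sign_sq n : (-1) ^+ n * (-1) ^+ n = 1 :> int.
Proof. by rewrite -signr_odd -signr_addb addbb. Qed.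

Variables (S : arc_system) (out : {set 'I_(nbd S)}) (n : 'I_(nbd S) -> nat).

Definition out_shape := [seq (n i).+1 | i <- enum out].

Definition out_block (T : Type) (X : seq T) (i : 'I_(nbd S)) : seq T :=
  nth [::] (reshape out_shape X) (index i (enum out)).

Lemma out_block_flatten (T : eqType) (x : 'I_(nbd S) -> seq T) i :
    (forall i, i \in out -> size (x i) = (n i).+1) -> i \in out ->
  out_block (flatten [seq x i | i <- enum out]) i = x i.
Proof.
move=> size_x i_out; rewrite /out_block.
have -> : out_shape = shape [seq x i | i <- enum out].
  rewrite /shape -map_comp; apply/eq_in_map => j; rewrite mem_enum => j_out /=.
  by rewrite size_x.
rewrite flattenK (nth_map i) ?index_mem ?mem_enum //.
by rewrite nth_index // mem_enum.
Qed.

Lemma flatten_out_block (T : eqType) (X : seq T) : size X = sumn out_shape ->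
  flatten [seq out_block X i | i <- enum out] = X.
Proof.
move=> size_X; rewrite map_nth_index ?enum_uniq //.
  by rewrite reshapeKr // size_X.
by rewrite -(size_map size) -/(shape _) reshapeKl ?size_X // size_map.
Qed.

Lemma size_out_block (T : eqType) (X : seq T) i : size X = sumn out_shape ->
  i \in out -> size (out_block X i) = (n i).+1.
Proof.
move=> size_X i_out; rewrite /out_block -(nth_map _ 0%N) -/(shape _); last first.
  by rewrite -(size_map size) -/(shape _) reshapeKl ?size_X // size_map
    index_mem mem_enum.
rewrite reshapeKl ?size_X // (nth_map i) ?index_mem ?mem_enum //.
by rewrite nth_index // mem_enum.
Qed.

(** [T] is the expansion of [Psi] given by [multi_expand], with each dual word cut into blocks that
    are read as pure cochains. *)
Lemma hoch_dualize Psi : multiadditive (sumn out_shape) Psi ->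
  exists T : seq (int * (forall i, cochain A (n i))),
    forall x, (forall i, i \in out -> size (x i) = (n i).+1) ->
      output_pairing C out T x = Psi (flatten [seq x i | i <- enum out]).
Proof.
move=> PsiD; set N := sumn out_shape in PsiD.
(* These are the signs that [output_pairing] creates, from [cochain_tensor] and from
   [tensor_pairing]. Put into the coefficients beforehand, they occur twice and cancel. *)
pose sgn (h : seq (cas_idx C * bool)) : int :=
  (\prod_(i <- enum out) cochain_sign (n i) (out_block (map snd h) i)) *
  tensor_sign N (map snd h).
exists [seq (Psi (map (@cas1h A C) h) * sgn h,
  fun i => pure_cochain (n i) (out_block (map (@cas2h A C) h) i))
  | h <- all_words C N] => x size_x.
set X := flatten _.
have size_X : size X = N.
  rewrite size_flatten /shape -map_comp; congr sumn; apply/eq_in_map => i.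
  by rewrite mem_enum => i_out /=; rewrite size_x.
rewrite (multi_expand C PsiD size_X) /output_pairing big_map !big_seq.
apply: eq_bigr => h /size_all_words size_h /=.
have size_w : size (map (@cas2h A C) h) = sumn out_shape by rewrite size_map.
have hom_w k : hom (nth false (map snd h) k) (map (@cas2h A C) h)`_k.
  have [lt_k|ge_k] := ltnP k (size h); last by rewrite !nth_default ?size_map //; apply: hom0.
  case: h lt_k {size_h size_w} => // c0 h lt_k.
  by rewrite !(nth_map c0) //; apply: gr_hom.
rewrite (@multi_ext_pure _ _ n (out_block (map (@cas2h A C) h))
  (out_block (map snd h)) [::] (fun Z => tensor_pairing Z X)).
- rewrite /= flatten_out_block // (@tensor_pairingE _ _ _ (map snd h)); last first.
    by move=> k p q; apply: pairing_hom_eq0_l.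
  rewrite size_w -/N -/(dot N _ _).
  have sgn2 : sgn h * sgn h = 1.
    rewrite /sgn mulrACA -big_split big1 /=; last by move=> i _; apply: sign_sq.
    by rewrite mul1r; apply: sign_sq.
  by rewrite [X in _ * X]mulrA -/(sgn h) mulrA -[X in X * _]mulrA sgn2 mulr1.
- move=> i k; rewrite /out_block !nth_reshape; set a := nth 0%N _ _.
  have [lt_k|ge_k] := ltnP k a; first by rewrite !nth_take // !nth_drop.
  have short (T : Type) (Z : seq T) : (size (take a Z) <= k)%N.
    by apply: leq_trans ge_k; rewrite size_take_min geq_minl.
  by rewrite [X in hom _ X]nth_default //; apply: hom0.
- by move=> i; rewrite mem_enum; apply: size_out_block.
- exact: tensor_pairing_multiadditive.
Qed.

End Dualization.

Section HochschildCorrelators.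
Variables (A : frobenius) (C : casimir A) (S : arc_system).
Variables (inact : {set letter 'I_(nbd S) (arcs S)}) (out : {set 'I_(nbd S)}).
Variables (n : 'I_(nbd S) -> nat) (f : forall i, cochain A (n i)).
Implicit Types (X : seq A).

Definition slots X : seq (seq (seq A)) :=
  [seq if i \in out then [:: out_block out n X i] else cochain_tensor C (f i)
  | i <- enum 'I_(nbd S)].

(** All terms have the same total number of tensor factors, so one bound on the multiplicities
    serves the whole sum. *)
Definition hoch_val X : int :=
  multi_ext (arc_val C inact out (sumn [seq (n i).+1 | i <- enum 'I_(nbd S)]))
    (slots X).

Lemma size_slots X : size (slots X) = nbd S.
Proof. by rewrite size_map size_enum_ord. Qed.

Lemma nth_slots X (i : 'I_(nbd S)) : nth [::] (slots X) i =
  if i \in out then [:: out_block out n X i] else cochain_tensor C (f i).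
Proof. by rewrite (nth_map i) ?size_enum_ord // nth_ord_enum. Qed.

Lemma hoch_corrE (cuts : region_cuts S) x :
    (forall i, i \in out -> size (x i) = (n i).+1) ->
  hoch_corr C out cuts inact f x = hoch_val (flatten [seq x i | i <- enum out]).
Proof.
move=> size_x; set X := flatten _.
have size_X : size X = sumn (out_shape out n).
  rewrite size_flatten /shape -map_comp; congr sumn; apply/eq_in_map => i.
  by rewrite mem_enum => i_out /=; rewrite size_x.
have -> : hoch_corr C out cuts inact f x =
    multi_ext (arc_corr C cuts inact out) (slots X).
  congr (multi_ext _ _); apply: eq_map => i; case: ifP => // i_out.
  by rewrite out_block_flatten.
apply: eq_multi_ext => us us_in; rewrite arc_corrE; congr (arc_val _ _ _ _ _).
have size_us := size_choices us_in; rewrite size_slots in size_us.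
rewrite size_flatten; congr sumn; apply: (@eq_from_nth _ 0%N).
  by rewrite /shape size_map size_us size_map size_enum_ord.
rewrite size_map size_us => k lt_k; pose i := Ordinal lt_k.
rewrite (nth_map [::]) ?size_us // (nth_map i) ?size_enum_ord //.
rewrite (_ : nth i (enum 'I_(nbd S)) k = i); last exact: (nth_ord_enum i i).
have := nth_choices [::] us_in (k := k); rewrite size_slots => /(_ lt_k).
rewrite (nth_slots X i); case: ifP => [i_out|_]; last exact: size_cochain_tensor.
by rewrite inE => /eqP->; apply: size_out_block.
Qed.

Lemma nth_out_block X i q : i \in out -> (out_block out n X i)`_q =
  if (q < (n i).+1)%N
  then X`_(flatten_index (out_shape out n) (index i (enum out)) q) else 0.
Proof.
move=> i_out; rewrite /out_block nth_reshape.
have -> : nth 0%N (out_shape out n) (index i (enum out)) = (n i).+1.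
  by rewrite (nth_map i) ?index_mem ?mem_enum // nth_index ?mem_enum.
case: ifP => lt_q; first by rewrite nth_take // nth_drop.
by rewrite nth_default // size_take_min geq_min leqNgt lt_q.
Qed.

Lemma hoch_val_multiadditive : multiadditive (sumn (out_shape out n)) hoch_val.
Proof.
move=> p X X' X'' lt_p size_X [size' size'' add_p add_q].
set sh := out_shape out n in lt_p size_X.
(* Position [p] of the concatenated tensor is the factor [c] of the output block number [r]. *)
have lt_r := reshape_indexP lt_p; have lt_c := reshape_offsetP lt_p.
have pE := reshape_indexK sh p.
set r := reshape_index sh p in lt_r lt_c pE; set c := reshape_offset sh p in lt_c pE.
have [i0 [i0_out def_r]] : exists i0, i0 \in out /\ index i0 (enum out) = r.
  rewrite size_map in lt_r.
  have [i _] : exists i, i \in enum out.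
    by case: (enum out) lt_r => // i s _; exists i; rewrite mem_head.
  exists (nth i (enum out) r); rewrite index_uniq ?enum_uniq //.
  by rewrite -mem_enum mem_nth.
have nth_sh i : i \in out -> nth 0%N sh (index i (enum out)) = (n i).+1.
  by move=> i_out; rewrite (nth_map i) ?index_mem ?mem_enum // nth_index ?mem_enum.
have {}lt_c : (c < (n i0).+1)%N by rewrite -(nth_sh i0) // def_r.
have index_neq i q : i \in out -> (q < (n i).+1)%N -> (i, q) != (i0, c) ->
    flatten_index sh (index i (enum out)) q != p.
  move=> i_out lt_q; apply: contra => /eqP eq_p.
  have eq_r : index i (enum out) = r.
    by rewrite /r -eq_p flatten_indexKl // nth_sh.
  have eq_c : q = c by rewrite /c -eq_p flatten_indexKr // nth_sh.
  have eq_i : i = i0.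
    by rewrite -(nth_index i (_ : i \in enum out)) ?mem_enum // eq_r -def_r
      nth_index ?mem_enum.
  by rewrite eq_i eq_c.
have block_q i q : i \in out -> (i, q) != (i0, c) ->
    (out_block out n X i)`_q = (out_block out n X' i)`_q /\
    (out_block out n X i)`_q = (out_block out n X'' i)`_q.
  move=> i_out neq; rewrite !nth_out_block //; case: ifP => // lt_q.
  exact/add_q/index_neq.
have size_block (Y : seq A) i : size Y = sumn sh -> i \in out ->
    size (out_block out n Y i) = (n i).+1 by apply: size_out_block.
have size_X' : size X' = sumn sh by rewrite size'.
have size_X'' : size X'' = sumn sh by rewrite size''.
have add_block : add_at c (out_block out n X i0) (out_block out n X' i0)
    (out_block out n X'' i0).
  split; rewrite ?size_block //.
    by rewrite !nth_out_block // lt_c def_r pE.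
  by move=> q neq_q; apply: block_q; rewrite // xpair_eqE negb_and neq_q orbT.
have slotsE Y : size Y = sumn sh -> (forall i q, i \in out -> (i, q) != (i0, c) ->
    (out_block out n X i)`_q = (out_block out n Y i)`_q) ->
    slots Y = set_nth [::] (slots X) i0 [:: out_block out n Y i0].
  move=> size_Y eq_Y; apply: (@eq_from_nth _ [::]).
    by rewrite size_set_nth !size_slots (maxn_idPr _).
  move=> k; rewrite size_slots => lt_k; pose i := Ordinal lt_k.
  rewrite nth_set_nth /= -[k]/(val i) !nth_slots (inj_eq val_inj).
  have [->|neq_i] := eqVneq i i0; first by rewrite i0_out.
  case: ifP => // i_out; congr [:: _]; apply: (@eq_from_nth _ 0).
    by rewrite !size_block.
  by move=> q _; apply/esym/eq_Y; rewrite // xpair_eqE negb_and neq_i.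
have lt_i0 : (i0 < size (slots X))%N by rewrite size_slots.
have nth_i0 : nth [::] (slots X) i0 = [:: out_block out n X i0].
  by rewrite nth_slots i0_out.
rewrite /hoch_val (slotsE X') // => [|i q i_out neq]; last by have [] := block_q i q.
rewrite (slotsE X'') // => [|i q i_out neq]; last by have [] := block_q i q.
rewrite !multi_extE !(choices_set_nth [::] _ lt_i0 nth_i0) !big_map -big_split.
rewrite big_seq [RHS]big_seq; apply: eq_bigr => us us_in /=.
have slot_i0 : slot us i0 = out_block out n X i0.
  by have := nth_choices [::] us_in lt_i0; rewrite nth_i0 inE => /eqP.
apply: (@arc_val_add _ _ _ _ _ _ i0 c).
  by rewrite slot_i0 size_block.
split; first by rewrite slot_i0 /slot !nth_set_nth /= eqxx.
by move=> j neq_j; rewrite /slot !nth_set_nth /= (negbTE neq_j).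
Qed.

End HochschildCorrelators.

Lemma region_cuts_exist (S : arc_system) : region_cuts S.
Proof.
move=> m j; have := thick_region_bounded (mem_tnth j (in_tuple (thick_regions m))).
case: (tnth _ j) => g [|w ws] /= [u_r ne_r]; first by [].
exact: standard_cut_system.
Qed.

Theorem corollary5p2 (A : frobenius) (C : casimir A) :
  (forall (S : arc_system) (inact : {set letter 'I_(nbd S) (arcs S)}),
     inhabited (region_cuts S) /\
     forall (out : {set 'I_(nbd S)}) (n : 'I_(nbd S) -> nat)
            (f : forall i, cochain A (n i)),
       exists T : seq (int * (forall i, cochain A (n i))),
         forall X : region_cuts S, hoch_operation C out X inact f T) /\
  (exists Z : nat -> seq (seq A) -> int,
     [/\ otft_of C Z,
         forall Z', otft_of C Z' ->
           forall g w ws, Z' g (w :: ws) = Z g (w :: ws)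
       & forall (D : finType) (g : nat) (w : seq D) (ws : seq (seq D)),
           uniq (flatten (w :: ws)) ->
           inhabited (cut_system g (w :: ws)) /\
           forall (X : cut_system g (w :: ws)) (a : D -> A),
             local_corr C X a =
               bracket ((\prod_(d <- w) a d) *
                        (\prod_(v <- ws) cas_conj C (\prod_(d <- v) a d)) *
                        (\prod_(k < g) cas_handle C)) /\
             local_corr C X a = Z g (map (map a) (w :: ws))]).
Proof.
split=> [S inact|].
  split=> [|out n f]; first by split; apply: region_cuts_exist.
  (* [hoch_val] contains no cuts, so the [T] obtained from it serves every [X]. *)
  have [T TE] := hoch_dualize C (hoch_val_multiadditive C inact (out := out) f).
  by exists T => X x size_x; rewrite TE // (hoch_corrE C inact f X size_x).
exists (tft C); split; first exact: otft_tft.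
  by move=> Z' HZ'; apply: otft_unique HZ'; apply: otft_tft.
move=> D g w ws uniq_w; split; first by split; apply: standard_cut_system.
move=> X a; rewrite local_corr_tft //; split=> //.
rewrite /tft /= /handles_prod /word_prod !big_map prodr_const card_ord mulrA.
by congr (bracket (_ * _ * _)); apply: eq_bigr => v _; rewrite big_map.
Qed.
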